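(* Let $d_1\in\{0,1,\ldots,5\}$ be a constant and let $D_2(n)$ be a monotonically non-decreasing integer-valued function which for all large $n$ satisfies $D_2(n)\ge\max\{d_1,3\}$ and $(d_1,D_2(n))\notin\{(3,3),(5,5)\}$. Then there exists a finite constant $\gamma_{d_1,D_2}>0$ such that $$\left(\frac{|\mathcal{P}(n,d_1,5,0,D_2)|}{n!}\right)^{1/n}\to\gamma_{d_1,D_2}\quad\text{as } n\to\infty.$$
   Context: $\mathcal{P}(n,d_1,d_2,D_1,D_2)$ denotes the set of simple labelled planar graphs on vertex set $\{1,\ldots,n\}$ with minimum degree in $[d_1,d_2]$ and maximum degree in $[D_1,D_2]$; here $D_2$ may depend on $n$, so $\mathcal{P}(n,d_1,5,0,D_2)$ is the set of planar graphs on $\{1,\ldots,n\}$ with all degrees between $d_1$ and $D_2(n)$. *)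

(* Defs.v *)
From HB Require Import structures.
From mathcomp Require Import all_boot all_order all_algebra.
From mathcomp Require Import all_classical all_reals all_analysis.

Set Implicit Arguments.
Unset Strict Implicit.
Unset Printing Implicit Defensive.

Import Order.TTheory GRing.Theory Num.Theory numFieldNormedType.Exports.

Local Open Scope classical_set_scope.
Local Open Scope ring_scope.

(** A graph on [V] is given by its set of edges, an edge being a set of
    vertices; it is simple when every edge has exactly two endpoints. *)
Definition simple_graph (V : finType) (E : {set {set V}}) : bool :=
  [forall e in E, #|e| == 2%N].

Definition degree (V : finType) (E : {set {set V}}) (v : V) : nat :=
  #|[set e in E | v \in e]%SET|.

(** Every degree in a simple graph is at most [#|V|], so the default value of
    the minimum plays no role unless [V] is empty, where the minimum degree
    is 0 by convention. *)
Definition min_degree (V : finType) (E : {set {set V}}) : nat :=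
  \big[minn/#|V|]_(v : V) degree E v.

Definition max_degree (V : finType) (E : {set {set V}}) : nat :=
  \max_(v : V) degree E v.

(** [g] parametrises over [[0, 1]] a simple arc of the plane from [a] to [b];
    its values outside [[0, 1]] are irrelevant. *)
Definition is_arc (R : realType) (g : R -> R * R) (a b : R * R) : Prop :=
  [/\ {within `[0, 1], continuous g},
      {in `[0, 1] &, injective g},
      g 0 = a
    & g 1 = b].

(** Plane drawing: vertices are distinct points [pos v], every edge [e] is a
    simple arc [arc e] joining its endpoints, and the interior of an edge
    contains no vertex and no point of another edge. *)
Definition plane_drawing (R : realType) (V : finType) (E : {set {set V}})
    (pos : V -> R * R) (arc : {set V} -> R -> R * R) : Prop :=
  [/\ injective pos,
      forall e, e \in E ->
        exists u v, e = [set u; v]%SET /\ is_arc (arc e) (pos u) (pos v),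
      forall e v, e \in E -> ~ (arc e @` `]0, 1[) (pos v)
    & forall e e', e \in E -> e' \in E -> e != e' ->
        (arc e @` `]0, 1[) `&` (arc e' @` `[0, 1]) = set0].

Definition planar (R : realType) (V : finType) (E : {set {set V}}) : Prop :=
  exists pos arc, @plane_drawing R V E pos arc.

(** The bounds are integers since the functions of [n] substituted for them
    may take negative values at small [n]. *)
Definition planar_graphs (R : realType) (n : nat) (d1 d2 D1 D2 : int) :
    {set {set {set 'I_n}}} :=
  [set E | [&& simple_graph E, `[< planar R E >],
               d1 <= (min_degree E)%:Z <= d2
             & D1 <= (max_degree E)%:Z <= D2]]%SET.

(* Main.v *)
(* Let a_n, b_n, c_n count the planar graphs on n labelled vertices with all
   degrees in [d1, D] that are, respectively, arbitrary, connected, and still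
   connected after the removal of two suitable edges.

   Two connected planar graphs with edges uv and u'v' can be merged by replacing
   these edges with uu' and vv', which preserves all degrees.  In a plane drawing,
   cut out a small disc around an interior point of uv and map its exterior to a
   half-plane, so that the two ends of uv reach the boundary line; drawings in
   the two complementary half-planes are then glued.  The merge is undone by
   naming u, v, u', v', so that C(m+n, m) c_m c_n <= (m+n)^4 c_(m+n), and c_n/n!
   has a growth rate by a Fekete argument along balanced merges.  Merging with a
   fixed graph bounds b by c up to a polynomial factor, and the component
   decomposition n a_n <= sum_m C(n, m) m b_m a_(n-m) shows that a_n/n! has the
   same growth rate, uniformly enough to let D vary with n.

   Finiteness: planar graphs have no K5 minor, by van Kampen's parity count of
   the crossings in a drawing of K5.  A graph without K5 minor has linearly many
   disjoint pairs of vertices that are adjacent or have the same neighbours;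
   contracting them gives the bound n! L^n (Norine, Seymour, Thomas, Wollan).

   Positivity: explicit straight-line drawings on p and p+1 vertices for p = 4,
   8, 14; merging copies of them reaches every large n.

   Euler's formula is not used: that a planar graph has a vertex of degree at
   most 5 is carried along as part of the definition of the classes. *)
Require Import Defs.
From HB Require Import structures.
From mathcomp Require Import all_boot all_order all_algebra.
From mathcomp Require Import all_classical all_reals all_analysis.
From mathcomp Require Import zify ring lra.
From Stdlib Require Import Btauto.

Set Implicit Arguments.
Unset Strict Implicit.
Unset Printing Implicit Defensive.

Import Order.TTheory GRing.Theory Num.Theory numFieldNormedType.Exports.

Local Open Scope classical_set_scope.
Local Open Scope ring_scope.

(** * K5 and the parity of crossings *)

Section CrossingParity.
Variables (R : realFieldType) (eta : R).
Hypothesis eta_gt0 : 0 < eta.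
Implicit Types (p q u v : R * R) (s : seq (R * R)).

Definition near_pt p q : bool := (`|p.1 - q.1| < eta) && (`|p.2 - q.2| < eta).
Definition far_pt p q : bool :=
  (eta *+ 2 <= `|p.1 - q.1|) || (eta *+ 2 <= `|p.2 - q.2|).

Definition upper v : bool := (0 < v.2) || (v.2 == 0) && (0 < v.1).

Definition crossing u v : bool := (upper u (+) upper v) && (0 < u.1).

(* [crossl] is the parity of the crossings of the polygonal path [p :: s] with
   the horizontal ray to the right of [v], [crossr] with the ray to the left. *)
Fixpoint crossl v p s : bool :=
  if s is q :: s' then crossing (p - v) (q - v) (+) crossl v q s' else false.
Fixpoint crossr v p s : bool :=
  if s is q :: s' then crossing (v - p) (v - q) (+) crossr v q s' else false.

Lemma upper_ge0 u : upper u -> 0 <= u.2.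
Proof. by case/orP => [/ltW //|/andP[/eqP -> _]]. Qed.

Lemma upper_le0 u : ~~ upper u -> u.2 <= 0.
Proof. by rewrite /upper negb_or => /andP[]; rewrite -leNgt. Qed.

Lemma upper_opp u : u != 0 -> upper (- u) = ~~ upper u.
Proof.
case: u => x y; rewrite -pair_eqE /pair_eq /upper /= !oppr_gt0 oppr_eq0.
by case: (ltrgtP y 0) => _; case: (ltrgtP x 0).
Qed.

Definition big_vec v : bool := (eta *+ 2 <= `|v.1|) || (eta *+ 2 <= `|v.2|).
Definition close_vec u v : bool :=
  (`|u.1 - v.1| < eta *+ 2) && (`|u.2 - v.2| < eta *+ 2).

Lemma big_neq0 v : big_vec v -> v != 0.
Proof.
rewrite /big_vec; apply: contraL => /eqP ->; rewrite /= normr0.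
by rewrite orbb -ltNge pmulrn_lgt0.
Qed.

Lemma upper_diff_big u v w : big_vec w -> close_vec u w -> close_vec v w ->
  upper u -> ~~ upper v -> eta *+ 2 <= `|w.1|.
Proof.
case: u v w => [u1 u2] [v1 v2] [w1 w2].
rewrite /big_vec /close_vec /= !ltr_norml !ler_normr.
move=> B /andP[_ /andP[? ?]] /andP[_ /andP[? ?]] /upper_ge0 /= ? /upper_le0 /= ?.
by case/orP: B => [//|] /orP[] ?; exfalso; lra.
Qed.

Lemma close_sym u v : close_vec u v = close_vec v u.
Proof. by rewrite /close_vec [`|u.1 - _|]distrC [`|u.2 - _|]distrC. Qed.

Lemma close_refl u : close_vec u u.
Proof. by rewrite /close_vec !subrr normr0 pmulrn_lgt0 // eta_gt0. Qed.

Lemma close_same_side u v : close_vec u v -> eta *+ 2 <= `|u.1| ->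
  eta *+ 2 <= `|v.1| -> (0 < u.1) = (0 < v.1).
Proof.
case: u v => [u1 u2] [v1 v2]; rewrite /close_vec /= !ltr_norml !ler_normr.
move=> /andP[/andP[? ?] _] /orP[] ? /orP[] ?; apply/idP/idP => ?; lra.
Qed.

Lemma crossing_anti u v : big_vec u -> big_vec v -> close_vec u v ->
  crossing u v (+) crossing (- u) (- v) = upper u (+) upper v.
Proof.
move=> Bu Bv Cuv; rewrite /crossing !upper_opp ?big_neq0 //= oppr_gt0.
case: (boolP (upper u)) (boolP (upper v)) => Uu [] Uv //=.
- have := upper_diff_big Bu (close_refl u) _ Uu Uv.
  by rewrite close_sym Cuv => /(_ isT); case: ltrgtP => // <-; rewrite normr0 leNgt pmulrn_lgt0 // eta_gt0.
- have := upper_diff_big Bu _ (close_refl u) Uv Uu.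
  by rewrite close_sym Cuv => /(_ isT); case: ltrgtP => // <-; rewrite normr0 leNgt pmulrn_lgt0 // eta_gt0.
Qed.

Lemma crossing_cell a b c d :
  big_vec a -> big_vec b -> big_vec c -> big_vec d ->
  close_vec a b -> close_vec a c -> close_vec a d -> close_vec b c -> close_vec b d -> close_vec c d ->
  crossing a b (+) crossing b c (+) crossing c d (+) crossing d a = false.
Proof.
move=> Ba Bb Bc Bd ab ac ad bc bd cd.
have ba : close_vec b a by rewrite close_sym.
have ca : close_vec c a by rewrite close_sym.
have da : close_vec d a by rewrite close_sym.
have cb : close_vec c b by rewrite close_sym.
have db : close_vec d b by rewrite close_sym.
have dc : close_vec d c by rewrite close_sym.
suff : (upper a == upper b) && (upper b == upper c) && (upper c == upper d) \/
  [/\ (0 < a.1) = (0 < b.1), (0 < a.1) = (0 < c.1) & (0 < a.1) = (0 < d.1)].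
  rewrite /crossing; case=> [|[<- <- <-]].
    by move=> /andP[/andP[/eqP -> /eqP ->] /eqP ->]; rewrite !addbb.
  by case: (upper a); case: (upper b); case: (upper c); case: (upper d); case: (0 < a.1).
have key u v : upper u -> ~~ upper v -> close_vec u a -> close_vec u b -> close_vec u c -> close_vec u d ->
   close_vec v a -> close_vec v b -> close_vec v c -> close_vec v d ->
  [/\ (0 < a.1) = (0 < b.1), (0 < a.1) = (0 < c.1) & (0 < a.1) = (0 < d.1)].
  move=> Uu Uv ua ub uc ud va vb vc vd.
  have Ha := upper_diff_big Ba ua va Uu Uv.
  have Hb := upper_diff_big Bb ub vb Uu Uv.
  have Hc := upper_diff_big Bc uc vc Uu Uv.
  have Hd := upper_diff_big Bd ud vd Uu Uv.
  by split; apply: close_same_side.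
have aa := close_refl a; have bb := close_refl b.
have cc := close_refl c; have dd := close_refl d.
case: (boolP (upper a)) => Ua; case: (boolP (upper b)) => Ub;
case: (boolP (upper c)) => Uc; case: (boolP (upper d)) => Ud; try (by left);
 right; solve [exact: (key a b) | exact: (key b a)| exact: (key a c)| exact: (key c a)| exact: (key a d)| exact: (key d a)].
Qed.

Lemma near_close p p' q q' : near_pt p p' -> near_pt q q' ->
  close_vec (p - q) (p' - q').
Proof.
case: p p' q q' => [? ?] [? ?] [? ?] [? ?]; rewrite /near_pt /close_vec /= !ltr_norml.
by move=> /andP[/andP[? ?] /andP[? ?]] /andP[/andP[? ?] /andP[? ?]];
  apply/andP; split; apply/andP; split; lra.
Qed.

Lemma near_pt_refl p : near_pt p p.
Proof. by rewrite /near_pt !subrr normr0 eta_gt0. Qed.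

Lemma near_pt_sym p q : near_pt p q = near_pt q p.
Proof. by rewrite /near_pt [`|p.1 - _|]distrC [`|p.2 - _|]distrC. Qed.

Lemma crossl_strip p p' q s : near_pt p p' -> path near_pt q s ->
  (forall r, r \in q :: s -> far_pt p r /\ far_pt p' r) ->
  crossing (p - q) (p' - q) (+) crossr p q s (+) crossr p' q s
   = crossing (p - last q s) (p' - last q s).
Proof.
move=> npp'; elim: s q => [|q' s IH] q /=; first by rewrite !addbF.
case/andP => nqq' nqs F.
rewrite -(IH q') => //; last by move=> r rs; apply: F; rewrite inE rs orbT.
have [Fq Fq'] := F _ (mem_head _ _).
have [Gq Gq'] : far_pt p q' /\ far_pt p' q'.
  by apply: F; rewrite !inE eqxx orbT.
have nc := near_close; have nr := near_pt_refl; have ns := near_pt_sym.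
have [np'p nq'q] : near_pt p' p /\ near_pt q' q by rewrite ns [near_pt q' _]ns.
have := @crossing_cell (p - q) (p' - q) (p' - q') (p - q') Fq Fq' Gq' Gq
  (nc _ _ _ _ npp' (nr q)) (nc _ _ _ _ npp' nqq') (nc _ _ _ _ (nr p) nqq')
  (nc _ _ _ _ (nr p') nqq') (nc _ _ _ _ np'p nqq')
  (nc _ _ _ _ np'p (nr q')).
have anti u v : big_vec u -> big_vec v -> close_vec u v -> crossing u v = crossing v u.
  move=> Bu Bv Cuv; rewrite /crossing addbC.
  case: (boolP (upper v)) (boolP (upper u)) => Uv [] Uu //=.
    by apply: close_same_side => //;
     [apply: upper_diff_big Uv Uu|apply: upper_diff_big Uv Uu] => //; rewrite ?close_refl // close_sym.
  by apply: close_same_side => //;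
     [apply: upper_diff_big Uu Uv|apply: upper_diff_big Uu Uv] => //; rewrite ?close_refl // close_sym.
rewrite (anti (p' - q') (p - q')) ?(anti (p - q') (p - q)) //;
  try by apply: nc; rewrite // ns.
move: (crossing (p - q) (p - q')) (crossing (p' - q) (p' - q')).
move: (crossing (p - q) (p' - q)) (crossing (p - q') (p' - q')).
move: (crossr _ _ _) (crossr _ _ _).
by do 6! case.
Qed.

Lemma crossl_grid p s q t : path near_pt p s -> path near_pt q t ->
  (forall x y, x \in p :: s -> y \in q :: t -> far_pt x y) ->
  crossl q p s (+) crossl (last q t) p s (+)
  crossr p q t (+) crossr (last p s) q t = false.
Proof.
elim: s p => [|p' s IH] p /=; first by move=> *; rewrite addbb.
case/andP => npp' nps nqt F.
have {}IH := IH p' nps nqt (fun x y xs => F x y (mem_behead (s := p :: _) xs)).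
have /(crossl_strip npp' nqt) :
    forall r, r \in q :: t -> far_pt p r /\ far_pt p' r.
  by move=> r rt; split; apply: F => //; rewrite !inE eqxx ?orbT.
move: IH; move: (crossing _ _) (crossing _ _) (crossl _ _ _) (crossl _ _ _).
move: (crossr _ _ _) (crossr _ _ _) (crossr _ _ _).
by do 7! case.
Qed.

Lemma crossl_crossr v p s : path near_pt p s ->
  (forall x, x \in p :: s -> far_pt x v) ->
  crossl v p s (+) crossr v p s = upper (p - v) (+) upper (last p s - v).
Proof.
elim: s p => [|p' s IH] p /=; first by rewrite addbb.
case/andP => npp' nps F.
have {}IH := IH p' nps (fun x xs => F x (mem_behead (s := p :: _) xs)).
have Fp : far_pt p v by apply: F; rewrite mem_head.
have Fp' : far_pt p' v by apply: F; rewrite !inE eqxx orbT.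
have := @crossing_anti (p - v) (p' - v) Fp Fp' (near_close npp' (near_pt_refl v)).
rewrite !opprB.
move: IH; move: (crossing _ _) (crossing _ _) (crossl _ _ _) (crossr _ _ _).
move: (upper _) (upper _) (upper _).
by do 7! case.
Qed.

(* The deleted product of K5 consists of the 15 squares [ij * kl] with [ij],
   [kl] disjoint.  Each square carries an even number of crossings along its
   boundary by [crossl_grid]; by [crossl_crossr] the sum of these 15 relations
   only involves the signs [upper (X i - X j)], and its value is odd. *)
Lemma K5_chains_cross (X : nat -> R * R) (L : nat -> nat -> seq (R * R)) :
  (forall i j, (i < j < 5)%N -> path near_pt (X i) (L i j)) ->
  (forall i j, (i < j < 5)%N -> last (X i) (L i j) = X j) ->
  (forall i j, (i < j < 5)%N -> far_pt (X i) (X j)) ->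
  (forall i j k x, (i < j < 5)%N -> (k < 5)%N -> k \notin [:: i; j] ->
    x \in X i :: L i j -> far_pt x (X k)) ->
  (forall i j k l x y, (i < j < 5)%N -> (k < l < 5)%N ->
    uniq [:: i; j; k; l] -> x \in X i :: L i j -> y \in X k :: L k l ->
    far_pt x y) -> False.
Proof.
move=> nearL lastL farX farLX farL.
pose sg i j := upper (X i - X j); pose c i j k := crossl (X k) (X i) (L i j).
have sgN i j : (i < j < 5)%N -> sg j i = ~~ sg i j.
  move=> ij; rewrite /sg -upper_opp ?opprB //.
  exact: (@big_neq0 (X i - X j)) (farX i j ij).
have crE i j k : (i < j < 5)%N -> (k < 5)%N -> k \notin [:: i; j] ->
    crossr (X k) (X i) (L i j) = c i j k (+) (sg i k (+) sg j k).
  move=> ij k5 kij; rewrite /sg -(lastL i j ij) -crossl_crossr ?nearL //.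
    by rewrite addbA addbb.
  by move=> x; apply: farLX.
have square i j k l : (i < j < 5)%N -> (k < l < 5)%N -> uniq [:: i; j; k; l] ->
    (c i j k (+) c i j l) (+)
    ((c k l i (+) (sg k i (+) sg l i)) (+) (c k l j (+) (sg k j (+) sg l j)))
    = false.
  move=> ij kl U.
  have := crossl_grid (nearL i j ij) (nearL k l kl)
    (fun x y => @farL i j k l x y ij kl U).
  have [i5 j5] : (i < 5)%N /\ (j < 5)%N by lia.
  have [ik jk] : i \notin [:: k; l] /\ j \notin [:: k; l].
    move: U; rewrite /= !inE !negb_or -!andbA.
    by case/and5P => _ -> -> -> /andP[-> _].
  by rewrite !lastL // !crE // -!addbA.
have e0 := square 0%N 1%N 2%N 3%N isT isT isT.
have e1 := square 0%N 2%N 1%N 3%N isT isT isT.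
have e2 := square 0%N 3%N 1%N 2%N isT isT isT.
have e3 := square 0%N 1%N 2%N 4%N isT isT isT.
have e4 := square 0%N 2%N 1%N 4%N isT isT isT.
have e5 := square 0%N 4%N 1%N 2%N isT isT isT.
have e6 := square 0%N 1%N 3%N 4%N isT isT isT.
have e7 := square 0%N 3%N 1%N 4%N isT isT isT.
have e8 := square 0%N 4%N 1%N 3%N isT isT isT.
have e9 := square 0%N 2%N 3%N 4%N isT isT isT.
have e10 := square 0%N 3%N 2%N 4%N isT isT isT.
have e11 := square 0%N 4%N 2%N 3%N isT isT isT.
have e12 := square 1%N 2%N 3%N 4%N isT isT isT.
have e13 := square 1%N 3%N 2%N 4%N isT isT isT.
have e14 := square 1%N 4%N 2%N 3%N isT isT isT.
have {}sgN i j : (i < j < 5)%N -> sg j i = xorb true (sg i j).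
  by move=> ij; rewrite sgN.
have addb_xorb a b : a (+) b = xorb a b by case: a; case: b.
have add0 a b : a = false -> b = false -> a (+) b = false by move=> -> ->.
move: (add0 _ _ e0 (add0 _ _ e1 (add0 _ _ e2 (add0 _ _ e3 (add0 _ _ e4 (add0 _ _ e5 (add0 _ _ e6 (add0 _ _ e7 (add0 _ _ e8 (add0 _ _ e9 (add0 _ _ e10 (add0 _ _ e11 (add0 _ _ e12 (add0 _ _ e13 e14)))))))))))))).
rewrite !addb_xorb.
rewrite ?(sgN 0%N 1%N isT).
rewrite ?(sgN 0%N 2%N isT).
rewrite ?(sgN 0%N 3%N isT).
rewrite ?(sgN 0%N 4%N isT).
rewrite ?(sgN 1%N 2%N isT).
rewrite ?(sgN 1%N 3%N isT).
rewrite ?(sgN 1%N 4%N isT).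
rewrite ?(sgN 2%N 3%N isT).
rewrite ?(sgN 2%N 4%N isT).
rewrite ?(sgN 3%N 4%N isT).
generalize (sg 0%N 1%N).
generalize (sg 0%N 2%N).
generalize (sg 0%N 3%N).
generalize (sg 0%N 4%N).
generalize (sg 1%N 2%N).
generalize (sg 1%N 3%N).
generalize (sg 1%N 4%N).
generalize (sg 2%N 3%N).
generalize (sg 2%N 4%N).
generalize (sg 3%N 4%N).
generalize (c 0%N 1%N 2%N).
generalize (c 0%N 1%N 3%N).
generalize (c 0%N 1%N 4%N).
generalize (c 0%N 2%N 1%N).
generalize (c 0%N 2%N 3%N).
generalize (c 0%N 2%N 4%N).
generalize (c 0%N 3%N 1%N).
generalize (c 0%N 3%N 2%N).
generalize (c 0%N 3%N 4%N).
generalize (c 0%N 4%N 1%N).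
generalize (c 0%N 4%N 2%N).
generalize (c 0%N 4%N 3%N).
generalize (c 1%N 2%N 0%N).
generalize (c 1%N 2%N 3%N).
generalize (c 1%N 2%N 4%N).
generalize (c 1%N 3%N 0%N).
generalize (c 1%N 3%N 2%N).
generalize (c 1%N 3%N 4%N).
generalize (c 1%N 4%N 0%N).
generalize (c 1%N 4%N 2%N).
generalize (c 1%N 4%N 3%N).
generalize (c 2%N 3%N 0%N).
generalize (c 2%N 3%N 1%N).
generalize (c 2%N 3%N 4%N).
generalize (c 2%N 4%N 0%N).
generalize (c 2%N 4%N 1%N).
generalize (c 2%N 4%N 3%N).
generalize (c 3%N 4%N 0%N).
generalize (c 3%N 4%N 1%N).
generalize (c 3%N 4%N 2%N).
intros; match goal with H : ?a = false |- _ =>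
  have : a = true by btauto
end.
by move=> ?; congruence.
Qed.

End CrossingParity.

(** * Graphs without K5 minor *)

Section CompleteMinors.
Import mathcomp.boot.fintype mathcomp.boot.finset.
Local Open Scope set_scope.
Local Open Scope nat_scope.

Definition within_rel (V : finType) (P : pred V) (e : rel V) : rel V :=
  [rel x y | [&& P x, P y & e x y]].

(* [c] colours the branch sets of a complete minor on [t] vertices; since
   distinct branch sets are adjacent, they are nonempty when [2 <= t]. *)
Definition K_model t (V : finType) (e : rel V) (c : V -> option 'I_t) : Prop :=
  (forall i j, i != j -> exists x y, [/\ c x = Some i, c y = Some j & e x y]) /\
  (forall x y i, c x = Some i -> c y = Some i ->
     connect (within_rel (fun z => c z == Some i) e) x y).

Definition has_K t (V : finType) (e : rel V) : Prop :=
  exists c : V -> option 'I_t, K_model e c.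

Lemma has_K_lift t (V W : finType) (e : rel V) (e' : rel W)
    (phi : V -> option W) :
  (forall a b, e' a b -> exists x y, [/\ phi x = Some a, phi y = Some b & e x y]) ->
  (forall x y a, phi x = Some a -> phi y = Some a ->
     connect (within_rel (fun z => phi z == Some a) e) x y) ->
  has_K t e' -> has_K t e.
Proof.
move=> lift_e fib [c [cadj cconn]]; exists (fun x => obind c (phi x)); split.
  move=> i j /cadj[a [b [ca cb /lift_e[x [y [px py exy]]]]]].
  by exists x, y; rewrite px py.
move=> x y i; case px : (phi x) => [a|//] /= ca; case py : (phi y) => [b|//] /= cb.
have fibc z w d : c d = Some i -> phi z = Some d -> phi w = Some d ->
    connect (within_rel (fun z => obind c (phi z) == Some i) e) z w.
  move=> cd pz pw; apply: connect_sub (fib _ _ _ pz pw) => u v.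
  case/and3P => /eqP pu /eqP pv euv; apply: connect1.
  by rewrite /within_rel /= pu pv /= cd eqxx.
have /connectP[p] := cconn _ _ _ ca cb.
elim: p a ca x px => [|d p IH] a ca x px /=.
  by move=> _ E; apply: (fibc _ _ a) => //; rewrite py E.
case/andP => /and3P[_ /eqP cd ead] pdp lastp.
have [x1 [y1 [px1 py1 exy1]]] := lift_e _ _ ead.
apply: connect_trans (fibc _ _ _ ca px px1) _.
apply: connect_trans (connect1 _) (IH d cd y1 py1 pdp lastp).
by rewrite /within_rel /= px1 py1 /= ca cd eqxx.
Qed.

Lemma has_K_sub t (V : finType) (e e' : rel V) :
  subrel e' e -> has_K t e' -> has_K t e.
Proof.
move=> sub; apply: (@has_K_lift t V V e e' Some).
  by move=> a b /sub eab; exists a, b.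
by move=> x y a [->] [->]; apply: connect0.
Qed.

Variable V : finType.
Implicit Types (e h : rel V) (A B X : {set V}).

Definition nbrs e x := [set y | e x y].
Definition arcs e := [set p : V * V | e p.1 p.2].
Definition supported A e := forall x y, e x y -> (x \in A) && (y \in A).

Lemma card_arcs e : #|arcs e| = \sum_x #|nbrs e x|.
Proof.
rewrite -sum1_card (eq_bigl (fun p => e p.1 p.2)); last by move=> p; rewrite inE.
rewrite -(pair_big_dep xpredT e (fun _ _ => 1)) /=.
by apply: eq_bigr => x _; rewrite sum1dep_card; apply: eq_card => y; rewrite !inE.
Qed.

Lemma card_arcs_supp A e : supported A e -> #|arcs e| = \sum_(x in A) #|nbrs e x|.
Proof.
move=> sA; rewrite card_arcs [RHS]big_mkcond; apply: eq_bigr => x _.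
case: ifP => // /negbT xA; apply/eqP; rewrite cards_eq0 -subset0.
by apply/subsetP => y; rewrite inE => /sA /andP[/(negP xA)].
Qed.

Definition contract e u v : rel V := [rel x y |
  [&& x != v, y != v, x != y & [|| e x y, (x == u) && e v y | (y == u) && e v x]]].

Lemma contract_sym e u v : symmetric e -> symmetric (contract e u v).
Proof.
move=> se x y; rewrite /contract /= (eq_sym y x) (se y x).
by rewrite andbCA [X in e x y || X]orbC.
Qed.

Lemma contract_has_K t e u v : symmetric e -> e u v ->
  has_K t (contract e u v) -> has_K t e.
Proof.
move=> se euv.
apply: (@has_K_lift _ _ _ _ _ (fun x => Some (if x == v then u else x))).
  move=> a b /and4P[/negPf av /negPf bv ab /or3P[eab|/andP[/eqP -> evb]|/andP[/eqP -> eva]]].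
  - by exists a, b; rewrite av bv.
  - by exists v, b; rewrite eqxx bv.
  - by exists a, v; rewrite eqxx av se.
have key x a : Some (if x == v then u else x) = Some a -> x = a \/ (x = v /\ a = u).
  by case: eqP => [->|_] [->]; [right|left].
have sc a : symmetric (within_rel
     (fun z => Some (if z == v then u else z) == Some a) e).
  by move=> x y; rewrite /within_rel /= se andbCA.
have uv : connect (within_rel
     (fun z => Some (if z == v then u else z) == Some u) e) u v.
  by apply: connect1; rewrite /within_rel /= eqxx euv eqxx; case: ifP; rewrite eqxx.
move=> x y a /key Hx /key Hy.
case: Hx => [xa|[xv au]]; case: Hy => [ya|[yv au']]; subst; rewrite ?connect0 //.
by rewrite sym_connect_sym.
Qed.

Lemma card_contract A e u v : symmetric e -> irreflexive e -> e u v ->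
  #|arcs e| <= #|arcs (contract e u v)| + 2 * (#|nbrs e u :&: nbrs e v|).+1.
Proof.
move=> se ie euv; have uv : u != v by apply: contraL euv => /eqP ->; rewrite ie.
pose Q := [set p in arcs e | (p.1 != v) && (p.2 != v)].
pose M := nbrs e v :\: (u |: nbrs e u).
have Nv : #|nbrs e v| <= #|M| + #|nbrs e u :&: nbrs e v|.+1.
  rewrite /M -(cardsID (u |: nbrs e u) (nbrs e v)) addnC leq_add2l.
  rewrite setIC setIUl; apply: leq_trans (leq_card_setU _ _) _.
  rewrite -add1n leq_add2r; apply: leq_trans (subset_leq_card (subsetIl _ _)) _.
  by rewrite cards1.
have E1 : arcs e \subset Q :|: [set (v, y) | y in nbrs e v] :|: [set (y, v) | y in nbrs e v].
  apply/subsetP => -[x y]; rewrite !inE /= => exy; rewrite exy /=.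
  case: (eqVneq x v) => [xv|xv].
    by rewrite xv in exy *; rewrite imset_f ?inE //= orbT.
  case: (eqVneq y v) => [yv|yv] //=.
  by rewrite yv in exy *; rewrite [X in _ || X]imset_f ?orbT // inE se.
have E2 : Q :|: [set (u, y) | y in M] :|: [set (y, u) | y in M]
   \subset arcs (contract e u v).
  apply/subsetP => -[x y]; rewrite !inE /contract /= -orbA => /or3P[].
  - case/and3P => exy -> ->; rewrite exy /= andbT.
    by apply: contraL exy => /eqP ->; rewrite ie.
  - case/imsetP => z; rewrite !inE negb_or => /andP[/andP[zu _] evz] [-> ->].
    rewrite uv eqxx evz orbT andbT (eq_sym u z) zu andbT.
    by apply: contraL evz => /eqP ->; rewrite ie.
  - case/imsetP => z; rewrite !inE negb_or => /andP[/andP[zu _] evz] [-> ->].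
    rewrite uv eqxx evz !orbT zu !andbT.
    by apply: contraL evz => /eqP ->; rewrite ie.
apply: leq_trans (subset_leq_card E1) _.
apply: (@leq_trans (#|Q| + 2 * #|nbrs e v|)).
  apply: leq_trans (leq_card_setU _ _) _.
  apply: leq_trans (leq_add (leq_card_setU _ _) (leqnn _)) _.
  by rewrite mul2n -addnn addnA !leq_add ?leq_imset_card.
apply: (@leq_trans (#|Q| + 2 * #|M| + 2 * #|nbrs e u :&: nbrs e v|.+1)).
  by rewrite -addnA -mulnDr leq_add2l leq_mul2l Nv.
rewrite leq_add2r; apply: leq_trans (subset_leq_card E2).
have d1 : Q :&: [set (u, y) | y in M] = set0.
  apply/setP => -[x y]; rewrite !inE /=.
  apply/negP => /andP[/and3P[exy _ _] /imsetP[z]]; rewrite !inE negb_or.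
  by move=> /andP[/andP[_ nuz] _] [xu yz]; rewrite -xu -yz exy in nuz.
have d2 : (Q :|: [set (u, y) | y in M]) :&: [set (y, u) | y in M] = set0.
  apply/setP => -[x y]; rewrite !inE /=.
  apply/negP => /andP[H /imsetP[z]]; rewrite !inE negb_or.
  move=> /andP[/andP[zu nuz] _] [xz yu]; case/orP: H => [/and3P[exy _ _]|].
    by rewrite -xz -yu se exy in nuz.
  case/imsetP => w; rewrite !inE negb_or => /andP[/andP[wu _] _] [_ yw].
  by rewrite -yw yu eqxx in wu.
rewrite !cardsU d1 d2 cards0 !subn0 !card_imset; last 2 first.
  by move=> a b [].
  by move=> a b [].
by rewrite mul2n -addnn addnA.
Qed.

Lemma mader t A e : symmetric e -> irreflexive e -> supported A e ->
  0 < #|A| -> 2 ^ t.+1 * #|A| <= #|arcs e| -> has_K t.+2 e.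
Proof.
elim: t A e => [|t IHt] A e.
  move=> se ie sA A0 H.
  have : arcs e != set0.
    by rewrite -card_gt0; apply: leq_trans H; rewrite muln_gt0.
  case/set0Pn => -[x y]; rewrite inE /= => exy.
  have xy : x != y by apply: contraL exy => /eqP ->; rewrite ie.
  pose c z : option 'I_2 :=
    if z == x then Some ord0 else if z == y then Some ord_max else None.
  exists c; rewrite /c; split.
    have ord2 (i : 'I_2) : i = ord0 \/ i = ord_max.
      by case: i => -[|[|//]] H2; [left|right]; apply: val_inj.
    move=> i j; case: (ord2 i) => ->; case: (ord2 j) => ->; rewrite ?eqxx //= => _.
      by exists x, y; rewrite !eqxx eq_sym (negPf xy).
    by exists y, x; rewrite !eqxx eq_sym (negPf xy) se.
  have cinj z i : c z = Some i -> z = if i == ord0 then x else y.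
    rewrite /c; case: eqP => [-> [<-] //|_].
    by case: eqP => [-> [<-] //|].
  by move=> z w i /cinj -> /cinj ->; apply: connect0.
move: {2}#|A| (leqnn #|A|) => n; elim: n A e => [|n IHn] A e An se ie sA A0 H.
  by rewrite lt0n -leqn0 An in A0.
case: (boolP [exists p : V * V, e p.1 p.2 && (#|nbrs e p.1 :&: nbrs e p.2| < 2 ^ t.+1)]).
  case/existsP => -[u v] /andP[/= euv small].
  have uv : u != v by apply: contraL euv => /eqP ->; rewrite ie.
  have /andP[uA vA] := sA _ _ euv.
  apply: (contract_has_K se euv); apply: (IHn (A :\ v)).
  - by rewrite (cardsD1 v) vA in An.
  - exact: contract_sym.
  - by move=> x; rewrite /contract /= eqxx !andbF.
  - move=> x y /and4P[xv yv _ exy]; rewrite !inE xv yv /=.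
    by case/or3P: exy => [/sA //|/andP[/eqP -> /sA/andP[_ ->]]
      |/andP[/eqP -> /sA/andP[_ ->]]]; rewrite uA.
  - by rewrite card_gt0; apply/set0Pn; exists u; rewrite !inE uv.
  have := card_contract A se ie euv.
  rewrite (cardsD1 v A) vA in H; rewrite expnS in H *.
  move: small H; rewrite add1n mulnS.
  move: #|nbrs e u :&: nbrs e v| (2 ^ t.+1) #|arcs e| => c k p.
  move: #|arcs (contract e u v)| #|A :\ v| => p' a.
  by rewrite -mulnA; move: (k * a) => ka; lia.
rewrite negb_exists => /forallP large.
have : arcs e != set0.
  by rewrite -card_gt0; apply: leq_trans H; rewrite muln_gt0 expn_gt0.
case/set0Pn => -[v w]; rewrite inE /= => evw.
pose B := nbrs e v; pose eB := within_rel (mem B) e.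
have : has_K t.+2 eB.
  have sB : supported B eB by move=> x y /and3P[xB yB _]; apply/andP.
  apply: (IHt B).
  - by move=> x y; rewrite /eB /within_rel /= se andbCA.
  - by move=> x; rewrite /eB /within_rel /= ie !andbF.
  - exact: sB.
  - by rewrite card_gt0; apply/set0Pn; exists w; rewrite inE.
  rewrite (card_arcs_supp sB) mulnC -sum_nat_const; apply: leq_sum => x xB.
  have := large (v, x); rewrite /= -/B; have -> /= : e v x by rewrite inE in xB.
  rewrite -leqNgt => /leq_trans; apply; apply: subset_leq_card.
  apply/subsetP => y /setIP[vy xy]; rewrite inE.
  by apply/and3P; split=> //; rewrite inE in xy.
case=> c [cadj cconn].
pose c' x := if x == v then Some ord_max else
  if x \in B then omap (lift ord_max) (c x) else None.
have c'B x i : x \in B -> c x = Some i -> c' x = Some (lift ord_max i).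
  move=> xB cx; rewrite /c' xB cx /=; case: eqP => // xv.
  by move: xB; rewrite xv inE ie.
have c'v : c' v = Some ord_max by rewrite /c' eqxx.
exists c'; split.
  have cB i : exists x, [/\ x \in B & c x = Some i].
    have [j ij] : exists j, i != j.
      case: (eqVneq i ord0) => [->|]; last by exists ord0.
      by exists ord_max.
    by have [x [y [cx _ /and3P[xB _ _]]]] := cadj _ _ ij; exists x.
  move=> i j; case: (unliftP ord_max i) => [i'|] ->;
    case: (unliftP ord_max j) => [j'|] ->; last by rewrite eqxx.
  - rewrite (inj_eq lift_inj) => /cadj[x [y [cx cy /and3P[xB yB exy]]]].
    by exists x, y; split; rewrite ?(c'B _ _ xB cx) ?(c'B _ _ yB cy).
  - have [x [xB cx]] := cB i'; move=> _; exists x, v; split; rewrite ?(c'B _ _ xB cx) //.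
    by rewrite inE in xB; rewrite se.
  - have [x [xB cx]] := cB j'; move=> _; exists v, x; split; rewrite ?(c'B _ _ xB cx) //.
    by rewrite inE in xB.
have c'inv x i : c' x = Some i ->
   (x = v /\ i = ord_max) \/ exists j, [/\ x \in B, c x = Some j & i = lift ord_max j].
  rewrite /c'; case: eqP => [-> [<-]|_]; first by left.
  by case: ifP => // xB; case: (c x) => [j|//] [<-]; right; exists j.
move=> x y i /c'inv[[-> ->]|[j [xB cx ->]]] /c'inv[[-> E]|[j' [yB cy E]]].
- exact: connect0.
- by have := neq_lift ord_max j'; rewrite -E eqxx.
- by have := neq_lift ord_max j; rewrite E eqxx.
rewrite -(lift_inj E) in cy.
apply: connect_sub (cconn _ _ _ cx cy) => a b /and3P[/eqP ca /eqP cb /and3P[aB bB eab]].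
by apply: connect1; rewrite /within_rel /= (c'B _ _ aB ca) (c'B _ _ bB cb) eqxx.
Qed.

End CompleteMinors.

Section GoodPairs.
Import mathcomp.boot.fintype mathcomp.boot.finset.
Local Open Scope set_scope.
Local Open Scope nat_scope.
Variable V : finType.
Implicit Types (e h : rel V) (A B X Z K : {set V}).

Lemma noK5_arcs A e : symmetric e -> irreflexive e -> supported A e ->
  ~ has_K 5 e -> #|arcs e| <= 16 * #|A|.
Proof.
move=> se ie sA noK; case: (posnP #|A|) => [A0|A0].
  rewrite (card_arcs_supp sA) big1 // => x xA.
  by rewrite (cardD1 x) xA in A0.
rewrite leqNgt; apply/negP => /ltnW H; apply: noK.
exact: (@mader _ 3 A).
Qed.

Lemma noK5_low_degree A e : symmetric e -> irreflexive e -> supported A e ->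
  ~ has_K 5 e -> 0 < #|A| -> exists2 v, v \in A & #|nbrs e v| <= 16.
Proof.
move=> se ie sA noK A0; apply/exists_inP; apply: contraT => /exists_inPn H.
exfalso; have := noK5_arcs se ie sA noK; rewrite (card_arcs_supp sA) leqNgt => /negP; apply.
apply: (@leq_trans (\sum_(x in A) 17)); first by rewrite sum_nat_const mulnC ltn_pmul2l.
by apply: leq_sum => x xA; rewrite ltnNge; apply: H.
Qed.

Definition clique e K := [forall x in K, forall y in K, (x != y) ==> e x y].

Lemma noK5_cliques A e : symmetric e -> irreflexive e -> supported A e ->
  ~ has_K 5 e -> #|[set K : {set V} | (K \subset A) && clique e K]| <= 2 ^ 16 * #|A| + 1.
Proof.
move: {2}#|A| (erefl #|A|) => n; elim: n A e => [|n IH] A e An se ie sA noK.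
  rewrite An muln0 add0n -(cards1 (set0 : {set V})); apply: subset_leq_card.
  move/eqP: An; rewrite cards_eq0 => /eqP ->.
  by apply/subsetP => K; rewrite !inE subset0 => /andP[].
have [v vA vN] := noK5_low_degree se ie sA noK (ltac:(by rewrite An)).
pose A' := A :\ v; pose e' := within_rel (mem A') e.
have sube : subrel e' e by move=> x y /and3P[].
have IH' : #|[set K : {set V} | (K \subset A') && clique e' K]| <= 2 ^ 16 * #|A'| + 1.
  apply: IH.
  - by move: An; rewrite (cardsD1 v) vA => -[].
  - by move=> x y; rewrite /e' /within_rel /= se andbCA.
  - by move=> x; rewrite /e' /within_rel /= ie !andbF.
  - by move=> x y /and3P[xB yB _]; apply/andP.
  - by move=> /(has_K_sub sube).
set C := [set K | _]; set C' := [set K | _] in IH'.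
have sub : C \subset C' :|: [set v |: K | K in powerset (nbrs e v)].
  apply/subsetP => K; rewrite !inE => /andP[KA cK].
  case: (boolP (v \in K)) => vK.
    apply/orP; right; apply/imsetP; exists (K :\ v); last by rewrite setD1K.
    rewrite inE; apply/subsetP => x; rewrite !inE => /andP[xv xK].
    by move/forall_inP: cK => /(_ v vK)/forall_inP/(_ x xK); rewrite eq_sym xv.
  have KA' : K \subset A' by rewrite subsetD1 KA.
  rewrite KA' /=; apply/orP; left; apply/forall_inP => x xK; apply/forall_inP => y yK.
  apply/implyP => xy; apply/and3P; split; try exact: (subsetP KA').
  by move/forall_inP: cK => /(_ x xK)/forall_inP/(_ y yK); rewrite xy.
apply: leq_trans (subset_leq_card sub) _.
apply: leq_trans (leq_card_setU _ _) _.
apply: leq_trans (leq_add IH' (leq_imset_card _ _)) _.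
have P16 : #|powerset (nbrs e v)| <= 2 ^ 16 by rewrite card_powerset leq_exp2l.
rewrite (cardsD1 v A) vA -/A' add1n mulnS.
by move: (2 ^ 16) #|powerset _| P16 => c p; move: (c * _); lia.
Qed.

(* Process the vertices [y] of the independent set [Z] one by one: if two
   neighbours of [y] are not yet adjacent in [h], contract [y] onto one of them,
   which makes them adjacent. *)
Lemma independent_minor e X Z : symmetric e -> irreflexive e ->
  [disjoint X & Z]%B -> (forall y, y \in Z -> nbrs e y \subset X) ->
  exists h (Z0 : {set V}), [/\ symmetric h, irreflexive h, supported X h,
    Z0 \subset Z & #|arcs h| = 2 * #|Z0|] /\
    (forall y, y \in Z :\: Z0 -> clique h (nbrs e y)) /\
    exists phi : V -> option V,
    [/\ forall x, x \in X -> phi x = Some x,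
      forall x, x \notin X -> x \notin Z0 -> phi x = None,
      forall y, y \in Z0 -> exists2 a, phi y = Some a & e y a &
      forall a b, h a b -> exists x y, [/\ phi x = Some a, phi y = Some b & e x y]].
Proof.
move=> se ie; move: {2}#|Z| (erefl #|Z|) => n; elim: n Z => [|n IH] Z Zn dXZ NZ.
  move/eqP: Zn; rewrite cards_eq0 => /eqP ->.
  exists (fun _ _ => false), set0; split; [split=> //|split].
  - by rewrite cards0 muln0; apply/eqP; rewrite cards_eq0; apply/eqP/setP => p; rewrite !inE.
  - by move=> y; rewrite !inE andbF.
  exists (fun x => if x \in X then Some x else None); split=> //.
  - by move=> x ->.
  - by move=> x /negPf ->.
  - by move=> y; rewrite inE.
have /set0Pn[y yZ] : Z != set0 by rewrite -card_gt0 Zn.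
have dX' : [disjoint X & Z :\ y]%B.
  by apply: disjointWr dXZ; apply: subD1set.
have [h [Z0 [[sh ih suph Z0Z ph] [hc [phi [phi1 phi2 phi3 phi4]]]]]] :
   exists h (Z0 : {set V}), [/\ symmetric h, irreflexive h, supported X h,
    Z0 \subset Z :\ y & #|arcs h| = 2 * #|Z0|] /\
    (forall y0, y0 \in (Z :\ y) :\: Z0 -> clique h (nbrs e y0)) /\
    exists phi : V -> option V,
    [/\ forall x, x \in X -> phi x = Some x,
      forall x, x \notin X -> x \notin Z0 -> phi x = None,
      forall y, y \in Z0 -> exists2 a, phi y = Some a & e y a &
      forall a b, h a b -> exists x y, [/\ phi x = Some a, phi y = Some b & e x y]].
  apply: IH => //; first by move: Zn; rewrite (cardsD1 y) yZ => -[].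
  by move=> z /setD1P[_ /NZ].
have yX : y \notin X by rewrite disjoint_sym in dXZ; rewrite (disjointFr dXZ).
have yZ0 : y \notin Z0 by apply/negP => /(subsetP Z0Z); rewrite !inE eqxx.
have Z0Z' : Z0 \subset Z by apply: subset_trans Z0Z (subD1set _ _).
case: (boolP (clique h (nbrs e y))) => [cy|].
  exists h, Z0; split; [by []|split; last by exists phi].
  move=> z; rewrite inE => /andP[zZ0 zZ]; case: (eqVneq z y) => [->//|zy].
  by apply: hc; rewrite !inE zZ0 zy.
case/forall_inPn => a ya /forall_inPn[b yb]; rewrite negb_imply => /andP[ab nab].
have aX := subsetP (NZ y yZ) _ ya; have bX := subsetP (NZ y yZ) _ yb.
pose h' : rel V := [rel u v | [|| h u v, (u == a) && (v == b) | (u == b) && (v == a)]].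
exists h', (y |: Z0); split; [split|split].
- by move=> u v; rewrite /h' /= sh [X in _ || X]orbC (andbC (u == a)) (andbC (u == b)).
- move=> u; rewrite /h' /= ih /=; apply/negP; case/orP => /andP[/eqP -> E]; first by rewrite E in ab.
  by rewrite eq_sym E in ab.
- by move=> u v /or3P[/suph//|/andP[/eqP -> /eqP ->]|/andP[/eqP -> /eqP ->]]; rewrite aX bX.
- by rewrite subUset sub1set yZ.
- have -> : arcs h' = (a, b) |: ((b, a) |: arcs h).
    by apply/setP => -[u v]; rewrite !inE /h' /= !xpair_eqE orbC -orbA.
  rewrite !cardsU1 ph !inE /= (negPf nab) sh (negPf nab) xpair_eqE (negPf ab) /= yZ0.
  by rewrite mulnDr muln1 addnA.
- move=> z; rewrite !inE negb_or => /andP[/andP[zy zZ0] zZ].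
  have : clique h (nbrs e z) by apply: hc; rewrite !inE zy zZ0.
  move=> /forall_inP H; apply/forall_inP => u uz; apply/forall_inP => v vz.
  move: (H u uz) => /forall_inP/(_ v vz)/implyP G; apply/implyP => /G uv.
  by rewrite /h' /= uv.
rewrite !inE in ya yb.
exists (fun x => if x == y then Some a else phi x).
have Xy x : x \in X -> x == y = false.
  by move=> xX; apply: contraNF yX => /eqP <-.
split.
- by move=> x xX; rewrite Xy // phi1.
- by move=> x xX; rewrite !inE negb_or => /andP[/negPf -> /phi2]; apply.
- move=> z /setU1P[->|zZ0]; first by exists a; rewrite ?eqxx.
  by case: eqP zZ0 => [->|_ /phi3//]; rewrite (negPf yZ0).
- move=> u v /or3P[huv|/andP[/eqP -> /eqP ->]|/andP[/eqP -> /eqP ->]].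
  + have [x [z [px pz exz]]] := phi4 _ _ huv; exists x, z.
    have ny w : phi w <> None -> w == y = false.
      by move=> H; apply/negP => /eqP E; apply: H; rewrite E phi2.
    by rewrite !ny ?px ?pz.
  + by exists y, b; rewrite eqxx Xy // phi1.
  + by exists b, y; rewrite eqxx Xy // phi1 // se.
Qed.

Lemma good_pair_exists e X : symmetric e -> irreflexive e -> ~ has_K 5 e ->
  2 ^ 17 * #|X| + 1 < #|V| ->
  exists u v, [/\ u != v, u \notin X, v \notin X &
    e u v \/ nbrs e u = nbrs e v].
Proof.
move=> se ie noK large.
case: (boolP [exists p : V * V, [&& p.1 != p.2, p.1 \notin X, p.2 \notin X &
   e p.1 p.2 || (nbrs e p.1 == nbrs e p.2)]]).
  case/existsP => -[u v] /and4P[/= uv uX vX /orP H]; exists u, v; split => //.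
  by case: H => [|/eqP]; [left|right].
rewrite negb_exists => /forallP no; exfalso; move: large; apply/negP; rewrite -leqNgt.
pose Y := ~: X.
have Yno u v : u != v -> u \in Y -> v \in Y -> ~~ e u v && (nbrs e u != nbrs e v).
  rewrite !inE => uv uX vX; have := no (u, v); rewrite /= uv uX vX /=.
  by rewrite negb_or.
have NY y : y \in Y -> nbrs e y \subset X.
  move=> yY; apply/subsetP => x; rewrite inE => exy; apply/negPn/negP => xX.
  have yx : y != x by apply: contraL exy => /eqP ->; rewrite ie.
  by have := Yno _ _ yx yY; rewrite inE xX exy => /(_ isT).
have dXY : [disjoint X & Y]%B by rewrite -setI_eq0 setICr.
have [h [Z0 [[sh ih suph Z0Z ph] [hc [phi [phi1 phi2 phi3 phi4]]]]]] :=
  independent_minor se ie dXY NY.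
have noKh : ~ has_K 5 h.
  move=> K; apply: noK; apply: has_K_lift phi4 _ K => x y a px py.
  have key z : phi z = Some a -> connect (within_rel (fun z => phi z == Some a) e) z a.
    move=> pz; case: (boolP (z \in X)) => zX.
      by move: pz; rewrite phi1 // => -[->]; apply: connect0.
    case: (boolP (z \in Z0)) => zZ0; last by rewrite phi2 in pz.
    have [b pb ezb] := phi3 _ zZ0; move: pb; rewrite pz => -[E]; rewrite -E in ezb.
    have aX : a \in X.
      by apply: (subsetP (NY z _)); rewrite ?inE.
    by apply: connect1; rewrite /within_rel /= pz phi1 // eqxx.
  apply: connect_trans (key _ px) _.
  rewrite sym_connect_sym ?key // => u v.
  by rewrite /within_rel /= se andbCA.
have Z0X : #|Z0| <= 8 * #|X|.
  have := noK5_arcs sh ih suph noKh; rewrite ph; lia.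
have YX : #|Y :\: Z0| <= 2 ^ 16 * #|X| + 1.
  apply: leq_trans (noK5_cliques sh ih suph noKh).
  rewrite -(card_in_imset (f := nbrs e)); last first.
    move=> u v /setDP[uY _] /setDP[vY _] E; apply/eqP/negPn/negP => uv.
    by have := Yno _ _ uv uY vY; rewrite E eqxx andbF.
  apply: subset_leq_card; apply/subsetP => K /imsetP[y yY ->].
  by rewrite inE hc // NY //; case/setDP: yY.
rewrite -(cardsC X) -/Y -(cardsID Z0 Y) (setIidPr Z0Z).
have : 9 <= 2 ^ 16 by rewrite (@leq_trans (2 ^ 4)) // leq_exp2l.
rewrite (expnSr 2 16); move: (2 ^ 16) YX => c; nia.
Qed.

End GoodPairs.

Section EdgeSets.
Import mathcomp.boot.fintype mathcomp.boot.finset.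
Local Open Scope set_scope.
Local Open Scope nat_scope.

Definition adj (V : finType) (E : {set {set V}}) : rel V :=
  [rel x y | (x != y) && ([set x; y] \in E)].

Definition inside (V : finType) (A : {set V}) (E : {set {set V}}) : bool :=
  [forall e in E, (#|e| == 2) && (e \subset A)].

Definition relabel (T V : finType) (f : T -> V) (E : {set {set T}}) :
    {set {set V}} := [set f @: (e : {set T}) | e in E].

Lemma adj_sym (V : finType) (E : {set {set V}}) : symmetric (adj E).
Proof. by move=> x y; rewrite /adj /= eq_sym setUC. Qed.

Lemma adj_irr (V : finType) (E : {set {set V}}) : irreflexive (adj E).
Proof. by move=> x; rewrite /adj /= eqxx. Qed.

Lemma insideP (V : finType) (A : {set V}) (E : {set {set V}}) :
  reflect (forall e, e \in E ->
             exists x y, [/\ x != y, x \in A, y \in A & e = [set x; y]])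
          (inside A E).
Proof.
apply: (iffP forall_inP) => H e eE.
  have /andP[/cards2P[x [y [xy ->]]] sA] := H e eE.
  by exists x, y; split=> //; apply: (subsetP sA); rewrite !inE eqxx ?orbT.
have [x [y [xy xA yA ->]]] := H e eE.
by rewrite cards2 xy eqxx subUset !sub1set xA yA.
Qed.

Lemma simple_inside (V : finType) (E : {set {set V}}) :
  simple_graph E = inside setT E.
Proof. by apply: eq_forallb_in => e _; rewrite subsetT andbT. Qed.

Lemma inside_adj (V : finType) (A : {set V}) (E : {set {set V}}) x y :
  inside A E -> [set x; y] \in E -> [/\ x != y, x \in A & y \in A].
Proof.
move=> /forall_inP H /H /andP[]; rewrite cards2 subUset !sub1set.
by case: (x != y) => //= _ /andP[-> ->].
Qed.

Lemma adj_supported (V : finType) (A : {set V}) (E : {set {set V}}) :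
  inside A E -> supported A (adj E).
Proof. by move=> iE x y /andP[_ /(inside_adj iE)[_ -> ->]]. Qed.

Lemma inside_subset (V : finType) (A : {set V}) (E F : {set {set V}}) :
  F \subset E -> inside A E -> inside A F.
Proof. by move=> /subsetP FE /forall_inP H; apply/forall_inP => e /FE /H. Qed.

Section Relabel.
Variables (T V : finType) (f : T -> V).
Hypothesis f_inj : injective f.

Lemma relabel_inj : injective (relabel f).
Proof. exact: imset_inj (imset_inj f_inj). Qed.

Lemma mem_relabel E (e : {set T}) : (f @: e \in relabel f E) = (e \in E).
Proof. by rewrite mem_imset //; apply: imset_inj. Qed.

Lemma imset_set2 x y : f @: [set x; y] = [set f x; f y].
Proof. by rewrite imsetU1 imset_set1. Qed.

Lemma adj_relabel E x y : adj (relabel f E) (f x) (f y) = adj E x y.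
Proof. by rewrite /adj /= (inj_eq f_inj) -imset_set2 mem_relabel. Qed.

Lemma adj_relabel_inv E x y : inside setT E -> adj (relabel f E) x y ->
  exists a b, [/\ x = f a, y = f b & adj E a b].
Proof.
move=> iE /andP[xy /imsetP[e eE xye]].
have [a [b [ab _ _ eab]]] := insideP _ _ iE e eE.
move: xye; rewrite eab imset_set2 => xye.
have abE : adj E a b by rewrite /adj /= ab -eab.
have : x \in [set x; y] by rewrite !inE eqxx.
have : y \in [set x; y] by rewrite !inE eqxx orbT.
rewrite xye !inE => /orP[] /eqP yE /orP[] /eqP xE.
- by rewrite xE yE eqxx in xy.
- by exists b, a; rewrite adj_sym.
- by exists a, b.
- by rewrite xE yE eqxx in xy.
Qed.

Lemma inside_relabel E : inside setT E = inside (f @: setT) (relabel f E).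
Proof.
apply/insideP/insideP => H e.
  case/imsetP => d /H[x [y [xy _ _ ->]]] ->; exists (f x), (f y).
  by rewrite (inj_eq f_inj) xy imset_set2 !imset_f.
rewrite -mem_relabel => /H[u [w [xy /imsetP[x _ ux] /imsetP[y _ wy]]]].
rewrite {u}ux {w}wy in xy *; rewrite -imset_set2 => /(imset_inj f_inj) ->.
by exists x, y; rewrite !inE; split=> //; apply: contraNneq xy => ->.
Qed.

Lemma relabel_surj F : inside (f @: setT) F -> exists2 E, inside setT E & F = relabel f E.
Proof.
move=> iF; have EF : F = relabel f [set e : {set T} | f @: e \in F].
  apply/setP => e; apply/idP/imsetP => [eF|[d]]; last by rewrite inE => dF ->.
  have [u [w [_ /imsetP[x _ ->] /imsetP[y _ ->] exy]]] := insideP _ _ iF e eF.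
  by exists [set x; y]; rewrite ?inE imset_set2 -?exy.
by exists [set e : {set T} | f @: e \in F] => //; rewrite inside_relabel -EF.
Qed.

Lemma card_relabel (P : pred {set {set T}}) (Q : pred {set {set V}}) :
  (forall E, inside setT E -> P E = Q (relabel f E)) ->
  #|[set E | inside (f @: setT) E && Q E]| = #|[set E | inside setT E && P E]|.
Proof.
move=> PQ; rewrite -(card_imset _ relabel_inj); apply: eq_card => F.
apply/idP/imsetP; rewrite inE.
  case/andP => /relabel_surj[E iE ->] QE; exists E => //.
  by rewrite inE iE PQ.
by case=> E; rewrite inE => /andP[iE PE] ->; rewrite -inside_relabel iE -PQ.
Qed.

Lemma has_K_relabel t E : inside setT E ->
  has_K t (adj (relabel f E)) <-> has_K t (adj E).
Proof.
move=> iE; split.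
  apply: (has_K_lift (phi := fun x => Some (f x))).
    move=> a b /adj_relabel_inv[]// x [y [-> -> xyE]]; by exists x, y.
  by move=> x y a [<-] [/f_inj ->]; apply: connect0.
apply: (has_K_lift (phi := fun x => [pick y | f y == x])).
  have pickf x : [pick y | f y == f x] = Some x.
    by case: pickP => [y /eqP/f_inj -> //|/(_ x)]; rewrite eqxx.
  by move=> a b ab; exists (f a), (f b); rewrite !pickf adj_relabel.
move=> x y a; case: pickP => // b /eqP <- [->].
by case: pickP => // c /eqP <- [->]; apply: connect0.
Qed.

End Relabel.

Definition K5_free (V : finType) (E : {set {set V}}) : bool :=
  `[< ~ has_K 5 (adj E) >].

Definition num_K5_free (V : finType) (A : {set V}) : nat :=
  #|[set E : {set {set V}} | inside A E && K5_free E]|.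

Lemma num_K5_freeE (V : finType) (A : {set V}) :
  num_K5_free A = num_K5_free [set: 'I_#|A|].
Proof.
rewrite /num_K5_free -(@card_relabel _ _ (enum_val : 'I_#|A| -> V) _ (@K5_free _) (@K5_free V)).
- suff -> : enum_val @: [set: 'I_#|A|] = A by [].
  apply/setP => x; apply/imsetP/idP => [[i _ ->]|xA]; first exact: enum_valP.
  by exists (enum_rank_in xA x); rewrite ?inE // enum_rankK_in.
- exact: enum_val_inj.
- move=> E iE; apply: asbool_equiv_eq.
  by have := has_K_relabel enum_val_inj 5 iE; tauto.
Qed.
End EdgeSets.

Section CountK5Free.
Import mathcomp.boot.fintype mathcomp.boot.finset.
Local Open Scope set_scope.
Local Open Scope nat_scope.

(* [pi] pairs every vertex of [S] with a vertex outside [S] that is adjacent to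
   it or has the same neighbours. *)
Definition good_pairing (V : finType) (e : rel V) (S : {set V}) (pi : V -> V) : Prop :=
  {in S &, injective pi} /\
  forall x, x \in S -> pi x \notin S /\ (e (pi x) x \/ nbrs e (pi x) = nbrs e x).

Lemma good_pairing_exists (V : finType) (e : rel V) k :
  symmetric e -> irreflexive e -> ~ has_K 5 e -> 2 ^ 18 * k <= #|V| ->
  exists (S : {set V}) (pi : V -> V), #|S| = k /\ good_pairing e S pi.
Proof.
move=> se ie noK; elim: k => [_|k IH large].
  by exists set0, id; rewrite cards0; split=> //; split=> [x|x]; rewrite inE.
have [|S [pi [Sk [pi_inj good]]]] := IH; first by apply: leq_trans large; rewrite leq_mul2l leqnSn orbT.
have [|u [v [uv uX vX uv_good]]] := @good_pair_exists V e (S :|: pi @: S) se ie noK.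
  apply: leq_trans large; rewrite (expnSr 2 17).
  have := leq_trans (leq_card_setU S (pi @: S))
    (leq_add (leqnn _) (leq_imset_card pi (mem S))).
  rewrite Sk => Xk; have c0 : 0 < 2 ^ 17 by rewrite expn_gt0.
  have : 2 ^ 17 * #|S :|: pi @: S| <= 2 ^ 17 * (k + k) by rewrite leq_mul2l Xk orbT.
  by move: (2 ^ 17) c0 => c c0; move: (c * #|_|) => d; nia.
move: uX vX; rewrite !inE !negb_or => /andP[uS upi] /andP[vS vpi].
exists (v |: S), (fun x => if x == v then u else pi x); split; last split.
- by rewrite cardsU1 vS Sk.
- have Sv x : x \in S -> x == v = false by move=> xS; apply: contraNF vS => /eqP <-.
  move=> x y /setU1P[->|xS] /setU1P[->|yS] //; rewrite ?eqxx ?Sv //.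
  + by move=> E; rewrite E imset_f in upi.
  + by move=> E; rewrite -E imset_f in upi.
  + exact: pi_inj.
move=> x /setU1P[->|xS].
  by rewrite eqxx !inE negb_or uv.
have -> : x == v = false by apply: contraNF vS => /eqP <-.
have [piS g] := good x xS; split=> //; rewrite !inE negb_or piS andbT.
by apply: contraNneq vpi => <-; rewrite imset_f.
Qed.

Definition fold_pairs (V : finType) (S : {set V}) (t : seq V) (x : V) : V :=
  if x \in S then nth x t (index x (enum S)) else x.

Definition quotient (V : finType) (phi : V -> V) (E : {set {set V}}) : {set {set V}} :=
  [set e | [exists x, exists y, [&& adj E x y, phi x != phi y & e == [set phi x; phi y]]]].

Definition unfold_edges (V : finType) (phi : V -> V) (E : {set {set V}}) : {set {set V}} :=
  [set [set p.1; p.2] | p in [set p : V * V | adj E (phi p.1) (phi p.2) || (phi p.1 == phi p.2)]].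

Lemma foldE (V : finType) (S : {set V}) (pi : V -> V) x :
  fold_pairs S [seq pi y | y <- enum S] x = if x \in S then pi x else x.
Proof.
rewrite /fold_pairs; case: ifP => // xS.
by rewrite (nth_map x) ?nth_index ?mem_enum // index_mem mem_enum.
Qed.

Lemma subset_unfold (V : finType) (phi : V -> V) (A : {set V}) (E : {set {set V}}) :
  inside A E -> E \subset unfold_edges phi (quotient phi E).
Proof.
move=> iE; apply/subsetP => e eE; have [x [y [xy _ _ exy]]] := insideP _ _ iE e eE.
apply/imsetP; exists (x, y) => //; rewrite inE /=.
case: eqVneq => [_|pxy]; rewrite ?orbT // orbF /adj /= pxy /= inE.
apply/existsP; exists x; apply/existsP; exists y.
by rewrite pxy eqxx /adj /= xy -exy eE.
Qed.

Lemma inside_quotient (V : finType) (phi : V -> V) (A : {set V}) (E : {set {set V}}) :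
  (forall x, phi x \in A) -> inside A (quotient phi E).
Proof.
move=> phiA; apply/insideP => e; rewrite inE.
by move=> /existsP[x /existsP[y /and3P[_ pxy /eqP ->]]]; exists (phi x), (phi y).
Qed.

Lemma quotient_K5_free (V : finType) (E : {set {set V}}) S pi phi :
  good_pairing (adj E) S pi -> phi =1 (fun x => if x \in S then pi x else x) ->
  K5_free E -> K5_free (quotient phi E).
Proof.
move=> [pi_inj good] phiE /asboolP noK; apply/asboolP => K; apply: noK.
pose phi' x := if (x \in S) && ~~ adj E (pi x) x then None else Some (phi x).
apply: (has_K_lift (phi := phi')) K => [a b|x y a].
  case/andP => ab; rewrite inE => /existsP[x /existsP[y /and3P[xy pxy /eqP E2]]].
  have key z w : adj E z w -> exists2 z', phi' z' = Some (phi z) & adj E z' w.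
    move=> zw; case: (boolP ((z \in S) && ~~ adj E (pi z) z)) => [|/negPf H].
      case/andP => zS npi; have [pS [|Nz]] := good z zS; first by rewrite (negPf npi).
      exists (pi z); first by rewrite /phi' !phiE (negPf pS) zS.
      by have := erefl (w \in nbrs (adj E) (pi z)); rewrite {2}Nz !inE zw.
    by exists z; rewrite // /phi' H.
  have [x' px' x'y] := key _ _ xy; rewrite adj_sym in x'y.
  have [y' py' y'x'] := key _ _ x'y.
  have : a \in [set phi x; phi y] by rewrite -E2 !inE eqxx.
  have : b \in [set phi x; phi y] by rewrite -E2 !inE eqxx orbT.
  rewrite !inE => /orP[] /eqP bE /orP[] /eqP aE.
  - by rewrite aE bE eqxx in ab.
  - by exists y', x'; rewrite aE bE.
  - by exists x', y'; rewrite aE bE adj_sym.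
  - by rewrite aE bE eqxx in ab.
have key z : phi' z = Some a -> connect (within_rel (fun z => phi' z == Some a) (adj E)) z a.
  rewrite /phi'; case: ifP => // /negbT; rewrite negb_and negbK => H.
  case; rewrite phiE; case: ifP H => [zS|zS _ ->]; last exact: connect0.
  rewrite /= => piz Ea; apply: connect1; rewrite /within_rel /= -Ea zS piz /=.
  have [/negPf pS _] := good z zS.
  by rewrite /phi' pS !phiE pS zS eqxx adj_sym.
move=> /key xa /key ya; apply: connect_trans xa _.
rewrite sym_connect_sym // => u v.
by rewrite /within_rel /= adj_sym andbCA.
Qed.

Lemma card_unfold (V : finType) (phi : V -> V) (E : {set {set V}}) :
  (forall a, #|[set x | phi x == a]| <= 2) -> #|unfold_edges phi E| <= 4 * #|arcs (adj E)| + 2 * #|V|.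
Proof.
move=> fib; apply: leq_trans (leq_imset_card _ _) _.
set D := [set p | _].
have DU : D = [set p | (phi p.1, phi p.2) \in arcs (adj E)] :|: [set p | phi p.1 == phi p.2].
  by apply/setP => p; rewrite !inE.
rewrite DU; apply: leq_trans (leq_card_setU _ _) (leq_add _ _).
  rewrite -sum1_card (partition_big (fun p => (phi p.1, phi p.2)) (mem (arcs (adj E)))) /=; last first.
    by move=> p; rewrite !inE.
  rewrite mulnC -sum_nat_const; apply: leq_sum => -[a b] _.
  rewrite sum1dep_card; apply: (@leq_trans #|setX [set x | phi x == a] [set x | phi x == b]|).
    apply: subset_leq_card; apply/subsetP => -[x y]; rewrite !inE /= => /andP[_].
    by rewrite xpair_eqE.
  by rewrite cardsX -[4]/(2 * 2) leq_mul.
rewrite -sum1_card (partition_big fst xpredT) //= mulnC -sum_nat_const.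
apply: leq_sum => x _; rewrite sum1dep_card.
apply: leq_trans (fib (phi x)).
apply: (@leq_trans #|[set (x, y) | y in [set y | phi y == phi x]]|); last exact: leq_imset_card.
apply: subset_leq_card; apply/subsetP => -[a b]; rewrite !inE /= => /andP[/eqP E1 /eqP E2].
by apply/imsetP; exists b; rewrite ?inE -E2 ?E1.
Qed.

Lemma leq_card_bigcup (I T : finType) (P : pred I) (F : I -> {set T}) :
  #|\bigcup_(i | P i) F i| <= \sum_(i | P i) #|F i|.
Proof.
elim/big_rec2: _ => [|i m A _ IH]; first by rewrite cards0.
by apply: leq_trans (leq_card_setU _ _) _; rewrite leq_add2l.
Qed.

Lemma card_fold_fiber (V : finType) (S : {set V}) (t : seq V) a : uniq t ->
  size t = #|S| -> #|[set x | fold_pairs S t x == a]| <= 2.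
Proof.
move=> tU ts; rewrite (cardsD1 a); apply: (@leq_trans (1 + 1)) => //.
apply: leq_add; first exact: leq_b1.
rewrite leqNgt; apply/negP => /card_gt1P[x [y []]].
rewrite !inE /fold_pairs => /andP[xa]; case: ifP => [xS|_ /eqP E]; last by rewrite E eqxx in xa.
move=> /eqP Ex /andP[ya]; case: ifP => [yS|_ /eqP E]; last by rewrite E eqxx in ya.
move=> /eqP Ey /negP; apply; apply/eqP.
have ix : index x (enum S) < size t by rewrite ts cardE index_mem mem_enum.
have iy : index y (enum S) < size t by rewrite ts cardE index_mem mem_enum.
move: Ex Ey; rewrite (set_nth_default a x ix) (set_nth_default a y iy) => Ex Ey.
have Exy : index x (enum S) = index y (enum S).
  by apply/eqP; rewrite -(nth_uniq a ix iy tU) Ex Ey.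
have xe : x \in enum S by rewrite mem_enum.
by rewrite -(nth_index x xe) Exy nth_index ?mem_enum.
Qed.

Lemma num_K5_free_rec n k : 2 ^ 18 * k <= n ->
  num_K5_free [set: 'I_n] <=
    'C(n, k) * n ^_ k * num_K5_free [set: 'I_(n - k)] * 2 ^ (66 * n).
Proof.
move=> large; set V := 'I_n.
pose F (S : {set V}) := [set E : {set {set V}} | inside (~: S) E && K5_free E].
apply: (@leq_trans #|\bigcup_(S : {set V} | #|S| == k) \bigcup_(t : k.-tuple V | uniq t)
   \bigcup_(E in F S) powerset (unfold_edges (fold_pairs S t) E)|).
  apply: subset_leq_card; apply/subsetP => E; rewrite inE => /andP[iE fE].
  have [|S [pi [Sk gd]]] := @good_pairing_exists V (adj E) k (@adj_sym _ _) (@adj_irr _ _) (asboolP _ fE).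
    by rewrite card_ord.
  have ts : size [seq pi y | y <- enum S] == k by rewrite size_map -cardE Sk.
  apply/bigcupP; exists S; first by rewrite Sk.
  apply/bigcupP; exists (Tuple ts).
    rewrite /= map_inj_in_uniq ?enum_uniq // => x y; rewrite !mem_enum.
    by case: gd => + _; apply.
  pose phi := fold_pairs S (Tuple ts).
  have phiE : phi =1 (fun x => if x \in S then pi x else x) by move=> x; exact: foldE.
  apply/bigcupP; exists (quotient phi E).
    rewrite inE inside_quotient ?(quotient_K5_free gd phiE) // => x.
    rewrite inE phiE; case: ifP => [xS|->//].
    by case: gd => _ /(_ x xS)[].
  by rewrite inE (subset_unfold _ iE).
apply: leq_trans (leq_card_bigcup _ _) _.
apply: (@leq_trans (\sum_(S : {set V} | #|S| == k) n ^_ k * num_K5_free [set: 'I_(n - k)] * 2 ^ (66 * n))); last first.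
  rewrite sum_nat_cond_const -!mulnA leq_mul2r; apply/orP; right.
  by have := card_draws 'I_n k; rewrite card_ord => <-.
apply: leq_sum => S /eqP Sk; apply: leq_trans (leq_card_bigcup _ _) _.
apply: (@leq_trans (\sum_(t : k.-tuple V | uniq t) num_K5_free [set: 'I_(n - k)] * 2 ^ (66 * n))); last first.
  rewrite sum_nat_cond_const -!mulnA leq_mul2r; apply/orP; right.
  have := @card_uniq_tuples V k predT; rewrite card_ord => <-.
  by apply: subset_leq_card; apply/subsetP => t; rewrite !inE => ->; rewrite andbT; apply/allP.
apply: leq_sum => t tU; apply: leq_trans (leq_card_bigcup _ _) _.
have -> : num_K5_free [set: 'I_(n - k)] = #|F S|.
  have SCk : #|~: S| = n - k.
    by have := cardsC S; rewrite card_ord Sk; lia.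
  have gen m : #|~: S| = m -> num_K5_free [set: 'I_m] = num_K5_free (~: S).
    by move=> <-; symmetry; apply: num_K5_freeE.
  exact: gen SCk.
rewrite -sum_nat_const; apply: leq_sum => E; rewrite inE => /andP[iE /asboolP fE].
rewrite card_powerset leq_exp2l // (leq_trans (card_unfold _ _)) //.
  by move=> a; apply: card_fold_fiber => //; rewrite size_tuple Sk.
have Sn : #|~: S| <= n by apply: leq_trans (max_card _) _; rewrite card_ord.
have := noK5_arcs (@adj_sym _ E) (@adj_irr _ E) (adj_supported iE) fE.
move=> /leq_trans/(_ (leq_mul (leqnn 16) Sn)); rewrite card_ord.
by move: #|_| => a; lia.
Qed.

Lemma num_simple_le n : #|[set E : {set {set 'I_n}} | inside setT E]| <= 2 ^ (n * n).
Proof.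
apply: (@leq_trans #|powerset [set [set p.1; p.2] | p in [set: 'I_n * 'I_n]]|).
  apply: subset_leq_card; apply/subsetP => E; rewrite !inE => iE.
  apply/subsetP => e /(insideP _ _ iE)[x [y [_ _ _ ->]]].
  by apply/imsetP; exists (x, y).
rewrite card_powerset leq_exp2l // (leq_trans (leq_imset_card _ _)) //.
by rewrite cardsT card_prod card_ord.
Qed.

Lemma num_K5_free_small : exists L, forall n, num_K5_free [set: 'I_n] <= n`! * L ^ n.
Proof.
have [q q0 rec] : exists2 q, 0 < q & forall n k, q * k <= n ->
    num_K5_free [set: 'I_n] <=
      'C(n, k) * n ^_ k * num_K5_free [set: 'I_(n - k)] * 2 ^ (66 * n).
  by exists (2 ^ 18); [rewrite expn_gt0 | exact: num_K5_free_rec].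
exists (2 ^ (134 * q)) => n.
elim/ltn_ind: n => n IH; case: (ltnP n q) => nq.
  apply: (@leq_trans (1 * (2 ^ n) ^ n)); last first.
    apply: leq_mul; rewrite ?fact_gt0 // -!expnM leq_exp2l // leq_mul2r.
    by apply/orP; right; apply: leq_trans (ltnW nq) _; rewrite leq_pmull.
  rewrite mul1n -expnM; apply: leq_trans (num_simple_le n).
  by apply: subset_leq_card; apply/subsetP => E; rewrite !inE => /andP[].
set k := n %/ q.
have k0 : 0 < k by rewrite divn_gt0.
have qk : q * k <= n by rewrite mulnC leq_trunc_div.
have nk : n <= 2 * q * k.
  have := ltn_ceil n q0; rewrite -/k; nia.
have kn : k <= n by apply: leq_trans qk; rewrite leq_pmull.
have bin_le : 'C(n, k) <= 2 ^ n.
  rewrite -[n in 2 ^ n]card_ord -[k in 'C(_, k)]/k -{1}(card_ord n) -card_draws.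
  rewrite -cardsT -card_powerset; apply: subset_leq_card.
  by apply/subsetP => A _; rewrite inE subsetT.
apply: leq_trans (rec _ _ qk) _.
rewrite -bin_ffact -(bin_fact kn).
have IHk : num_K5_free [set: 'I_(n - k)] <= (n - k)`! * (2 ^ (134 * q)) ^ (n - k).
  by apply: IH; rewrite ltn_subrL k0 (leq_trans k0 kn).
apply: (@leq_trans ('C(n, k) * (2 ^ n * k`!) *
    ((n - k)`! * (2 ^ (134 * q)) ^ (n - k)) * 2 ^ (66 * n))).
  by rewrite !leq_mul.
have -> : (2 ^ (134 * q)) ^ n = (2 ^ (134 * q)) ^ k * (2 ^ (134 * q)) ^ (n - k).
  by rewrite -expnD subnKC.
have : 2 ^ n * 2 ^ (66 * n) <= (2 ^ (134 * q)) ^ k.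
  by rewrite -expnD -expnM leq_exp2l //; lia.
move: 'C(n, k) (2 ^ n) (2 ^ (66 * n)) ((2 ^ (134 * q)) ^ k).
move: ((2 ^ (134 * q)) ^ (n - k)) k`! (n - k)`! => x y z b c d w cdw.
have -> : b * (c * y) * (z * x) * d = b * (y * z) * x * (c * d) by lia.
by rewrite [w * x]mulnC -[leqLHS]mulnA !leq_mul2l cdw !orbT.
Qed.

End CountK5Free.

(** * Planar drawings *)

Section Curves.
Variable R : realType.
Implicit Types (g h : R -> R * R) (s t : R) (p q : R * R).

Lemma continuous_fstR : continuous (fun z : R * R => z.1).
Proof. by move=> z; exact: cvg_fst. Qed.

Lemma continuous_sndR : continuous (fun z : R * R => z.2).
Proof. by move=> z; exact: cvg_snd. Qed.

Definition dist1 p q : R := `|p.1 - q.1| + `|p.2 - q.2|.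

Lemma dist1_gt0 p q : p <> q -> 0 < dist1 p q.
Proof.
case: p q => [p1 p2] [q1 q2] pq; rewrite /dist1 /= lt_neqAle addr_ge0 // andbT.
rewrite eq_sym paddr_eq0 // !normr_eq0 !subr_eq0.
by apply/negP => /andP[/eqP E1 /eqP E2]; apply: pq; rewrite E1 E2.
Qed.

Lemma continuous_dist1 (T : topologicalType) (f k : T -> R * R) :
  continuous f -> continuous k -> continuous (fun x => dist1 (f x) (k x)).
Proof.
move=> cf ck x; apply: cvgD; apply: cvg_norm; apply: cvgB.
- exact: (continuous_comp (cf x) (@continuous_fstR _)).
- exact: (continuous_comp (ck x) (@continuous_fstR _)).
- exact: (continuous_comp (cf x) (@continuous_sndR _)).
- exact: (continuous_comp (ck x) (@continuous_sndR _)).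
Qed.

Lemma continuous_comp_fst (T : topologicalType) (f : R -> T) :
  continuous f -> continuous (fun z : R * R => f z.1).
Proof.
by move=> cf z; apply: (continuous_comp (f := fst)); [exact: cvg_fst|exact: cf].
Qed.

Lemma continuous_comp_snd (T : topologicalType) (f : R -> T) :
  continuous f -> continuous (fun z : R * R => f z.2).
Proof.
by move=> cf z; apply: (continuous_comp (f := snd)); [exact: cvg_snd|exact: cf].
Qed.

Lemma unit_square_compact : compact (`[0 : R, 1] `*` `[0 : R, 1]).
Proof. by apply: compact_setX; apply: segment_compact. Qed.

Lemma positive_min_square (D : set (R * R)) (f : R * R -> R) :
  closed D -> D `<=` `[0, 1] `*` `[0, 1] -> continuous f ->
  (forall z, D z -> 0 < f z) -> exists2 e : R, 0 < e & forall z, D z -> e <= f z.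
Proof.
move=> cD sD cf f0; have [D0|nD] := pselect (D !=set0); last first.
  by exists 1 => // z Dz; exfalso; apply: nD; exists z.
have kD : compact D by apply: subclosed_compact cD unit_square_compact sD.
have [c cin minc] := compact_EVT_min D0 kD (continuous_subspaceT cf).
by exists (f c); [apply: f0; rewrite inE in cin | move=> z Dz; apply: minc; rewrite inE].
Qed.

Lemma curves_apart g h : continuous g -> continuous h ->
  (forall s t, 0 <= s <= 1 -> 0 <= t <= 1 -> g s <> h t) ->
  exists2 e : R, 0 < e &
    forall s t, 0 <= s <= 1 -> 0 <= t <= 1 -> e <= dist1 (g s) (h t).
Proof.
move=> cg ch gh.
have [|||z|e e0 He] := @positive_min_square (`[0, 1] `*` `[0, 1])
  (fun z => dist1 (g z.1) (h z.2)).
- by apply: compact_closed; [exact: norm_hausdorff|exact: unit_square_compact].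
- by [].
- by apply: continuous_dist1; [exact: continuous_comp_fst|exact: continuous_comp_snd].
- case: z => s t [/=]; rewrite !in_itv /= => s01 t01.
  by apply: dist1_gt0; apply: gh.
by exists e => // s t s01 t01; apply: (He (s, t)); split; rewrite /= in_itv.
Qed.

Lemma uniformly_continuous_unit g (eta : R) : continuous g -> 0 < eta ->
  exists2 d : R, 0 < d & forall s t, 0 <= s <= 1 -> 0 <= t <= 1 ->
    `|s - t| < d -> dist1 (g s) (g t) < eta.
Proof.
move=> cg eta0.
have cf : continuous (fun z : R * R => dist1 (g z.1) (g z.2)).
  by apply: continuous_dist1; [exact: continuous_comp_fst|exact: continuous_comp_snd].
have [||z|z|d d0 Hd] := @positive_min_square
  ((`[0, 1] `*` `[0, 1]) `&` [set z | eta <= dist1 (g z.1) (g z.2)])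
  (fun z => `|z.1 - z.2|).
- apply: closedI.
    by apply: compact_closed; [exact: norm_hausdorff|exact: unit_square_compact].
  exact: ((continuous_closedP _).1 cf _ (@closed_ge _ eta)).
- by move=> z [].
- by apply: cvg_norm; apply: cvgB; [exact: cvg_fst|exact: cvg_snd].
- case: z => s t [_ /=] H; rewrite normr_gt0 subr_eq0; apply/negP => /eqP st.
  by move: H; rewrite st /dist1 !subrr normr0 addr0 leNgt eta0.
exists d => // s t s01 t01 st; rewrite ltNge; apply/negP => H.
have : d <= `|s - t|.
  by apply: (Hd (s, t)); split=> //; split; rewrite /= in_itv.
by rewrite leNgt st.
Qed.

Lemma curve_chain g (eta : R) : continuous g -> 0 < eta ->
  exists l : seq (R * R), [/\ path (near_pt eta) (g 0) l, last (g 0) l = g 1 &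
    forall x, x \in l -> exists2 t, 0 <= t <= 1 & x = g t].
Proof.
move=> cg eta0; have [d d0 Hd] := uniformly_continuous_unit cg eta0.
pose N := (Num.truncn d^-1).+1.
have N0 : (0 : R) < N%:R by rewrite ltr0n.
have Nd : N%:R^-1 < d.
  by rewrite -[d]invrK ltf_pV2 ?posrE ?invr_gt0 // truncnS_gt // ltW ?invr_gt0.
pose pt (i : nat) := g (i%:R / N%:R).
have in01 i : (i <= N)%N -> 0 <= (i%:R / N%:R : R) <= 1.
  by move=> iN; rewrite divr_ge0 //= ler_pdivrMr // mul1r ler_nat.
have step i : (i < N)%N -> near_pt eta (pt i) (pt i.+1).
  move=> iN; have : dist1 (pt i) (pt i.+1) < eta.
    apply: Hd; rewrite ?in01 //; first exact: ltnW.
    by rewrite -mulrBl -natr1 opprD addrA subrr sub0r mulN1r normrN gtr0_norm ?invr_gt0.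
  rewrite /dist1 /near_pt => H; apply/andP.
  by split; apply: le_lt_trans H; rewrite ?lerDl ?lerDr.
have sub k m : (k + m <= N)%N -> path (near_pt eta) (pt k) [seq pt i | i <- iota k.+1 m] /\
    last (pt k) [seq pt i | i <- iota k.+1 m] = pt (k + m)%N.
  elim: m k => [|m IH] k; first by rewrite addn0.
  rewrite -addSnnS => kmN; have [P L] := IH k.+1 kmN.
  by rewrite /= P L step //; apply: leq_trans kmN; rewrite addSn ltnS leq_addr.
exists [seq pt i | i <- iota 1 N].
have g0 : g 0 = pt 0%N by rewrite /pt mul0r.
have g1 : g 1 = pt N by rewrite /pt divff // gt_eqF.
have [P L] := sub 0%N N (leqnn _); rewrite g0 g1 P L; split=> // x.
case/mapP => i; rewrite mem_iota add1n ltnS => /andP[_ iN] ->.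
by exists (i%:R / N%:R) => //; apply: in01.
Qed.

End Curves.

Section PlanarOn.
Variable R : realType.
Implicit Types (g h : R -> R * R) (s t : R) (p q : R * R).

Definition curve g p q : Prop :=
  [/\ continuous g, forall s t, 0 <= s <= 1 -> 0 <= t <= 1 -> g s = g t -> s = t,
      g 0 = p & g 1 = q].

Definition trace g : set (R * R) := [set p | exists2 t, 0 <= t <= 1 & p = g t].

(* Plane drawing of the graph with vertex set [A] and edge set [E]; the two
   last clauses say that arcs only meet vertices and each other at common
   endpoints. *)
Definition drawing_on (V : finType) (A : {set V}) (E : {set {set V}})
    (pos : V -> R * R) (arc : {set V} -> R -> R * R) : Prop :=
  [/\ {in A &, injective pos},
      forall e, e \in E ->
        exists u v, e = [set u; v]%SET /\ curve (arc e) (pos u) (pos v),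
      forall e w, e \in E -> w \in A -> trace (arc e) (pos w) -> w \in e
    & forall e e', e \in E -> e' \in E -> e != e' ->
        forall p, trace (arc e) p -> trace (arc e') p ->
        exists w, [/\ w \in e, w \in e' & p = pos w]].

Definition planar_on (V : finType) (A : {set V}) (E : {set {set V}}) : Prop :=
  exists pos arc, @drawing_on V A E pos arc.

Lemma unit_rev t : 0 <= t <= 1 -> 0 <= 1 - t <= 1.
Proof. by move=> /andP[? ?]; apply/andP; split; lra. Qed.

Lemma curve_rev g p q : curve g p q -> curve (fun t => g (1 - t)) q p.
Proof.
case=> cg ig g0 g1; split; rewrite ?subrr ?subr0 //.
  move=> t; apply: (continuous_comp (f := fun t => 1 - t)); last exact: cg.
  by apply: cvgB; [exact: cvg_cst|exact: cvg_id].
move=> s t s01 t01 /ig E; have : 1 - s = 1 - t by apply: E; exact: unit_rev.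
by move/addrI/oppr_inj.
Qed.

Lemma trace_rev g : trace (fun t => g (1 - t)) = trace g.
Proof.
apply/seteqP; split=> p [t t01 ->]; by exists (1 - t); rewrite ?subKr //; exact: unit_rev.
Qed.

Lemma finite_pos_bound (T : finType) (P : T -> R -> Prop) :
  (forall x, exists2 e, 0 < e & P x e) ->
  (forall x e e', e' <= e -> P x e -> P x e') ->
  exists2 e, 0 < e & forall x, P x e.
Proof.
move=> H mono.
have /choice[f Hf] : forall x, exists e, 0 < e /\ P x e by move=> x; have [e] := H x; exists e.
exists (\big[Num.min/1]_x f x).
  by elim/big_ind: _ => // [a b a0 b0|x _]; [rewrite lt_min a0|case: (Hf x)].
by move=> x; have [_] := Hf x; apply: mono; apply: bigmin_le_cond.
Qed.

Section Drawn.
Variables (V : finType) (A : {set V}) (E : {set {set V}}).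
Variables (pos : V -> R * R) (arc : {set V} -> R -> R * R).
Hypotheses (iE : inside A E) (dE : drawing_on A E pos arc).

Definition cell_curve (c : V + {set V}) : R -> R * R :=
  match c with inl w => fun=> pos w | inr e => arc e end.
Definition cell_valid (c : V + {set V}) : bool :=
  match c with inl w => w \in A | inr e => e \in E end.
Definition cell_verts (c : V + {set V}) : {set V} :=
  match c with inl w => [set w]%SET | inr e => e end.

Lemma cells_apart : exists2 e : R, 0 < e &
  forall c d p q, cell_valid c -> cell_valid d ->
    (forall w, w \in cell_verts c -> w \in cell_verts d -> False) ->
    trace (cell_curve c) p -> trace (cell_curve d) q -> e <= dist1 p q.
Proof.
have [inj_pos arcE arcV arcX] := dE.
have cont c : cell_valid c -> continuous (cell_curve c).
  case: c => [w|e] /=; first by move=> _ t; exact: cvg_cst.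
  by move=> /arcE[u [v [_ []]]].
have [|cd e e' ee' H ? ? ? p q ? ?|e e0 He] := @finite_pos_bound ((V + {set V}) * (V + {set V}))%type
  (fun cd e => cell_valid cd.1 -> cell_valid cd.2 ->
    (forall w, w \in cell_verts cd.1 -> w \in cell_verts cd.2 -> False) ->
    forall p q, trace (cell_curve cd.1) p -> trace (cell_curve cd.2) q -> e <= dist1 p q).
- case=> c d /=; case: (boolP (cell_valid c)) => vc; last by exists 1.
  case: (boolP (cell_valid d)) => vd; last by exists 1.
  have [H|nH] := pselect (forall w, w \in cell_verts c -> w \in cell_verts d -> False); last by exists 1.
  have [|e e0 He] := curves_apart (cont _ vc) (cont _ vd).
    move=> s t s01 t01 /=.
    case: c d vc vd H => [w|e] [w'|e'] /= vc vd H E'.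
    + by apply: (H w); rewrite !inE ?(inj_pos _ _ vc vd E').
    + by apply: (H w); rewrite ?inE //; apply: arcV => //; exists t.
    + by apply: (H w'); rewrite ?inE //; apply: arcV => //; exists s.
    have [ee'|ee'] := eqVneq e e'.
      have [u [v [eu _]]] := arcE _ vc.
      by apply: (H u); rewrite -?ee' eu !inE eqxx.
    have [||w [we we' _]] := arcX e e' vc vd ee' (arc e s); last exact: (H w).
      by exists s.
    by exists t.
  by exists e => // _ _ _ p q [s s01 ->] [t t01 ->]; apply: He.
- by apply: le_trans ee' _; apply: H.
by exists e => // c d p q vc vd H tp tq; apply: (He (c, d)).
Qed.

Lemma adj_curve x y : adj E x y -> exists g, curve g (pos x) (pos y) /\
  trace g = trace (arc [set x; y]%SET).
Proof.
case/andP => xy eE; have [_ arcE _ _] := dE.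
have [u [v [E' cg]]] := arcE _ eE.
have xe : x \in [set u; v]%SET by rewrite -E' !inE eqxx.
have ye : y \in [set u; v]%SET by rewrite -E' !inE eqxx orbT.
move: (arc _) cg => g cg; case/set2P: xe => xE; case/set2P: ye => yE.
- by rewrite xE yE eqxx in xy.
- by exists g; rewrite xE yE.
- exists (fun t => g (1 - t)); rewrite xE yE trace_rev; split=> //.
  exact: curve_rev.
- by rewrite xE yE eqxx in xy.
Qed.

Lemma path_chain (B : pred V) (eta : R) x (s : seq V) : 0 < eta ->
  path (within_rel B (adj E)) x s ->
  exists l, [/\ path (near_pt eta) (pos x) l, last (pos x) l = pos (last x s) &
    forall p, p \in l -> exists c, [/\ cell_valid c, trace (cell_curve c) p &
      forall w, w \in cell_verts c -> B w]].
Proof.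
move=> eta0; elim: s x => [|y s IH] x /=; first by exists [::].
case/andP => /and3P[Bx By xy] /IH[l [Pl ll cl]].
have [g [[cg _ g0 g1] tg]] := adj_curve xy.
have [k [Pk lk ck]] := curve_chain cg eta0.
rewrite g0 g1 in Pk lk; exists (k ++ l); rewrite cat_path last_cat lk Pk; split=> // p.
rewrite mem_cat => /orP[/ck[t t01 pt]|/cl//].
exists (inr [set x; y]%SET); split.
- by have /andP[] := xy.
- by rewrite /= -tg; exists t.
- by move=> w; rewrite /= !inE => /orP[] /eqP ->.
Qed.

Lemma drawing_on_K5_free : ~ has_K 5 (adj E).
Proof.
case=> c [cadj cconn]; have [inj_pos _ _ _] := dE.
have /choice[xs Hxs] : forall i : 'I_5, exists x, c x = Some i /\ x \in A.
  move=> i; have [j ij] : exists j : 'I_5, i != j.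
    have [->|] := eqVneq i ord0; last by exists ord0.
    by exists ord_max.
  have [x [y [cx _ /(adj_supported iE)/andP[xA _]]]] := cadj _ _ ij.
  by exists x.
have [e e0 He] := cells_apart; pose eta := e / 4.
have eta0 : 0 < eta by rewrite divr_gt0.
have far p q : e <= dist1 p q -> far_pt eta p q.
  rewrite /dist1 /far_pt => H; apply/negPn/negP; rewrite negb_or -!ltNge => /andP[].
  by rewrite /eta; lra.
pose B i j : pred V := fun w => (c w == Some i) || (c w == Some j).
have conn i j : i != j -> connect (within_rel (B i j) (adj E)) (xs i) (xs j).
  move=> ij; have [x [y [cx cy xy]]] := cadj _ _ ij.
  have [ci _] := Hxs i; have [cj _] := Hxs j.
  apply: (@connect_trans _ _ x).
    apply: connect_sub (cconn _ _ _ ci cx) => u v /and3P[cu cv uv].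
    by apply: connect1; rewrite /within_rel /= /B cu cv uv.
  apply: (@connect_trans _ _ y).
    by apply: connect1; rewrite /within_rel /= /B cx cy !eqxx orbT xy.
  apply: connect_sub (cconn _ _ _ cy cj) => u v /and3P[cu cv uv].
  by apply: connect1; rewrite /within_rel /= /B cu cv uv !orbT.
pose X (i : nat) := pos (xs (inord i)).
pose cells i j p := exists d, [/\ cell_valid d, trace (cell_curve d) p &
      forall w, w \in cell_verts d -> B (inord i) (inord j) w].
have /choice[L HL] : forall ij : nat * nat, exists l, (ij.1 < ij.2 < 5)%N ->
    [/\ path (near_pt eta) (X ij.1) l, last (X ij.1) l = X ij.2 &
      forall p, p \in l -> cells ij.1 ij.2 p].
  move=> [i j] /=; have [ij|nij] := boolP (i < j < 5)%N; last by exists [::].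
  have /conn/connectP[s Ps ls] : (inord i : 'I_5) != inord j.
    by apply/eqP => /(congr1 (@nat_of_ord _)); rewrite !inordK; lia.
  have [l [Pl ll cl]] := path_chain eta0 Ps.
  by exists l => _; split; rewrite // ll -ls.
have cellX i : cells i i (X i).
  exists (inl (xs (inord i))); have [ci Ai] := Hxs (inord i); split => //.
    by exists 0; rewrite ?lexx ?ler01.
  by move=> w; rewrite inE => /eqP ->; rewrite /B ci eqxx.
have cellL i j p : (i < j < 5)%N -> p \in X i :: L (i, j) -> cells i j p.
  move=> ij; rewrite inE => /orP[/eqP ->|]; last by have [_ _] := HL (i, j) ij; apply.
  have [d [vd td Bd]] := cellX i; exists d; split=> // w /Bd.
  by rewrite /B orbb => ->.
have cells_far i j k l p q : (i < 5)%N -> (j < 5)%N -> (k < 5)%N -> (l < 5)%N ->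
   k \notin [:: i; j] -> l \notin [:: i; j] -> cells i j p -> cells k l q -> far_pt eta p q.
  move=> i5 j5 k5 l5; rewrite !inE !negb_or => /andP[ki kj] /andP[li lj].
  move=> [c1 [v1 t1 B1]] [c2 [v2 t2 B2]]; apply/far/(He c1 c2) => // w /B1 w1 /B2.
  have ne a b : (a < 5)%N -> (b < 5)%N -> b != a -> (inord a : 'I_5) != inord b.
    move=> a5 b5; apply: contra => /eqP /(congr1 (@nat_of_ord _)).
    by rewrite !inordK // => ->.
  rewrite /B; case/orP: w1 => /eqP ->; case/orP => /eqP [] /eqP; apply/negP; exact: ne.
apply: (@K5_chains_cross R eta eta0 X (fun i j => L (i, j))).
- by move=> i j ij; case: (HL (i, j) ij).
- by move=> i j ij; case: (HL (i, j) ij).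
- move=> i j ij.
  by apply: (cells_far i i j j) (cellX i) (cellX j); rewrite ?inE; lia.
- move=> i j k p ij k5 kij pL.
  by apply: (cells_far i j k k) (cellL _ _ _ ij pL) (cellX k) => //; lia.
- move=> i j k l p q ij kl U pL qL.
  apply: (cells_far i j k l) (cellL _ _ _ ij pL) (cellL _ _ _ kl qL);
    move: U; rewrite /= !inE; lia.
Qed.

End Drawn.

Lemma planar_on_K5_free (V : finType) (A : {set V}) (E : {set {set V}}) :
  inside A E -> planar_on A E -> K5_free E.
Proof. by move=> iE [pos [arc dE]]; apply/asboolP/(drawing_on_K5_free iE dE). Qed.

End PlanarOn.

Section PlanarConversion.
Variable R : realType.
Implicit Types (g h : R -> R * R) (s t : R) (p q : R * R).

Definition clamp t : R := (`|t| - `|t - 1| + 1) / 2.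

Lemma continuous_clamp : continuous clamp.
Proof.
move=> t; apply: cvgM; last exact: cvg_cst.
apply: cvgD; last exact: cvg_cst.
apply: cvgB; apply: cvg_norm; first exact: cvg_id.
by apply: cvgB; [exact: cvg_id|exact: cvg_cst].
Qed.

Lemma clamp_id t : 0 <= t <= 1 -> clamp t = t.
Proof.
move=> /andP[t0 t1]; rewrite /clamp ger0_norm // ler0_norm ?subr_le0 //; lra.
Qed.

Lemma clamp_le0 t : t <= 0 -> clamp t = 0.
Proof.
move=> t0; rewrite /clamp ler0_norm // ler0_norm ?subr_le0 //; lra.
Qed.

Lemma clamp_ge1 t : 1 <= t -> clamp t = 1.
Proof.
move=> t1; rewrite /clamp ger0_norm ?ger0_norm ?subr_ge0 //; lra.
Qed.

Lemma clamp01 t : 0 <= clamp t <= 1.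
Proof.
have [t0|t0] := leP t 0; first by rewrite clamp_le0 // lexx ler01.
have [t1|t1] := leP 1 t; first by rewrite clamp_ge1 // lexx ler01.
by rewrite clamp_id ?ltW.
Qed.

Lemma continuous_comp_clamp (T : topologicalType) (f : R -> T) :
  {within `[0, 1], continuous f} -> continuous (fun t => f (clamp t)).
Proof.
move=> /subspace_continuousP cf t.
have := cf (clamp t); rewrite /= in_itv /= clamp01 => /(_ isT) H.
apply: (cvg_comp clamp f _ H).
move=> P nP; have nP' : \forall x \near t, `[0, 1]%classic (clamp x) -> P (clamp x).
  exact: (@continuous_clamp t _ nP).
by apply: filterS nP' => x; apply; rewrite /= in_itv /= clamp01.
Qed.

Lemma trace_clamp g : trace (fun t => g (clamp t)) = trace g.
Proof.
by apply/seteqP; split=> p [t t01 ->]; exists t; rewrite // clamp_id.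
Qed.

Lemma is_arc_curve g p q : is_arc g p q -> curve (fun t => g (clamp t)) p q.
Proof.
case=> cg ig g0 g1; split; first exact: continuous_comp_clamp.
- by move=> s t s01 t01; rewrite !clamp_id // => /ig; apply; rewrite in_itv.
- by rewrite clamp_id // lexx ler01.
- by rewrite clamp_id // lexx ler01.
Qed.

Lemma curve_is_arc g p q : curve g p q -> is_arc g p q.
Proof.
by case=> cg ig g0 g1; split=> //; exact: continuous_subspaceT.
Qed.

Variable V : finType.
Implicit Types (A B : {set V}) (E F : {set {set V}}).

Lemma planar_planar_on E : planar R E -> planar_on R [set: V]%SET E.
Proof.
case=> pos [arc [inj_pos arcE arcV arcX]].
exists pos, (fun e t => arc e (clamp t)).
have ends e s : e \in E -> 0 <= s <= 1 -> ~ (0 < s < 1) -> exists2 u, u \in e & arc e s = pos u.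
  move=> eE /andP[s0 s1] ns; have [u [v [-> [_ _ g0 g1]]]] := arcE e eE.
  have [s0'|s0'] := eqVneq s 0; first by exists u; rewrite ?inE ?eqxx // s0' -g0.
  have [s1'|s1'] := eqVneq s 1; first by exists v; rewrite ?inE ?eqxx ?orbT // s1' -g1.
  by case: ns; rewrite !lt_neqAle eq_sym s0' s0 s1'.
split.
- by move=> u v _ _; apply: inj_pos.
- by move=> e /arcE[u [v [-> /is_arc_curve ?]]]; exists u, v.
- move=> e w eE _; rewrite trace_clamp => -[s s01 ws].
  have [s01'|s01'] := boolP (0 < s < 1).
    by case: (arcV e w eE); exists s => //; rewrite /= in_itv.
  have [u ue] := ends e s eE s01 (elimN idP s01').
  by rewrite -ws => /inj_pos ->.
- move=> e e' eE e'E ee' p; rewrite !trace_clamp => -[s s01 ps] [t t01 pt].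
  have [s01'|s01'] := boolP (0 < s < 1).
    have : set0 p.
      rewrite -(arcX e e' eE e'E ee'); split; first by exists s; rewrite //= in_itv.
      by exists t; rewrite //= in_itv.
    by [].
  have [t01'|t01'] := boolP (0 < t < 1).
    have : set0 p.
      rewrite -(arcX e' e e'E eE); last by rewrite eq_sym.
      split; first by exists t; rewrite //= in_itv.
      by exists s; rewrite //= in_itv.
    by [].
  have [u ue us] := ends e s eE s01 (elimN idP s01').
  have [u' ue' us'] := ends e' t e'E t01 (elimN idP t01').
  have uu' : u = u' by apply: inj_pos; rewrite -us -us' -ps -pt.
  by exists u; rewrite ue uu' ue' ps us uu'.
Qed.

Lemma planar_on_planar E : planar_on R [set: V]%SET E -> planar R E.
Proof.
case=> pos [arc [inj_pos arcE arcV arcX]]; exists pos, arc.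
have ends e s w : e \in E -> 0 < s < 1 -> w \in e -> arc e s <> pos w.
  move=> eE /andP[s0 s1] we ws; have [u [v [euv [_ ig g0 g1]]]] := arcE e eE.
  have s01 : 0 <= s <= 1 by rewrite !ltW.
  move: we; rewrite euv => /set2P[] wE.
    have := ig s 0 s01; rewrite lexx ler01 ws wE g0 => /(_ isT erefl) sE.
    by rewrite sE ltxx in s0.
  have := ig s 1 s01; rewrite lexx ler01 ws wE g1 => /(_ isT erefl) sE.
  by rewrite sE ltxx in s1.
split.
- by move=> u v; apply: inj_pos; rewrite inE.
- by move=> e /arcE[u [v [-> /curve_is_arc ?]]]; exists u, v.
- move=> e w eE [s /=]; rewrite in_itv /= => s01 ws.
  have we : w \in e.
    by apply: arcV; rewrite ?inE //; exists s; rewrite ?ws //; case/andP: s01 => *; rewrite !ltW.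
  exact: (ends e s w eE s01 we).
- move=> e e' eE e'E ee'; apply/seteqP; split=> // p [[s /=]].
  rewrite in_itv /= => s01 ps [t /=]; rewrite in_itv /= => t01 pt.
  have s01' : 0 <= s <= 1 by case/andP: s01 => *; rewrite !ltW.
  have [||w [we we' pw]] := arcX e e' eE e'E ee' p.
  + by exists s.
  + by exists t.
  by apply: (ends e s w eE s01 we); rewrite ps pw.
Qed.

Lemma planar_on_sub A B E F : B \subset A -> F \subset E ->
  planar_on R A E -> planar_on R B F.
Proof.
move=> /fintype.subsetP BA /fintype.subsetP FE [pos [arc [inj_pos arcE arcV arcX]]].
exists pos, arc; split.
- by move=> u v /BA uA /BA vA; apply: inj_pos.
- by move=> e /FE /arcE.
- by move=> e w /FE eE /BA wA; apply: arcV.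
- by move=> e e' /FE eE /FE e'E; apply: arcX.
Qed.
End PlanarConversion.

Section PlanarRelabel.
Variables (R : realType) (T V : finType) (f : T -> V).
Hypothesis f_inj : injective f.

Lemma planar_on_relabel (E : {set {set T}}) : inside [set: T]%SET E ->
  planar_on R (f @: [set: T])%SET (relabel f E) <-> planar_on R [set: T]%SET E.
Proof.
move=> iE; split=> -[pos [arc [inj_pos arcE arcV arcX]]].
  exists (fun x => pos (f x)), (fun e => arc (f @: (e : {set T}))%SET); split.
  - by move=> x y _ _ /inj_pos; rewrite !imset_f // => /(_ isT isT)/f_inj.
  - move=> e eE; have [x [y [_ _ _ exy]]] := insideP _ _ iE e eE.
    have [|u [v [euv cuv]]] := arcE (f @: (e : {set T}))%SET; first by rewrite mem_relabel.
    have : u \in (f @: (e : {set T}))%SET by rewrite euv !inE eqxx.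
    have : v \in (f @: (e : {set T}))%SET by rewrite euv !inE eqxx orbT.
    move=> /imsetP[b be vb] /imsetP[a ae ua]; rewrite ua vb in euv cuv.
    exists a, b; split => //; apply: (imset_inj f_inj).
    by rewrite imset_set2.
  - move=> e w eE _ /arcV; rewrite mem_relabel // imset_f // => /(_ eE isT).
    by rewrite mem_imset.
  - move=> e e' eE e'E ee' p pe pe'.
    have [||||| w [we we' pw]] := arcX (f @: (e : {set T}))%SET (f @: (e' : {set T}))%SET _ _ _ p.
    + by rewrite mem_relabel.
    + by rewrite mem_relabel.
    + by rewrite (inj_eq (imset_inj f_inj)).
    + by [].
    + by [].
    move: we we'; rewrite pw => /imsetP[x xe ->] xe'; exists x.
    by rewrite mem_imset in xe'.
pose g (v : V) : R * R := if [pick x | f x == v] is Some x then pos x else (0, 0).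
have gf x : g (f x) = pos x.
  by rewrite /g; case: pickP => [y /eqP/f_inj -> //|/(_ x)]; rewrite eqxx.
pose pre (e : {set V}) : {set T} := (f @^-1: e)%SET.
have pref e : pre (f @: (e : {set T}))%SET = e.
  by apply/setP => x; rewrite inE mem_imset.
exists g, (fun e => arc (pre e)); split.
- move=> _ _ /imsetP[x _ ->] /imsetP[y _ ->]; rewrite !gf => /inj_pos.
  by rewrite !inE => /(_ isT isT) ->.
- move=> _ /imsetP[e eE ->]; have [u [v [-> cuv]]] := arcE e eE.
  by exists (f u), (f v); rewrite !gf imset_set2 -imset_set2 pref.
- move=> _ _ /imsetP[e eE ->] /imsetP[w _ ->]; rewrite pref gf mem_imset //.
  by apply: arcV => //; rewrite inE.
- move=> _ _ /imsetP[e eE ->] /imsetP[e' e'E ->]; rewrite !pref => ee' p pe pe'.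
  have [|w [we we' pw]] := arcX e e' eE e'E _ p pe pe'.
    by apply: contraNneq ee' => ->.
  by exists (f w); rewrite gf !mem_imset.
Qed.

End PlanarRelabel.

(** * Gluing two drawings *)

Section Tentacles.
Variable R : realType.
Implicit Types (g h : R -> R * R) (s t : R) (p q z : R * R).

Lemma sqr_sum_gt (r a b : R) : 0 < r -> 0 <= a -> 0 <= b -> r * 4 <= a + b ->
  r ^+ 2 < a ^+ 2 + b ^+ 2.
Proof.
move=> r0 a0 b0 H; have ab := sqr_ge0 (a - b).
have : (r * 4) ^+ 2 <= (a + b) ^+ 2 by rewrite lerXn2r ?nnegrE ?mulr_ge0 ?addr_ge0 // ltW.
have := exprn_gt0 2 r0.
rewrite sqrrB sqrrD exprMn in ab *; move: (r ^+ 2) (a ^+ 2) (b ^+ 2) (a * b) ab => x y z w ab; lra.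
Qed.

Lemma first_hit (n : R -> R) (b c : R) : continuous n -> 0 < b -> c < n 0 -> n b < c ->
  exists t, [/\ 0 < t, t < b, n t = c & forall s, 0 <= s -> s < t -> c < n s].
Proof.
move=> cn b0 c0 cb.
pose S := `[0, b]%classic `&` [set t | n t <= c].
have kS : compact S.
  apply: subclosed_compact (@segment_compact R 0 b) _; last by move=> t [].
  apply: closedI; first exact: interval_closed.
  exact: ((continuous_closedP _).1 cn _ (@closed_le _ c)).
have S0 : S !=set0 by exists b; split; rewrite /= ?in_itv /= ?lexx ?andbT; exact: ltW.
have [t] := compact_EVT_min S0 kS (continuous_subspaceT (fun x => @cvg_id _ (nbhs x))).
rewrite inE => -[/=]; rewrite in_itv /= => /andP[t0 tb] ntc mint.
have before s : 0 <= s -> s < t -> c < n s.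
  move=> s0 st; rewrite ltNge; apply/negP => nsc.
  have : t <= s by apply: mint; rewrite inE; split; rewrite //= in_itv /= s0 ltW // (lt_le_trans st).
  by rewrite leNgt st.
have t0' : 0 < t.
  rewrite lt_neqAle t0 andbT; apply/negP => /eqP E.
  by move: ntc; rewrite -E leNgt c0.
have ntE : n t = c.
  apply/eqP; rewrite eq_le ntc leNgt; apply/negP => ltc.
  have [|s] := @IVT R n 0 t c t0 (continuous_subspaceT cn).
    by rewrite ge_min le_max (ltW c0) (ltW ltc) orbT.
  rewrite in_itv /= => /andP[s0]; rewrite le_eqVlt => /orP[/eqP ->|st] nsc.
    by rewrite nsc ltxx in ltc.
  by have := before s s0 st; rewrite nsc ltxx.
exists t; split=> //; rewrite lt_neqAle tb andbT.
by apply/negP => /eqP E; move: cb; rewrite -E ntE ltxx.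
Qed.

Lemma curve_map (F : R * R -> R * R) g p q : curve g p q ->
  (forall z, trace g z -> {for z, continuous F}) ->
  (forall y z, trace g y -> trace g z -> F y = F z -> y = z) ->
  curve (fun t => F (g (clamp t))) (F p) (F q).
Proof.
move=> [cg ig g0 g1] cF iF.
have tr t : trace g (g (clamp t)) by exists (clamp t) => //; exact: clamp01.
split.
- move=> t; apply: (continuous_comp (f := fun t => g (clamp t))); last exact: cF.
  by apply: continuous_comp; [exact: continuous_clamp|exact: cg].
- move=> s t s01 t01 /(iF _ _ (tr s) (tr t)).
  by rewrite !clamp_id //; apply: ig.
- by rewrite clamp_id ?g0 // lexx ler01.
- by rewrite clamp_id ?g1 // lexx ler01.
Qed.

Lemma trace_map (F : R * R -> R * R) g :
  trace (fun t => F (g (clamp t))) = F @` trace g.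
Proof.
apply/seteqP; split=> p.
  by move=> [t t01 ->]; exists (g (clamp t)) => //; exists (clamp t) => //; exact: clamp01.
by move=> [_ [t t01 ->] <-]; exists t => //; rewrite clamp_id.
Qed.

Variable V : finType.
Implicit Types (A : {set V}) (E : {set {set V}}).

(* A drawing of [E] in the region [P] together with two disjoint curves that
   leave it from [u] and [v] and end at [x] and [y]. *)
Record tentacled A E (u v : V) (P : R * R -> Prop) (x y : R * R)
    (pos : V -> R * R) (arc : {set V} -> R -> R * R) (tu tv : R -> R * R) : Prop :=
  Tentacled {
    tent_drawing : drawing_on A E pos arc;
    tent_pos : forall w, w \in A -> P (pos w);
    tent_arc : forall e p, e \in E -> trace (arc e) p -> P p;
    tent_u : curve tu (pos u) x;
    tent_v : curve tv (pos v) y;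
    tent_Pu : forall p, trace tu p -> p = x \/ P p;
    tent_Pv : forall p, trace tv p -> p = y \/ P p;
    tent_upos : forall w, w \in A -> trace tu (pos w) -> w = u;
    tent_vpos : forall w, w \in A -> trace tv (pos w) -> w = v;
    tent_uarc : forall e p, e \in E -> trace tu p -> trace (arc e) p ->
      u \in e /\ p = pos u;
    tent_varc : forall e p, e \in E -> trace tv p -> trace (arc e) p ->
      v \in e /\ p = pos v;
    tent_uv : forall p, trace tu p -> trace tv p -> False }.

Definition tentacled_in A E u v P x y :=
  exists pos arc tu tv, tentacled A E u v P x y pos arc tu tv.

Lemma tentacled_map (F : R * R -> R * R) A E u v (P Q : R * R -> Prop) x y :
  inside A E -> u \in A -> v \in A ->
  (forall z, P z \/ z = x \/ z = y -> {for z, continuous F}) ->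
  (forall z w, P z \/ z = x \/ z = y -> P w \/ w = x \/ w = y -> F z = F w -> z = w) ->
  (forall z, P z -> Q (F z)) ->
  tentacled_in A E u v P x y -> tentacled_in A E u v Q (F x) (F y).
Proof.
move=> iE uA vA cF iF PQ [pos [arc [tu [tv T]]]].
have [[inj_pos arcE arcV arcX] Ppos Parc cu cv Pu Pv upos vpos uarc varc uv] := T.
have Gpos w : w \in A -> P (pos w) \/ pos w = x \/ pos w = y by left; apply: Ppos.
have Garc e z : e \in E -> trace (arc e) z -> P z \/ z = x \/ z = y.
  by move=> eE /Parc; left; auto.
have Gu z : trace tu z -> P z \/ z = x \/ z = y by move=> /Pu[]; auto.
have Gv z : trace tv z -> P z \/ z = x \/ z = y by move=> /Pv[]; auto.
exists (fun w => F (pos w)), (fun e t => F (arc e (clamp t))),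
  (fun t => F (tu (clamp t))), (fun t => F (tv (clamp t))).
split; first split.
- by move=> a b aA bA /iF E'; apply: inj_pos => //; apply: E'; exact: Gpos.
- move=> e eE; have [a [b [eab c]]] := arcE e eE; exists a, b; split=> //.
  apply: curve_map c _ _ => [z /Garc-/(_ eE)/cF//|z w /Garc-/(_ eE) Gz /Garc-/(_ eE) Gw].
  exact: iF.
- move=> e w eE wA /=; rewrite (trace_map F (arc e)) => -[z tz /iF zw]; apply: arcV => //.
  by rewrite -zw //; [exact: Garc tz|exact: Gpos].
- move=> e e' eE e'E ee' p /=; rewrite (trace_map F (arc e)) (trace_map F (arc e')) => -[z tz <-] [z' tz' /iF zz'].
  have {}zz' : z' = z by apply: zz'; [exact: Garc tz'|exact: Garc tz].
  rewrite zz' in tz'; have [w [we we' ->]] := arcX e e' eE e'E ee' z tz tz'.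
  by exists w.
- by move=> w /Ppos /PQ.
- by move=> e p eE /=; rewrite (trace_map F (arc e)) => -[z /Parc-/(_ eE)/PQ ? <-].
- by apply: curve_map cu _ _ => [z /Gu/cF//|z w /Gu Gz /Gu Gw]; exact: iF.
- by apply: curve_map cv _ _ => [z /Gv/cF//|z w /Gv Gz /Gv Gw]; exact: iF.
- by move=> p /=; rewrite (trace_map F tu) => -[z /Pu Hz <-]; case: Hz => [->|/PQ]; [left|right].
- by move=> p /=; rewrite (trace_map F tv) => -[z /Pv Hz <-]; case: Hz => [->|/PQ]; [left|right].
- move=> w wA /=; rewrite (trace_map F tu) => -[z tz /iF zw]; apply: upos => //.
  by rewrite -zw //; [exact: Gu|exact: Gpos].
- move=> w wA /=; rewrite (trace_map F tv) => -[z tz /iF zw]; apply: vpos => //.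
  by rewrite -zw //; [exact: Gv|exact: Gpos].
- move=> e p eE /=; rewrite (trace_map F tu) (trace_map F (arc e)) => -[z tz <-] [z' tz' /iF zz'].
  have {}zz' : z' = z by apply: zz'; [exact: Garc tz'|exact: Gu].
  by rewrite zz' in tz'; have [ue ->] := uarc e z eE tz tz'.
- move=> e p eE /=; rewrite (trace_map F tv) (trace_map F (arc e)) => -[z tz <-] [z' tz' /iF zz'].
  have {}zz' : z' = z by apply: zz'; [exact: Garc tz'|exact: Gv].
  by rewrite zz' in tz'; have [ve ->] := varc e z eE tz tz'.
- move=> p /=; rewrite (trace_map F tu) (trace_map F tv) => -[z tz <-] [z' tz' /iF zz'].
  have {}zz' : z' = z by apply: zz'; [exact: Gv|exact: Gu].
  by rewrite zz' in tz'; apply: uv tz tz'.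
Qed.

Lemma tentacled_disc A E u v : inside A E -> [set u; v]%SET \in E ->
  planar_on R A E ->
  exists c r x y, [/\ 0 < r, (x.1 - c.1) ^+ 2 + (x.2 - c.2) ^+ 2 = r ^+ 2,
    (y.1 - c.1) ^+ 2 + (y.2 - c.2) ^+ 2 = r ^+ 2, x <> y &
    tentacled_in A (E :\ [set u; v])%SET u v
      (fun z => r ^+ 2 < (z.1 - c.1) ^+ 2 + (z.2 - c.2) ^+ 2) x y].
Proof.
move=> iE uvE [pos [arc dE]].
have [uv uA vA] := inside_adj iE uvE.
have uvadj : adj E u v by rewrite /adj /= uv.
have [g [cg tg]] := adj_curve dE uvadj.
have [cont_g inj_g g0 g1] := cg.
have [inj_pos arcE arcV arcX] := dE.
have half01 : 0 <= (2^-1 : R) <= 1 by apply/andP; split; lra.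
pose c := g 2^-1.
have in01 : 0 <= (0:R) <= 1 by rewrite lexx ler01.
have in11 : 0 <= (1:R) <= 1 by rewrite lexx ler01.
have posc w : w \in A -> c <> pos w.
  move=> wA cw; have : w \in [set u; v]%SET.
    by apply: arcV => //; rewrite -tg; exists 2^-1.
  rewrite !inE => /orP[] /eqP wE; move: cw; rewrite wE -?g0 -?g1 => /inj_g E'.
    by have := E' half01 in01; lra.
  by have := E' half01 in11; lra.
have arcc e : e \in E -> e != [set u; v]%SET -> ~ trace (arc e) c.
  move=> eE ne te; have [|w [we we' cw]] := arcX e [set u; v]%SET eE uvE ne c te.
    by rewrite -tg; exists 2^-1.
  have wA : w \in A by move: we'; rewrite !inE => /orP[] /eqP ->.
  exact: posc wA cw.
have cc : continuous (fun _ : R => c) by move=> t; exact: cvg_cst.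
have [||d1 d10 Hd1] := @finite_pos_bound R V (fun w d => w \in A -> d <= dist1 c (pos w)).
- move=> w; have [wA|wA] := boolP (w \in A); last by exists 1.
  by exists (dist1 c (pos w)) => //; apply/dist1_gt0/posc.
- by move=> w d d' dd' H /H; apply: le_trans.
have [||d2 d20 Hd2] := @finite_pos_bound R {set V}
   (fun e d => e \in E -> e != [set u; v]%SET -> forall p, trace (arc e) p -> d <= dist1 c p).
- move=> e; have [eE|eE] := boolP (e \in E); last by exists 1.
  have [ne|ne] := boolP (e != [set u; v]%SET); last by exists 1.
  have [_ [_ [_ [cont_e _ _ _]]]] := arcE e eE.
  have [|d d0 Hd] := curves_apart cc cont_e.
    by move=> s t _ t01 ct; apply: (arcc e eE ne); exists t.
  by exists d => // _ _ p [t t01 ->]; apply: (Hd 0 t).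
- by move=> e d d' dd' H eE ne p /(H eE ne); apply: le_trans.
pose r := Num.min d1 d2 / 4.
have r0 : 0 < r by rewrite divr_gt0 // lt_min d10.
pose N z := (z.1 - c.1) ^+ 2 + (z.2 - c.2) ^+ 2.
have farN z : r * 4 <= dist1 c z -> r ^+ 2 < N z.
  rewrite /dist1 /N => H.
  have E1 : (z.1 - c.1) ^+ 2 = `|c.1 - z.1| ^+ 2 by rewrite real_normK ?num_real // -sqrrN opprB.
  have E2 : (z.2 - c.2) ^+ 2 = `|c.2 - z.2| ^+ 2 by rewrite real_normK ?num_real // -sqrrN opprB.
  rewrite E1 E2; move: (normr_ge0 (c.1 - z.1)) (normr_ge0 (c.2 - z.2)) H.
  exact: sqr_sum_gt.
have r4 : r * 4 = Num.min d1 d2 by rewrite /r divfK.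
have Npos w : w \in A -> r ^+ 2 < N (pos w).
  by move=> wA; apply: farN; rewrite r4 ge_min Hd1.
have Narc e p : e \in E -> e != [set u; v]%SET -> trace (arc e) p -> r ^+ 2 < N p.
  by move=> eE ne tp; apply: farN; rewrite r4 ge_min (Hd2 e eE ne p tp) orbT.
have cN : continuous N.
  have ca (k : R * R -> R) a : continuous k -> continuous (fun z => (k z - a) ^+ 2).
    move=> ck z; have cka : k z' - a @[z' --> z] --> k z - a.
      by apply: cvgB; [exact: ck|exact: cvg_cst].
    exact: (cvgM cka cka).
  by move=> z; apply: cvgD; apply: ca; [exact: continuous_fstR|exact: continuous_sndR].
have hit h : continuous h -> r ^+ 2 < N (h 0) -> h 2^-1 = c ->
   exists t, [/\ 0 < t, t < 2^-1, N (h t) = r ^+ 2 & forall s, 0 <= s -> s < t -> r ^+ 2 < N (h s)].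
  move=> ch h0 hc; apply: (@first_hit (fun t => N (h t))) => //.
  - by move=> t; apply: (continuous_comp (f := h)); [exact: ch|exact: cN].
  - by rewrite hc /N !subrr expr0n /= addr0 exprn_gt0.
have Nu : r ^+ 2 < N (g 0) by rewrite g0; apply: Npos.
have Nv : r ^+ 2 < N (g (1 - 0)) by rewrite subr0 g1; apply: Npos.
have [t [t0 th Nt bt]] := hit g cont_g Nu erefl.
have [cont_k inj_k k0 k1] := curve_rev cg.
have [|t' [t'0 t'h Nt' bt']] := hit (fun t => g (1 - t)) cont_k Nv.
  by rewrite /c; congr g; lra.
have sc (a : R) h : continuous h -> continuous (fun s => h (a * s)).
  move=> ch s; apply: (continuous_comp (f := fun s => a * s)); last exact: ch.
  by apply: cvgM; [exact: cvg_cst|exact: cvg_id].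
have sc01 (a s : R) : 0 < a -> a < 2^-1 -> 0 <= s <= 1 -> 0 <= a * s <= 1.
  by move=> ? ? /andP[? ?]; apply/andP; split; nra.
exists c, r, (g t), (g (1 - t')); split=> //.
  move/inj_g => E'; have : t = 1 - t' by apply: E'; apply/andP; split; lra.
  by lra.
have E'E e : e \in (E :\ [set u; v])%SET -> e \in E /\ e != [set u; v]%SET.
  by rewrite !inE => /andP[].
exists pos, arc, (fun s => g (t * s)), (fun s => g (1 - t' * s)).
have tru p : trace (fun s => g (t * s)) p -> trace (arc [set u; v]%SET) p.
  by move=> [s s01 ->]; rewrite -tg; exists (t * s) => //; apply: sc01.
have trv p : trace (fun s => g (1 - t' * s)) p -> trace (arc [set u; v]%SET) p.
  by move=> [s s01 ->]; rewrite -tg; exists (1 - t' * s) => //; apply/unit_rev/sc01.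
have nuv p : trace (fun s => g (t * s)) p -> p <> pos v.
  move=> [s s01 ->]; rewrite -g1 => /inj_g E'.
  have : t * s = 1 by apply: E' => //; apply: sc01.
  by move: s01 => /andP[? ?]; nra.
have nvu p : trace (fun s => g (1 - t' * s)) p -> p <> pos u.
  move=> [s s01 ->]; rewrite -g0 => /inj_g E'.
  have : 1 - t' * s = 0 by apply: E' => //; apply/unit_rev/sc01.
  by move: s01 => /andP[? ?]; nra.
split.
- split=> //.
  + by move=> e /E'E[/arcE].
  + by move=> e w /E'E[eE _]; apply: arcV.
  + by move=> e e' /E'E[eE _] /E'E[e'E _]; apply: arcX.
- exact: Npos.
- by move=> e p /E'E[eE ne]; apply: Narc.
- split; rewrite ?mulr0 ?mulr1 //; first exact: sc.
  move=> s s' s01 s01' /inj_g E'.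
  have /mulfI : t * s = t * s' by apply: E'; apply: sc01.
  by apply; rewrite gt_eqF.
- split; rewrite ?mulr0 ?mulr1 ?subr0 //; first exact: sc cont_k.
  move=> s s' s01 s01' /inj_g E'.
  have /addrI/oppr_inj/mulfI : 1 - t' * s = 1 - t' * s' by apply: E'; apply/unit_rev/sc01.
  by apply; rewrite gt_eqF.
- move=> p [s /andP[s0 s1] ->]; move: s1; rewrite le_eqVlt => /orP[/eqP ->|s1].
    by left; rewrite mulr1.
  by right; apply: bt; [rewrite mulr_ge0 // ltW|rewrite gtr_pMr].
- move=> p [s /andP[s0 s1] ->]; move: s1; rewrite le_eqVlt => /orP[/eqP ->|s1].
    by left; rewrite mulr1.
  by right; apply: bt'; [rewrite mulr_ge0 // ltW|rewrite gtr_pMr].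
- move=> w wA tw; have := arcV _ _ uvE wA (tru _ tw); rewrite !inE.
  by case/orP => /eqP // wv; case: (nuv _ tw); rewrite wv.
- move=> w wA tw; have := arcV _ _ uvE wA (trv _ tw); rewrite !inE.
  by case/orP => /eqP // wv; case: (nvu _ tw); rewrite wv.
- move=> e p /E'E[eE ne] tp te.
  have [w [we]] := arcX _ _ eE uvE ne p te (tru _ tp).
  rewrite !inE => /orP[] /eqP wE pw; first by rewrite -wE.
  by case: (nuv _ tp); rewrite pw wE.
- move=> e p /E'E[eE ne] tp te.
  have [w [we]] := arcX _ _ eE uvE ne p te (trv _ tp).
  rewrite !inE => /orP[] /eqP wE pw; last by rewrite -wE.
  by case: (nvu _ tp); rewrite pw wE.
- move=> p [s s01 ->] [s' s01' /inj_g E'].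
  have : t * s = 1 - t' * s' by apply: E'; [apply: sc01|apply/unit_rev/sc01].
  by move: s01 s01' => /andP[? ?] /andP[? ?]; nra.
Qed.

End Tentacles.

Section HalfPlane.
Variable R : realType.
Implicit Types (p q z w : R * R).

Lemma continuous_pair_at (f k : R * R -> R) z :
  {for z, continuous f} -> {for z, continuous k} ->
  {for z, continuous (fun w => (f w, k w))}.
Proof. by move=> cf ck; exact: (cvg_pair cf ck). Qed.

Lemma continuous_affine_fst (a b : R) : continuous (fun z : R * R => (z.1 - a) / b).
Proof.
move=> z; apply: cvgM; last exact: cvg_cst.
by apply: cvgB; [exact: continuous_fstR|exact: cvg_cst].
Qed.

Lemma continuous_affine_snd (a b : R) : continuous (fun z : R * R => (z.2 - a) / b).
Proof.
move=> z; apply: cvgM; last exact: cvg_cst.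
by apply: cvgB; [exact: continuous_sndR|exact: cvg_cst].
Qed.

(* The map [z |-> i (z + 1) / (z - 1)] of the complex plane. *)
Definition cayley z : R * R :=
  let N := (z.1 - 1) ^+ 2 + z.2 ^+ 2 in
  (2 * z.2 / N, (z.1 ^+ 2 + z.2 ^+ 2 - 1) / N).

Lemma cayley_norm_gt0 z : z <> (1, 0) -> 0 < (z.1 - 1) ^+ 2 + z.2 ^+ 2.
Proof.
case: z => x y /= H; rewrite lt_neqAle addr_ge0 ?sqr_ge0 // andbT eq_sym.
rewrite paddr_eq0 ?sqr_ge0 // !sqrf_eq0 subr_eq0.
by apply/negP => /andP[/eqP E1 /eqP E2]; apply: H; rewrite E1 E2.
Qed.

Lemma continuous_cayley z : z <> (1, 0) -> {for z, continuous cayley}.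
Proof.
move=> /cayley_norm_gt0 N0.
have c1 : {for z, continuous (fun z : R * R => z.1)} by exact: continuous_fstR.
have c2 : {for z, continuous (fun z : R * R => z.2)} by exact: continuous_sndR.
have cN : {for z, continuous (fun z : R * R => ((z.1 - 1) ^+ 2 + z.2 ^+ 2)^-1)}.
  apply: cvgV; first by rewrite gt_eqF.
  apply: cvgD; last exact: (cvgM c2 c2).
  have c11 : {for z, continuous (fun z : R * R => z.1 - 1)}.
    by apply: cvgB; [exact: c1|exact: cvg_cst].
  exact: (cvgM c11 c11).
apply: continuous_pair_at; apply: cvgM; try exact: cN.
  by apply: cvgM; [exact: cvg_cst|exact: c2].
apply: cvgB; last exact: cvg_cst.
by apply: cvgD; [exact: (cvgM c1 c1)|exact: (cvgM c2 c2)].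
Qed.

Lemma cayley_inj z w : z <> (1, 0) -> w <> (1, 0) -> cayley z = cayley w -> z = w.
Proof.
move=> /cayley_norm_gt0 + /cayley_norm_gt0; case: z w => [x y] [x' y'] /=.
rewrite /cayley /=.
have key (a b : R) : 0 < (a - 1) ^+ 2 + b ^+ 2 ->
    (2 * b / ((a - 1) ^+ 2 + b ^+ 2)) ^+ 2 +
    ((a ^+ 2 + b ^+ 2 - 1) / ((a - 1) ^+ 2 + b ^+ 2) - 1) ^+ 2 =
    4 / ((a - 1) ^+ 2 + b ^+ 2).
  by move=> N0; field; rewrite gt_eqF.
move=> N0 N0' [E1 E2]; have := key _ _ N0; rewrite E1 E2 (key _ _ N0') => /mulfI.
rewrite pnatr_eq0 => /(_ isT)/invr_inj NN; rewrite NN in E1 E2.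
have Nu : ((x - 1) ^+ 2 + y ^+ 2)^-1 != 0 by rewrite invr_eq0 gt_eqF.
move/(mulIf Nu): E1 => /mulfI; rewrite pnatr_eq0 => /(_ isT) yy.
move/(mulIf Nu): E2 => xx; rewrite yy in NN xx *.
by congr (_, _); lra.
Qed.

Variable V : finType.
Implicit Types (A : {set V}) (E : {set {set V}}).

Definition norm2 z : R := z.1 ^+ 2 + z.2 ^+ 2.

Lemma tentacled_unit_disc A E u v : inside A E -> [set u; v]%SET \in E ->
  planar_on R A E -> exists x y, [/\ norm2 x = 1, norm2 y = 1, x <> y &
    tentacled_in A (E :\ [set u; v])%SET u v (fun z => 1 < norm2 z) x y].
Proof.
move=> iE uvE pE; have [uv uA vA] := inside_adj iE uvE.
have [c [r [x [y [r0 Nx Ny xy T]]]]] := tentacled_disc iE uvE pE.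
pose F z : R * R := ((z.1 - c.1) / r, (z.2 - c.2) / r).
have rU : r^-1 != 0 by rewrite invr_eq0 gt_eqF.
have Finj z w : F z = F w -> z = w.
  case: z w => [z1 z2] [w1 w2] [/(mulIf rU)/addIr -> /(mulIf rU)/addIr ->] //.
have FN z : norm2 (F z) = ((z.1 - c.1) ^+ 2 + (z.2 - c.2) ^+ 2) / r ^+ 2.
  by rewrite /norm2 /F /= !expr_div_n mulrDl.
have r2 : 0 < r ^+ 2 by rewrite exprn_gt0.
exists (F x), (F y); split.
- by rewrite FN Nx divff // gt_eqF.
- by rewrite FN Ny divff // gt_eqF.
- by move/Finj.
apply: tentacled_map T => //.
- exact: inside_subset (subD1set _ _) iE.
- by move=> z _; apply: continuous_pair_at;
    [exact: continuous_affine_fst|exact: continuous_affine_snd].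
- by move=> z w _ _ /Finj.
- by move=> z zr; rewrite FN ltr_pdivlMr // mul1r.
Qed.

Lemma tentacled_unit_disc' A E u v : inside A E -> [set u; v]%SET \in E ->
  planar_on R A E -> exists x y, [/\ norm2 x = 1 /\ norm2 y = 1, x <> y,
    x <> (1, 0), y <> (1, 0) &
    tentacled_in A (E :\ [set u; v])%SET u v (fun z => 1 < norm2 z) x y].
Proof.
move=> iE uvE pE; have [uv uA vA] := inside_adj iE uvE.
have [x [y [Nx Ny xy T]]] := tentacled_unit_disc iE uvE pE.
have iE' := inside_subset (subD1set E [set u; v]%SET) iE.
have step (F : R * R -> R * R) : involutive F -> continuous F ->
    (forall z, norm2 (F z) = norm2 z) -> x <> F (1, 0) -> y <> F (1, 0) ->
    exists x y, [/\ norm2 x = 1 /\ norm2 y = 1, x <> y,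
      x <> (1, 0), y <> (1, 0) &
      tentacled_in A (E :\ [set u; v])%SET u v (fun z => 1 < norm2 z) x y].
  move=> FF cF NF x1 y1; exists (F x), (F y); split.
  - by rewrite !NF.
  - by move/(inv_inj FF).
  - by move=> E1; apply: x1; rewrite -E1 FF.
  - by move=> E1; apply: y1; rewrite -E1 FF.
  apply: tentacled_map T => //.
  - by move=> z _; exact: cF.
  - by move=> z w _ _ /(inv_inj FF).
  - by move=> z; rewrite NF.
have [x1|x1] := eqVneq x (1, 0); last have [y1|y1] := eqVneq y (1, 0).
- have [y2|y2] := eqVneq y (-1, 0).
    apply: (step (fun z => (z.2, z.1))).
    + by case.
    + by move=> z; apply: continuous_pair_at; [exact: continuous_sndR|exact: continuous_fstR].
    + by move=> z; rewrite /norm2 /= addrC.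
    + by rewrite x1 /= => -[/eqP]; rewrite oner_eq0.
    + by rewrite y2 /= => -[/eqP]; rewrite oppr_eq0 oner_eq0.
  apply: (step (fun z => - z)); try exact: opprK.
  + by move=> z; apply: cvgN; exact: cvg_id.
  + by move=> z; rewrite /norm2 /= !sqrrN.
  + by rewrite x1 => -[/eqP]; rewrite -subr_eq0 opprK paddr_eq0 ?ler01 // oner_eq0.
  + by move=> E1; case/eqP: y2; rewrite E1; congr (_, _); rewrite oppr0.
- have [y2|y2] := eqVneq x (-1, 0).
    apply: (step (fun z => (z.2, z.1))).
    + by case.
    + by move=> z; apply: continuous_pair_at; [exact: continuous_sndR|exact: continuous_fstR].
    + by move=> z; rewrite /norm2 /= addrC.
    + by rewrite y2 /= => -[/eqP]; rewrite oppr_eq0 oner_eq0.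
    + by rewrite y1 /= => -[/eqP]; rewrite oner_eq0.
  apply: (step (fun z => - z)); try exact: opprK.
  + by move=> z; apply: cvgN; exact: cvg_id.
  + by move=> z; rewrite /norm2 /= !sqrrN.
  + by move=> E1; case/eqP: y2; rewrite E1; congr (_, _); rewrite oppr0.
  + by rewrite y1 => -[/eqP]; rewrite -subr_eq0 opprK paddr_eq0 ?ler01 // oner_eq0.
by exists x, y; split=> //; apply/eqP.
Qed.

Lemma tentacled_half_plane A E u v : inside A E -> [set u; v]%SET \in E ->
  planar_on R A E ->
  tentacled_in A (E :\ [set u; v])%SET u v (fun z => 0 < z.2) (0, 0) (1, 0).
Proof.
move=> iE uvE pE; have [uv uA vA] := inside_adj iE uvE.
have iE' := inside_subset (subD1set E [set u; v]%SET) iE.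
have [x [y [[Nx Ny] xy x1 y1 T]]] := tentacled_unit_disc' iE uvE pE.
have ne z : 1 < norm2 z \/ z = x \/ z = y -> z <> (1, 0).
  case=> [H zE|[->|->]//]; move: H.
  by rewrite zE /norm2 /= expr1n expr0n addr0 ltxx.
have T2 : tentacled_in A (E :\ [set u; v])%SET u v (fun z => 0 < z.2) (cayley x) (cayley y).
  apply: tentacled_map T => //.
  - by move=> z /ne; apply: continuous_cayley.
  - by move=> z w /ne z1 /ne w1; apply: cayley_inj.
  - move=> z zN; rewrite /cayley /= divr_gt0 // ?subr_gt0 //.
    by apply: cayley_norm_gt0; apply: ne; left.
have on_line z : norm2 z = 1 -> (cayley z).2 = 0.
  by rewrite /norm2 /cayley /= => ->; rewrite subrr mul0r.
pose a := (cayley x).1; pose b := (cayley y).1.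
have xE : cayley x = (a, 0) by rewrite /a -(on_line x Nx); case: (cayley x).
have yE : cayley y = (b, 0) by rewrite /b -(on_line y Ny); case: (cayley y).
have ab : b - a != 0.
  rewrite subr_eq0; apply/eqP => ab; apply: xy; apply: cayley_inj => //.
  by rewrite xE yE ab.
rewrite xE yE in T2.
pose F z : R * R := ((z.1 - a) / (b - a), (z.2 - 0) / 1).
have -> : (0, 0) = F (a, 0) by rewrite /F /= !subrr !mul0r.
have -> : (1, 0) = F (b, 0) by rewrite /F /= divff // subrr mul0r.
apply: tentacled_map T2 => //.
- by move=> z _; apply: continuous_pair_at;
    [exact: continuous_affine_fst|exact: continuous_affine_snd].
- move=> [z1 z2] [w1 w2] _ _ [/mulIf E1]; rewrite !subr0 !divr1 => ->.
  by move: E1; rewrite invr_eq0 ab => /(_ isT)/addIr ->.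
- by move=> z; rewrite /F /= subr0 divr1.
Qed.

Lemma tentacled_lower_half_plane A E u v : inside A E -> [set u; v]%SET \in E ->
  planar_on R A E ->
  tentacled_in A (E :\ [set u; v])%SET u v (fun z => z.2 < 0) (0, 0) (1, 0).
Proof.
move=> iE uvE pE; have [uv uA vA] := inside_adj iE uvE.
have iE' := inside_subset (subD1set E [set u; v]%SET) iE.
pose F z : R * R := (z.1, - z.2).
have F0 (t : R) : (t, 0) = F (t, 0) by rewrite /F /= oppr0.
rewrite [(0, 0)]F0 [(1, 0)]F0.
apply: tentacled_map (tentacled_half_plane iE uvE pE) => //.
- move=> z _; apply: continuous_pair_at; first exact: continuous_fstR.
  by apply: cvgN; exact: continuous_sndR.
- by move=> [z1 z2] [w1 w2] _ _ [-> /oppr_inj ->].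
- by move=> z; rewrite /F /= oppr_lt0.
Qed.

End HalfPlane.

Section Concatenation.
Variable R : realType.
Implicit Types (g h : R -> R * R) (s t : R) (p q r z w : R * R).

Definition curve_cat g h t : R * R := g (clamp (2 * t)) + h (clamp (2 * t - 1)) - h 0.

Lemma curve_cat_left g h t : t <= 2^-1 -> curve_cat g h t = g (clamp (2 * t)).
Proof.
move=> t2; rewrite /curve_cat (@clamp_le0 _ (2 * t - 1)); first by rewrite addrK.
by lra.
Qed.

Lemma curve_cat_right g h t : g 1 = h 0 -> 2^-1 <= t ->
  curve_cat g h t = h (clamp (2 * t - 1)).
Proof.
move=> gh t2; rewrite /curve_cat (@clamp_ge1 _ (2 * t)); last by lra.
by rewrite gh addrAC subrr add0r.
Qed.

Lemma continuous_comp_clampM (T : topologicalType) (f : R -> T) (a b : R) :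
  continuous f -> continuous (fun t => f (clamp (a * t - b))).
Proof.
move=> cf t; apply: (continuous_comp (f := fun t => clamp (a * t - b))); last exact: cf.
apply: (continuous_comp (f := fun t => a * t - b)); last exact: continuous_clamp.
by apply: cvgB; [apply: cvgM; [exact: cvg_cst|exact: cvg_id]|exact: cvg_cst].
Qed.

Lemma trace_clamped g t : trace g (g (clamp t)).
Proof. by exists (clamp t) => //; exact: clamp01. Qed.

Lemma trace_cat g h : g 1 = h 0 -> trace (curve_cat g h) = trace g `|` trace h.
Proof.
move=> gh; apply/seteqP; split=> p.
  move=> [t t01 ->]; have [t2|t2] := leP t 2^-1.
    by left; rewrite curve_cat_left //; exact: trace_clamped.
  by right; rewrite curve_cat_right ?ltW //; exact: trace_clamped.
case=> -[t /andP[t0 t1] ->].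
  exists (t / 2); first by apply/andP; split; lra.
  rewrite curve_cat_left; last by lra.
  by rewrite mulrCA divff ?pnatr_eq0 // mulr1 clamp_id // t0.
exists ((t + 1) / 2); first by apply/andP; split; lra.
rewrite curve_cat_right //; last by lra.
by rewrite mulrCA divff ?pnatr_eq0 // mulr1 addrK clamp_id // t0.
Qed.

Lemma curve_cat_curve g h p q r : curve g p q -> curve h q r ->
  (forall z, trace g z -> trace h z -> z = q) -> curve (curve_cat g h) p r.
Proof.
move=> [cg ig g0 g1] [ch ih h0 h1] gh; have gh1 : g 1 = h 0 by rewrite g1 h0.
split.
- have c2 : continuous (fun t => g (clamp (2 * t))).
    rewrite (_ : (fun t => _) = (fun t => g (clamp (2 * t - 0)))).
      exact: continuous_comp_clampM.
    by apply/funext => t; rewrite subr0.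
  move=> t; apply: cvgB; last exact: cvg_cst.
  by apply: cvgD; [exact: c2|exact: continuous_comp_clampM].
- have mixed s t : 0 <= s <= 1 -> 0 <= t <= 1 -> s <= 2^-1 -> 2^-1 <= t ->
      curve_cat g h s = curve_cat g h t -> s = t.
    move=> /andP[s0 s1] /andP[t0 t1] s2 t2.
    rewrite curve_cat_left // curve_cat_right // => E.
    have Eq : g (clamp (2 * s)) = q.
      apply: gh; first exact: trace_clamped.
      by rewrite E; exact: trace_clamped.
    have s01 : 0 <= 2 * s <= 1 by apply/andP; split; lra.
    have t01 : 0 <= 2 * t - 1 <= 1 by apply/andP; split; lra.
    rewrite !clamp_id // in E Eq.
    have E1 : 2 * s = 1 by apply: ig; rewrite ?g1 // ler01 lexx.
    have E2 : 2 * t - 1 = 0 by apply: ih; rewrite ?h0 -?E // ler01 lexx.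
    by lra.
  move=> s t s01 t01; have [s2|s2] := leP s 2^-1; have [t2|t2] := leP t 2^-1.
  + rewrite !curve_cat_left // !clamp_id; try by case/andP: s01 => ? ?; case/andP: t01 => ? ?; apply/andP; split; lra.
    move/ig => E; have : 2 * s = 2 * t by apply: E; case/andP: s01 => ? ?; case/andP: t01 => ? ?; apply/andP; split; lra.
    by move=> ?; lra.
  + by apply: mixed => //; exact: ltW.
  + by move=> E; symmetry; apply: mixed => //; exact: ltW.
  + rewrite !curve_cat_right ?ltW // !clamp_id; try by case/andP: s01 => ? ?; case/andP: t01 => ? ?; apply/andP; split; lra.
    move/ih => E; have : 2 * s - 1 = 2 * t - 1 by apply: E; case/andP: s01 => ? ?; case/andP: t01 => ? ?; apply/andP; split; lra.
    by move=> ?; lra.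
- by rewrite curve_cat_left ?invr_ge0 // mulr0 clamp_le0.
- rewrite curve_cat_right //; last by lra.
  by rewrite mulr1 clamp_ge1 //; lra.
Qed.

End Concatenation.

Section Glue.
Variables (R : realType) (V : finType).
Implicit Types (A B e eu ev : {set V}) (E F : {set {set V}}) (p : R * R) (w : V).

Definition piece E (arc : {set V} -> R -> R * R) (eu ev : {set V}) tu tv e p : Prop :=
  [\/ e = eu /\ trace tu p, e = ev /\ trace tv p | e \in E /\ trace (arc e) p].

Lemma piece_meet A E u v P x y pos arc tu tv eu ev e e' p :
  inside A E -> u \in A -> v \in A -> u \in eu -> v \in ev -> e <> e' ->
  tentacled A E u v P x y pos arc tu tv ->
  piece E arc eu ev tu tv e p -> piece E arc eu ev tu tv e' p ->
  exists w, [/\ w \in A, w \in e, w \in e' & p = pos w].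
Proof.
move=> iE uA vA ueu vev ee' [[_ _ _ arcX] _ _ _ _ _ _ _ _ uarc varc uv].
have EA f w : f \in E -> w \in f -> w \in A.
  by move=> fE; have /andP[_ /fintype.subsetP] := forall_inP iE f fE; apply.
case=> [[E1 t1]|[E1 t1]|[E1 t1]] [[E2 t2]|[E2 t2]|[E2 t2]]; subst.
- by [].
- by case: (uv p).
- by have [ue ->] := uarc _ _ E2 t1 t2; exists u.
- by case: (uv p).
- by [].
- by have [ve ->] := varc _ _ E2 t1 t2; exists v.
- by have [ue ->] := uarc _ _ E1 t2 t1; exists u.
- by have [ve ->] := varc _ _ E1 t2 t1; exists v.
- have [|w [we we' pw]] := arcX e e' E1 E2 _ p t1 t2; first exact/eqP.
  by exists w; rewrite (EA e).
Qed.

Lemma piece_pos A E u v P x y pos arc tu tv eu ev e w :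
  u \in eu -> v \in ev -> w \in A ->
  tentacled A E u v P x y pos arc tu tv ->
  piece E arc eu ev tu tv e (pos w) -> w \in e.
Proof.
move=> ueu vev wA [[_ _ arcV _] _ _ _ _ _ _ upos vpos _ _ _].
case=> [[-> /upos ->//]|[-> /vpos ->//]|[eE /arcV]]; exact.
Qed.

Lemma piece_region A E u v P x y pos arc tu tv eu ev e p :
  tentacled A E u v P x y pos arc tu tv -> piece E arc eu ev tu tv e p ->
  [\/ P p, p = x /\ e = eu | p = y /\ e = ev].
Proof.
move=> [_ _ Parc _ _ Pu Pv _ _ _ _ _].
case=> [[-> /Pu[]]|[-> /Pv[]]|[eE /Parc-/(_ eE)]]; by [constructor 1|constructor 2|constructor 3].
Qed.

Definition edge_swap E F u v u' v' : {set {set V}} :=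
  ([set [set u; u']; [set v; v']] :|: ((E :\ [set u; v]) :|: (F :\ [set u'; v'])))%SET.

Lemma edge_swap_planar A B E F u v u' v' :
  [disjoint A & B]%B -> inside A E -> inside B F ->
  [set u; v]%SET \in E -> [set u'; v']%SET \in F ->
  planar_on R A E -> planar_on R B F ->
  planar_on R (A :|: B)%SET (edge_swap E F u v u' v').
Proof.
move=> dAB iE iF uvE uvF pE pF.
have [uv uA vA] := inside_adj iE uvE; have [uv' u'B v'B] := inside_adj iF uvF.
have [posA [arcA [tu [tv TA]]]] := tentacled_half_plane iE uvE pE.
have [posB [arcB [tu' [tv' TB]]]] := tentacled_lower_half_plane iF uvF pF.
have nAB w : w \in A -> w \in B -> False.
  by move=> wA wB; have := disjointFr dAB wA; rewrite wB.
pose eu := [set u; u']%SET; pose ev := [set v; v']%SET.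
pose E' := (E :\ [set u; v])%SET; pose F' := (F :\ [set u'; v'])%SET.
have iE' : inside A E' := inside_subset (subD1set _ _) iE.
have iF' : inside B F' := inside_subset (subD1set _ _) iF.
pose pos w := if w \in A then posA w else posB w.
have posAE w : w \in A -> pos w = posA w by rewrite /pos => ->.
have posBE w : w \in B -> pos w = posB w.
  by rewrite /pos; case: ifP => // wA wB; case: (nAB w).
pose arc e := if e == eu then curve_cat tu (fun t => tu' (1 - t)) else
  if e == ev then curve_cat tv (fun t => tv' (1 - t)) else
  if e \in E' then arcA e else arcB e.
have evu : ev != eu.
  apply/eqP => /setP/(_ u); rewrite !inE eqxx /= (negPf uv) /= => /eqP uv2.
  by apply: (nAB u); rewrite // uv2.
have neE e : e \in E' -> e != eu /\ e != ev.
  move=> eE; have /andP[_ /fintype.subsetP eA] := forall_inP iE' e eE.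
  split; apply/eqP => E0; rewrite E0 in eA.
    by apply: (nAB u') => //; apply: eA; rewrite !inE eqxx orbT.
  by apply: (nAB v') => //; apply: eA; rewrite !inE eqxx orbT.
have neF e : e \in F' -> [/\ e != eu, e != ev & e \notin E'].
  move=> eF; have /andP[_ /fintype.subsetP eB] := forall_inP iF' e eF.
  split; [apply/eqP => E0|apply/eqP => E0|apply/negP => eE'].
  - by rewrite E0 in eB; apply: (nAB u) => //; apply: eB; rewrite !inE eqxx.
  - by rewrite E0 in eB; apply: (nAB v) => //; apply: eB; rewrite !inE eqxx.
  have [a [b [_ aA _ eab]]] := insideP _ _ iE' e eE'.
  by apply: (nAB a) => //; apply: eB; rewrite eab !inE eqxx.
have cu := tent_u TA; have cv := tent_v TA.
have cu' := curve_rev (tent_u TB); have cv' := curve_rev (tent_v TB).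
have joinu : tu 1 = tu' (1 - 0) by rewrite subr0; case: cu => _ _ _ ->; case: (tent_u TB).
have joinv : tv 1 = tv' (1 - 0) by rewrite subr0; case: cv => _ _ _ ->; case: (tent_v TB).
have tru : trace (arc eu) = trace tu `|` trace tu'.
  by rewrite /arc eqxx trace_cat // trace_rev.
have trv : trace (arc ev) = trace tv `|` trace tv'.
  by rewrite /arc (negPf evu) eqxx trace_cat // trace_rev.
have arcAE e : e \in E' -> arc e = arcA e.
  by move=> eE; have [/negPf n1 /negPf n2] := neE e eE; rewrite /arc n1 n2 eE.
have arcBE e : e \in F' -> arc e = arcB e.
  by move=> eF; have [/negPf n1 /negPf n2 /negPf n3] := neF e eF; rewrite /arc n1 n2 n3.
have split_piece e p : e \in edge_swap E F u v u' v' -> trace (arc e) p ->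
    piece E' arcA eu ev tu tv e p \/ piece F' arcB eu ev tu' tv' e p.
  rewrite finset.in_setU finset.in_set2 => /orP[/orP[]/eqP ->|].
  - by rewrite tru => -[]; [left|right]; constructor 1.
  - by rewrite trv => -[]; [left|right]; constructor 2.
  rewrite finset.in_setU => /orP[eE|eF].
    by rewrite arcAE //; left; constructor 3.
  by rewrite arcBE //; right; constructor 3.
have n01 : (0, 0) <> (1, 0) :> R * R by case=> /eqP; rewrite eq_sym oner_eq0.
have posA0 w : w \in A -> 0 < (posA w).2 by exact: (tent_pos TA).
have posB0 w : w \in B -> (posB w).2 < 0 by exact: (tent_pos TB).
have mixed e e' p : piece E' arcA eu ev tu tv e p -> piece F' arcB eu ev tu' tv' e' p -> e = e'.
  move=> /(piece_region TA) [P1|[p1 ->]|[p1 ->]] /(piece_region TB) [P2|[p2 ->]|[p2 ->]] //.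
  - by have := lt_trans P1 P2; rewrite ltxx.
  - by move: P1; rewrite p2 ltxx.
  - by move: P1; rewrite p2 ltxx.
  - by move: P2; rewrite p1 ltxx.
  - by case: n01; rewrite -p1 -p2.
  - by move: P2; rewrite p1 ltxx.
  - by case: n01; rewrite -p1 -p2.
have pieceA_ge0 e p : piece E' arcA eu ev tu tv e p -> 0 <= p.2.
  by move=> /(piece_region TA) [/ltW//|[-> _]|[-> _]] /=; rewrite lexx.
have pieceB_le0 e p : piece F' arcB eu ev tu' tv' e p -> p.2 <= 0.
  by move=> /(piece_region TB) [/ltW//|[-> _]|[-> _]] /=; rewrite lexx.
have [ueu u'eu vev v'ev] : [/\ u \in eu, u' \in eu, v \in ev & v' \in ev].
  by rewrite !inE !eqxx !orbT.
exists pos, arc; split.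
- move=> a b; rewrite !finset.in_setU => /orP[aA|aB] /orP[bA|bB].
  + rewrite !posAE //; by case: (tent_drawing TA) => + _ _ _; apply.
  + rewrite posAE // posBE // => E0; have := posA0 a aA; rewrite E0.
    by move=> /lt_trans/(_ (posB0 b bB)); rewrite ltxx.
  + rewrite posBE // posAE // => E0; have := posB0 a aB; rewrite E0.
    by move=> /lt_trans/(_ (posA0 b bA)); rewrite ltxx.
  + rewrite !posBE //; by case: (tent_drawing TB) => + _ _ _; apply.
- move=> e; rewrite finset.in_setU finset.in_set2 => /orP[/orP[]/eqP ->|].
  + exists u, u'; split=> //; rewrite posAE // posBE // /arc eqxx.
    apply: curve_cat_curve cu cu' _ => z; rewrite trace_rev => /(tent_Pu TA) [->//|z0].
    by move=> /(tent_Pu TB) [->//|/(lt_trans z0)]; rewrite ltxx.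
  + exists v, v'; split=> //; rewrite posAE // posBE // /arc (negPf evu) eqxx.
    apply: curve_cat_curve cv cv' _ => z; rewrite trace_rev => /(tent_Pv TA) [->//|z0].
    by move=> /(tent_Pv TB) [->//|/(lt_trans z0)]; rewrite ltxx.
  rewrite finset.in_setU => /orP[eE|eF].
    rewrite arcAE //; have [_ /(_ e eE)[a [b [eab c]]] _ _] := tent_drawing TA.
    exists a, b; split=> //; rewrite !posAE //.
      by have [_ _ ] := inside_adj iE' (etrans (congr1 (mem E') (esym eab)) eE).
    by have [_ ] := inside_adj iE' (etrans (congr1 (mem E') (esym eab)) eE).
  rewrite arcBE //; have [_ /(_ e eF)[a [b [eab c]]] _ _] := tent_drawing TB.
  exists a, b; split=> //; rewrite !posBE //.
    by have [_ _ ] := inside_adj iF' (etrans (congr1 (mem F') (esym eab)) eF).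
  by have [_ ] := inside_adj iF' (etrans (congr1 (mem F') (esym eab)) eF).
- move=> e w eEF; rewrite finset.in_setU => /orP[wA|wB].
    rewrite posAE // => /(split_piece _ _ eEF)[/(piece_pos ueu vev wA TA)//|/pieceB_le0].
    by rewrite leNgt posA0.
  rewrite posBE // => /(split_piece _ _ eEF)[/pieceA_ge0|/(piece_pos u'eu v'ev wB TB)//].
  by rewrite leNgt posB0.
- move=> e e' eEF eEF' ee' p /(split_piece _ _ eEF) + /(split_piece _ _ eEF').
  have {}ee' := elimN eqP ee'.
  case=> p1 [] p2.
  + have [w [wA we we' ->]] := piece_meet iE' uA vA ueu vev ee' TA p1 p2.
    by exists w; rewrite posAE.
  + by case: ee'; apply: mixed p1 p2.
  + by case: ee'; symmetry; apply: mixed p2 p1.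
  + have [w [wB we we' ->]] := piece_meet iF' u'B v'B u'eu v'ev ee' TB p1 p2.
    by exists w; rewrite posBE.
Qed.

End Glue.

(** * Merging connected graphs *)

Section GraphClasses.
Import mathcomp.boot.fintype mathcomp.boot.finset.
Local Open Scope set_scope.
Local Open Scope nat_scope.

Section Predicates.
Variable V : finType.
Implicit Types (A : {set V}) (E F : {set {set V}}).

Definition degrees_in d D A E : bool := [forall w in A, d <= degree E w <= D].

Definition connected_on A E : bool :=
  [forall x in A, forall y in A, connect (adj E) x y].

Definition low_degree A E : bool := [exists w in A, degree E w <= 5].

Definition removable k A E : bool :=
  [exists S : {set {set V}}, [&& S \subset E, #|S| == k & connected_on A (E :\: S)]].

Lemma connected_onP A E :
  reflect {in A &, forall x y, connect (adj E) x y} (connected_on A E).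
Proof.
apply: (iffP forall_inP) => [H x y xA yA|H x xA].
  by move/forall_inP: (H x xA); apply.
by apply/forall_inP => y yA; apply: H.
Qed.

Lemma adj_subset E F : E \subset F -> subrel (adj E) (adj F).
Proof. by move=> /subsetP EF x y /andP[xy /EF xyF]; rewrite /adj /= xy. Qed.

Lemma connect_subset E F x y : E \subset F -> connect (adj E) x y -> connect (adj F) x y.
Proof.
by move=> EF; apply: connect_sub => u w /(adj_subset EF); apply: connect1.
Qed.

Lemma connected_on_subset A E F :
  E \subset F -> connected_on A E -> connected_on A F.
Proof.
move=> EF /connected_onP H; apply/connected_onP => x y xA yA.
by apply: connect_subset EF _; apply: H.
Qed.

Lemma connect_sym_adj E x y : connect (adj E) x y = connect (adj E) y x.
Proof. by rewrite (sym_connect_sym (@adj_sym _ E)). Qed.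

Lemma removable0 A E : removable 0 A E = connected_on A E.
Proof.
apply/existsP/idP => [[S /and3P[_]]|cE].
  by rewrite cards_eq0 => /eqP ->; rewrite setD0.
by exists set0; rewrite sub0set cards0 setD0.
Qed.

Lemma removableW k A E : removable k.+1 A E -> removable k A E.
Proof.
case/existsP => S /and3P[SE /eqP Sk cS].
have /set0Pn[e eS] : S != set0 by rewrite -card_gt0 Sk.
apply/existsP; exists (S :\ e); apply/and3P; split.
- by apply: subset_trans SE; apply: subD1set.
- by move: Sk; rewrite (cardsD1 e) eS add1n => -[->].
- by apply: connected_on_subset cS; apply: setDS; apply: subD1set.
Qed.

Lemma removable_connected k A E : removable k A E -> connected_on A E.
Proof. by elim: k => [|k IH]; [rewrite removable0|move/removableW]. Qed.
End Predicates.

Section Relabelling.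
Variables (T V : finType) (f : T -> V).
Hypothesis f_inj : injective f.
Implicit Types (E : {set {set T}}).

Lemma degree_relabel E x : degree (relabel f E) (f x) = degree E x.
Proof.
rewrite /degree -(card_imset _ (imset_inj f_inj)); apply: eq_card => e.
rewrite inE; apply/andP/imsetP => [[/imsetP[d dE ->]]|[d]].
  by rewrite mem_imset // => xd; exists d; rewrite // inE dE.
by rewrite inE => /andP[dE xd] ->; rewrite mem_relabel // mem_imset.
Qed.

Lemma forall_relabel (p : pred V) : [forall w in f @: [set: T], p w] = [forall x, p (f x)].
Proof.
apply/forall_inP/forallP => [H x|H w /imsetP[x _ ->]//].
by apply: H; rewrite imset_f.
Qed.

Lemma forall_setT (p : pred T) : [forall w in [set: T], p w] = [forall x, p x].
Proof. by apply/forall_inP/forallP => H x => [|_]; apply: H. Qed.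

Lemma degrees_in_relabel d D E :
  degrees_in d D (f @: [set: T]) (relabel f E) = degrees_in d D [set: T] E.
Proof.
rewrite /degrees_in forall_relabel forall_setT.
by apply: eq_forallb => x; rewrite degree_relabel.
Qed.

Lemma low_degree_relabel E :
  low_degree (f @: [set: T]) (relabel f E) = low_degree [set: T] E.
Proof.
apply/exists_inP/exists_inP => [[_ /imsetP[x _ ->]]|[x _]].
  by rewrite degree_relabel; exists x.
by rewrite -degree_relabel; exists (f x); rewrite ?imset_f.
Qed.

Lemma connect_relabel E x y : inside setT E ->
  connect (adj (relabel f E)) (f x) (f y) = connect (adj E) x y.
Proof.
move=> iE; apply/idP/idP.
  case/connectP => p; elim: p x => [|z p IH] x /=; first by move=> _ /f_inj ->.
  case/andP => /(adj_relabel_inv iE)[a [b [/f_inj -> -> ab]]] pz zy.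
  exact: connect_trans (connect1 ab) (IH _ pz zy).
case/connectP => p; elim: p x => [|z p IH] x /=; first by move=> _ ->.
case/andP => xz pz zy; apply: connect_trans (IH _ pz zy).
by apply: connect1; rewrite adj_relabel.
Qed.

Lemma connected_on_relabel E : inside setT E ->
  connected_on (f @: [set: T]) (relabel f E) = connected_on [set: T] E.
Proof.
move=> iE; rewrite /connected_on forall_relabel forall_setT.
apply: eq_forallb => x; rewrite forall_relabel forall_setT.
by apply: eq_forallb => y; rewrite connect_relabel.
Qed.

Lemma removable_relabel k E : inside setT E ->
  removable k (f @: [set: T]) (relabel f E) = removable k [set: T] E.
Proof.
move=> iE; have rD S : relabel f (E :\: S) = relabel f E :\: relabel f S.
  apply/setP => e; rewrite inE; apply/idP/andP => [/imsetP[b]|[eS /imsetP[b bE eb]]].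
    by rewrite inE => /andP[bS bE] ->; rewrite !mem_relabel.
  by move: eS; rewrite eb !mem_relabel // inE bE => ->.
have iD S : inside setT (E :\: S) := inside_subset (subsetDl _ _) iE.
apply/existsP/existsP => -[S /and3P[SE Sk cS]]; last first.
  exists (relabel f S); apply/and3P; split; first exact: imsetS.
    by rewrite card_imset //; apply: imset_inj.
  by rewrite -rD connected_on_relabel.
have [|S' _ SS'] := relabel_surj f_inj (F := S).
  by apply: inside_subset SE _; rewrite -inside_relabel.
rewrite SS' in SE Sk cS; exists S'; apply/and3P; split.
- apply/subsetP => e eS; rewrite -(mem_relabel f_inj).
  by apply: (subsetP SE); rewrite mem_relabel.
- by rewrite card_imset in Sk => //; apply: imset_inj.
- by rewrite -rD connected_on_relabel in cS.
Qed.
End Relabelling.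

Definition graph_class := forall V : finType, {set V} -> {set {set V}} -> bool.

Definition invariant_class (P : graph_class) : Prop :=
  forall (T V : finType) (f : T -> V) (E : {set {set T}}), injective f ->
    inside setT E -> P V (f @: [set: T]) (relabel f E) = P T setT E.

Definition num_class (P : graph_class) (V : finType) (A : {set V}) : nat :=
  #|[set E : {set {set V}} | inside A E && P V A E]|.

Lemma num_class_card (P : graph_class) (V : finType) (A : {set V}) n :
  invariant_class P -> #|A| = n -> num_class P A = num_class P [set: 'I_n].
Proof.
move=> inv <-; have fA : (enum_val : 'I_#|A| -> V) @: [set: 'I_#|A|] = A.
  apply/setP => x; apply/imsetP/idP => [[i _ ->]|xA]; first exact: enum_valP.
  by exists (enum_rank_in xA x); rewrite ?inE // enum_rankK_in.
rewrite /num_class -(@card_relabel _ _ (enum_val : 'I_#|A| -> V) _ (P _ setT) (P V A)).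
- by rewrite fA.
- exact: enum_val_inj.
- by move=> E iE; rewrite -{1}(inv _ _ _ _ (@enum_val_inj _ A) iE) fA.
Qed.

Section Classes.
Variables (R : realType) (d D : nat).

Definition planar_class : graph_class := fun V A E =>
  degrees_in d D A E && `[< planar_on R A E >].

Definition connected_class : graph_class := fun V A E =>
  planar_class A E && connected_on A E.

Definition rich_class k : graph_class := fun V A E =>
  [&& planar_class A E, low_degree A E & removable k A E].

Lemma planar_class_invariant : invariant_class planar_class.
Proof.
move=> T V f E f_inj iE; rewrite /planar_class degrees_in_relabel //.
by congr (_ && _); apply: asbool_equiv_eq; apply: planar_on_relabel.
Qed.

Lemma connected_class_invariant : invariant_class connected_class.
Proof.
move=> T V f E f_inj iE.
by rewrite /connected_class planar_class_invariant // connected_on_relabel.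
Qed.

Lemma rich_class_invariant k : invariant_class (rich_class k).
Proof.
move=> T V f E f_inj iE; rewrite /rich_class planar_class_invariant //.
by rewrite low_degree_relabel // removable_relabel.
Qed.

End Classes.
End GraphClasses.

Section EdgeSwap.
Import mathcomp.boot.fintype mathcomp.boot.finset.
Local Open Scope set_scope.
Local Open Scope nat_scope.
Variable V : finType.
Implicit Types (A B : {set V}) (E F S : {set {set V}}) (u v w x : V).

Lemma edge_swap_sym E F u v u' v' : edge_swap E F u v u' v' = edge_swap F E u' v' u v.
Proof.
rewrite /edge_swap [_ :\ _ :|: _ :\ _]setUC.
by rewrite [[set u; u']]setUC [[set v; v']]setUC.
Qed.

Lemma edge_swap_flip E F u v u' v' : edge_swap E F u v u' v' = edge_swap E F v u v' u'.
Proof.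
by rewrite /edge_swap [[set [set u; u']; _]]setUC [[set u; v]]setUC [[set u'; v']]setUC.
Qed.

Section Swap.
Variables (A B : {set V}) (E F : {set {set V}}) (u v u' v' : V).
Hypotheses (dAB : [disjoint A & B]%B) (iE : inside A E) (iF : inside B F).
Hypotheses (uvE : [set u; v] \in E) (uvF : [set u'; v'] \in F).

Let nAB w : w \in A -> w \in B -> False.
Proof. by move=> wA; rewrite (disjointFr dAB wA). Qed.

Lemma inside_notin e w : w \in A -> e \in F -> w \notin e.
Proof.
move=> wA eF; have /andP[_ /subsetP eB] := forall_inP iF e eF.
by apply/negP => /eB; apply: nAB.
Qed.

Lemma inside_edge_swap : inside (A :|: B) (edge_swap E F u v u' v').
Proof.
have [uv uA vA] := inside_adj iE uvE; have [uv' u'B v'B] := inside_adj iF uvF.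
have ne a b : a \in A -> b \in B -> a != b.
  by move=> aA bB; apply/eqP => ab; apply: (nAB aA); rewrite ab.
apply/insideP => e; rewrite in_setU in_set2 => /orP[/orP[]/eqP ->|].
- by exists u, u'; rewrite !inE uA u'B orbT ne.
- by exists v, v'; rewrite !inE vA v'B orbT ne.
rewrite in_setU !in_setD1 => /orP[/andP[_ eE]|/andP[_ eF]].
  have [x [y [xy xA yA ->]]] := insideP _ _ iE e eE.
  by exists x, y; rewrite !inE xA yA.
have [x [y [xy xB yB ->]]] := insideP _ _ iF e eF.
by exists x, y; rewrite !inE xB yB !orbT.
Qed.

Lemma degree_edge_swap_neq w : w \in A -> w != v ->
  degree (edge_swap E F u v u' v') w = degree E w.
Proof.
have [uv uA vA] := inside_adj iE uvE; have [uv' u'B v'B] := inside_adj iF uvF.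
move=> wA wv; have wv' : w != v' by apply/eqP => E0; apply: (nAB wA); rewrite E0.
have wu' : w != u' by apply/eqP => E0; apply: (nAB wA); rewrite E0.
have [wu|wu] := eqVneq w u; rewrite /degree.
  have nE : [set u; u'] \notin E.
    apply/negP => /(inside_adj iE)[_ _ u'A]; exact: nAB u'A u'B.
  rewrite [RHS](cardsD1 [set u; v]) !inE uvE wu eqxx /=.
  rewrite [LHS](cardsD1 [set u; u']) !inE eqxx /=; congr (_ + _).
    by rewrite eqxx.
  apply: eq_card => e; rewrite !inE.
  have [->|ne1] := eqVneq e [set u; u'].
    by rewrite (negPf nE) /= andbF.
  rewrite /=; have [->|ne2] /= := eqVneq e [set v; v'].
    rewrite !inE (negPf uv) -wu (negPf wv') /= !andbF //.
  case: (boolP (e \in F)) => [eF|]; last by rewrite andbF orbF andbA.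
  by rewrite -wu (negPf (inside_notin wA eF)) !andbF.
apply: eq_card => e; rewrite !inE.
have [->|ne1] := eqVneq e [set u; u'].
  by rewrite !inE (negPf wu) (negPf wu') !andbF.
have [->|ne2] := eqVneq e [set v; v'].
  by rewrite !inE (negPf wv) (negPf wv') !andbF.
case: (boolP (e \in F)) => [eF|_]; first by rewrite (negPf (inside_notin wA eF)) !andbF.
rewrite andbF /=; have [->|_] := eqVneq e [set u; v]; last by rewrite orbF.
by rewrite !inE (negPf wu) (negPf wv) !andbF.
Qed.

End Swap.

Lemma degree_edge_swap A B E F u v u' v' w :
  [disjoint A & B]%B -> inside A E -> inside B F ->
  [set u; v] \in E -> [set u'; v'] \in F -> w \in A ->
  degree (edge_swap E F u v u' v') w = degree E w.
Proof.
move=> dAB iE iF uvE uvF wA; have [->|wv] := eqVneq w v; last exact: (degree_edge_swap_neq dAB).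
have [uv uA vA] := inside_adj iE uvE.
rewrite edge_swap_flip; apply: (degree_edge_swap_neq dAB iE iF) => //.
- by rewrite setUC.
- by rewrite setUC.
- by rewrite eq_sym.
Qed.

(* Walking from [w] towards [u], the first use of the edge [uv] is preceded by
   a visit of [u] or [v]. *)
Lemma connect_edge_removed E S w u v :
  connect (adj (E :\: S)) w u ->
  connect (adj (E :\: ([set u; v] |: S))) w u || connect (adj (E :\: ([set u; v] |: S))) w v.
Proof.
case/connectP => p; elim: p w => [|x p IH] w /=; first by move=> _ ->; rewrite connect0.
case/andP => wx px lx; have [wxu|wxu] := eqVneq [set w; x] [set u; v].
  have : w \in [set u; v] by rewrite -wxu !inE eqxx.
  by rewrite !inE => /orP[] /eqP ->; rewrite connect0 ?orbT.
have {}wx : adj (E :\: ([set u; v] |: S)) w x.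
  by move: wx; rewrite /adj /= !inE negb_or wxu.
by case/orP: (IH x px lx) => H; apply/orP; [left|right];
  apply: connect_trans (connect1 wx) H.
Qed.

Lemma connected_edge_swap A B E F G S S' u v u' v' :
  [disjoint A & B]%B -> inside A E -> inside B F ->
  [set u; v] \in E -> [set u'; v'] \in F ->
  connected_on A (E :\: S) -> connected_on B (F :\: ([set u'; v'] |: S')) ->
  G = edge_swap E F u v u' v' -> S \subset E -> S' \subset F ->
  connected_on (A :|: B) (G :\: (S :|: S')).
Proof.
move=> dAB iE iF uvE uvF /connected_onP cE /connected_onP cF -> SE SF.
have nAB w : w \in A -> w \in B -> False by move=> wA; rewrite (disjointFr dAB wA).
have [uv uA vA] := inside_adj iE uvE; have [uv' u'B v'B] := inside_adj iF uvF.
set H := (_ :\: _).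
have cross a b : a \in A -> b \in B -> [set a; b] \in edge_swap E F u v u' v' -> adj H a b.
  move=> aA bB abG; rewrite /adj /= in_setD abG andbT.
  apply/andP; split; first by apply/eqP => ab; apply: (nAB a) => //; rewrite ab.
  rewrite in_setU negb_or; apply/andP; split; apply/negP.
    by move=> /(subsetP SE)/(inside_adj iE)[_ _ bA]; exact: nAB bA bB.
  by move=> /(subsetP SF)/(inside_adj iF)[_ aB _]; exact: nAB aA aB.
have uu'H : adj H u u' by apply: cross; rewrite // !inE eqxx.
have vv'H : adj H v v' by apply: cross; rewrite // !inE eqxx orbT.
have nEF e : e \in E -> e \in F -> False.
  move=> /(insideP _ _ iE)[a [b [_ aA _ ->]]] /(inside_adj iF)[_ aB _].
  exact: nAB aA aB.
have subE : E :\: ([set u; v] |: S) \subset H.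
  apply/subsetP => e; rewrite !inE !negb_or => /andP[/andP[e1 e2] e3].
  rewrite e1 e2 e3 !orbT andbT /=; apply/negP => /(subsetP SF); exact: nEF.
have subF : F :\: ([set u'; v'] |: S') \subset H.
  apply/subsetP => e; rewrite !inE !negb_or => /andP[/andP[e1 e2] e3].
  rewrite e1 e2 e3 !orbT !andbT /=; apply/negP => /(subsetP SE) eE; exact: nEF eE e3.
have toB w : w \in B -> connect (adj H) w u'.
  by move=> wB; apply: connect_subset subF _; apply: cF.
have tou' w : w \in A :|: B -> connect (adj H) w u'.
  rewrite inE => /orP[wA|/toB//].
  case/orP: (connect_edge_removed v (cE w u wA uA)) => /(connect_subset subE) wuv.
    exact: connect_trans wuv (connect1 uu'H).
  exact: connect_trans wuv (connect_trans (connect1 vv'H) (toB _ v'B)).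
apply/connected_onP => x y /tou' xu /tou' yu.
by apply: connect_trans xu _; rewrite connect_sym_adj.
Qed.

End EdgeSwap.

Section MergeCounting.
Import mathcomp.boot.fintype mathcomp.boot.finset.
Local Open Scope set_scope.
Local Open Scope nat_scope.

Definition restrict_edges (V : finType) (A : {set V}) (E : {set {set V}}) : {set {set V}} :=
  [set e in E | e \subset A].

Lemma restrict_edgesU (V : finType) (A B : {set V}) (E F : {set {set V}}) :
  [disjoint A & B]%B -> inside A E -> inside B F -> restrict_edges A (E :|: F) = E.
Proof.
move=> dAB iE iF; apply/setP => e; rewrite !inE; apply/idP/idP => [|eE].
  case/andP => /orP[//|/(insideP _ _ iF)[x [y [_ xB _ ->]]]].
  by rewrite subUset sub1set => /andP[xA _]; rewrite (disjointFr dAB xA) in xB.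
by rewrite eE; have /andP[_ ->] := forall_inP iE e eE.
Qed.

Lemma connect_inside (V : finType) (A B : {set V}) (E F : {set {set V}}) x y :
  [disjoint A & B]%B -> inside A E -> inside B F -> x \in A ->
  connect (adj (E :|: F)) x y -> y \in A.
Proof.
move=> dAB iE iF + /connectP[p]; elim: p x => [|z p IH] x xA /=; first by move=> _ ->.
case/andP => /andP[xz]; rewrite inE => /orP[/(inside_adj iE)[_ _ zA]|]; first exact: IH.
by move=> /(inside_adj iF)[_ xB _]; rewrite (disjointFr dAB xA) in xB.
Qed.

Lemma disjointAC (V : finType) (A : {set V}) : [disjoint A & ~: A]%B.
Proof. by rewrite -setI_eq0 setICr. Qed.

Lemma component_eq (V : finType) (A : {set V}) (E F : {set {set V}}) u :
  inside A E -> inside (~: A) F -> connected_on A E -> u \in A ->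
  A = [set w | connect (adj (E :|: F)) u w].
Proof.
move=> iE iF /connected_onP cE uA; apply/setP => w; rewrite inE.
apply/idP/idP => [wA|]; last exact: (connect_inside (disjointAC A) iE iF uA).
by apply: connect_subset (subsetUl _ _) _; apply: cE.
Qed.

Lemma edge_swapK (V : finType) (A B : {set V}) (E F : {set {set V}}) u v u' v' :
  [disjoint A & B]%B -> inside A E -> inside B F ->
  [set u; v] \in E -> [set u'; v'] \in F ->
  E :|: F = [set [set u; v]; [set u'; v']] :|:
    (edge_swap E F u v u' v' :\: [set [set u; u']; [set v; v']]).
Proof.
move=> dAB iE iF uvE uvF.
have [uv uA vA] := inside_adj iE uvE; have [uv' u'B v'B] := inside_adj iF uvF.
have nEF a b : a \in A -> b \in B -> [set a; b] \notin E :|: F.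
  move=> aA bB; rewrite inE negb_or; apply/andP; split; apply/negP.
    by move=> /(inside_adj iE)[_ _]; rewrite (disjointFl dAB bB).
  by move=> /(inside_adj iF)[_]; rewrite (disjointFr dAB aA).
have n1 := nEF u u' uA u'B; have n2 := nEF v v' vA v'B.
apply/setP => e; rewrite /edge_swap !inE.
have [->|_] /= := eqVneq e [set u; v]; first by rewrite uvE.
have [->|_] /= := eqVneq e [set u'; v']; first by rewrite uvF orbT.
have [->|_] /= := eqVneq e [set u; u']; first by rewrite -in_setU (negPf n1).
by have [->|_] //= := eqVneq e [set v; v']; rewrite -in_setU (negPf n2).
Qed.

Lemma card_setC_ord n (A : {set 'I_n}) m : #|A| = m -> #|~: A| = n - m.
Proof. by move=> <-; have := cardsC A; rewrite card_ord; lia. Qed.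

Lemma num_merge (P Q S : graph_class) n m :
  invariant_class P -> invariant_class Q -> m <= n ->
  (forall (V : finType) (A : {set V}) (E F : {set {set V}}),
     #|A| = m -> #|V| = n ->
     inside A E -> inside (~: A) F -> P V A E -> Q V (~: A) F ->
     connected_on A E /\
     exists u v u' v', [/\ [set u; v] \in E, [set u'; v'] \in F &
       S V [set: V] (edge_swap E F u v u' v')]) ->
  'C(n, m) * num_class P [set: 'I_m] * num_class Q [set: 'I_(n - m)] <=
    n ^ 4 * num_class S [set: 'I_n].
Proof.
move=> invP invQ mn swap; pose V := 'I_n.
pose X := [set t : {set V} * ({set {set V}} * {set {set V}}) |
  [&& #|t.1| == m, inside t.1 t.2.1 && P V t.1 t.2.1 & inside (~: t.1) t.2.2 && Q V (~: t.1) t.2.2]].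
have cardX : #|X| = 'C(n, m) * num_class P [set: 'I_m] * num_class Q [set: 'I_(n - m)].
  rewrite -sum1_card (eq_bigl (fun t : {set V} * ({set {set V}} * {set {set V}}) =>
    (#|t.1| == m) && ((inside t.1 t.2.1 && P V t.1 t.2.1) && (inside (~: t.1) t.2.2 && Q V (~: t.1) t.2.2)))); last first.
    by move=> t; rewrite inE.
  rewrite -(pair_big_dep (fun A : {set V} => #|A| == m)
    (fun A (t : {set {set V}} * {set {set V}}) => (inside A t.1 && P V A t.1) && (inside (~: A) t.2 && Q V (~: A) t.2)) (fun _ _ => 1)) /=.
  rewrite (eq_bigr (fun=> num_class P [set: 'I_m] * num_class Q [set: 'I_(n - m)])).
    rewrite sum_nat_cond_const mulnA; congr (_ * _ * _).
    have := card_draws V m; rewrite card_ord => <-.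
    by apply: eq_card => A; rewrite !inE.
  move=> A /eqP Am.
  have Cm : #|~: A| = n - m := card_setC_ord Am.
  rewrite -(num_class_card invP Am) -(num_class_card invQ Cm).
  rewrite -cardsX -sum1_card; apply: eq_bigl => t; by rewrite !inE.
pose good (t : {set V} * ({set {set V}} * {set {set V}})) (w : V * V * (V * V)) :=
  [&& [set w.1.1; w.1.2] \in t.2.1, [set w.2.1; w.2.2] \in t.2.2 &
    S V setT (edge_swap t.2.1 t.2.2 w.1.1 w.1.2 w.2.1 w.2.2)].
rewrite -cardX; have [->|[t0 t0X]] := set_0Vmem X; first by rewrite cards0.
have w0 : V.
  case: t0 t0X => A [E F]; rewrite inE /= => /and3P[/eqP Am /andP[iE PE] /andP[iF QF]].
  apply: xchoose; have [_ [u _]] := swap V A E F Am (card_ord n) iE iF PE QF.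
  by exists u.
pose pickw t : V * V * (V * V) := odflt (w0, w0, (w0, w0)) [pick w | good t w].
have pickP t : t \in X -> good t (pickw t) /\ connected_on t.1 t.2.1.
  case: t => A [E F]; rewrite inE /= => /and3P[/eqP Am /andP[iE PE] /andP[iF QF]].
  have [cE [u [v [u' [v' [uvE uvF SG]]]]]] := swap V A E F Am (card_ord n) iE iF PE QF.
  split=> //; rewrite /pickw; case: pickP => // /(_ (u, v, (u', v'))).
  by rewrite /good /= uvE uvF SG.
pose code t := (pickw t, let w := pickw t in edge_swap t.2.1 t.2.2 w.1.1 w.1.2 w.2.1 w.2.2).
rewrite -(card_in_imset (f := code)); last first.
  move=> [A [E F]] [A' [E' F']] tX tX'.
  have [g cE] := pickP _ tX; have [g' cE'] := pickP _ tX'.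
  rewrite /code => -[Ew]; rewrite -Ew in g' *.
  move: g g' cE cE' tX tX'; rewrite /good !inE /=.
  move: (pickw _) => [[u v] [u' v']] /=.
  move=> /and3P[uvE uvF _] /and3P[uvE' uvF' _] cE cE' /and3P[_ /andP[iE _] /andP[iF _]] /and3P[_ /andP[iE' _] /andP[iF' _]] Esw.
  have EF : E :|: F = E' :|: F'.
    rewrite (edge_swapK (disjointAC A) iE iF uvE uvF).
    by rewrite (edge_swapK (disjointAC A') iE' iF' uvE' uvF') Esw.
  have AA : A = A'.
    have [_ uA _] := inside_adj iE uvE; have [_ uA' _] := inside_adj iE' uvE'.
    by rewrite (component_eq iE iF cE uA) (component_eq iE' iF' cE' uA') EF.
  rewrite -{}AA in iE' iF' *.
  congr (_, (_, _)).
    by rewrite -(restrict_edgesU (disjointAC A) iE iF) EF (restrict_edgesU (disjointAC A) iE' iF').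
  have dCA : [disjoint ~: A & A]%B by rewrite disjoint_sym disjointAC.
  rewrite -(restrict_edgesU dCA iF iE) setUC EF setUC.
  by rewrite (restrict_edgesU dCA iF' iE').
apply: (@leq_trans #|setX [set: V * V * (V * V)] [set E : {set {set V}} | inside setT E && S V setT E]|).
  apply: subset_leq_card; apply/subsetP => _ /imsetP[t tX ->]; rewrite inE /= inE /= inE.
  have [/and3P[uvE uvF ->] _] := pickP t tX; rewrite andbT.
  move: tX; rewrite inE => /and3P[_ /andP[iE _] /andP[iF _]].
  by have := inside_edge_swap (disjointAC t.1) iE iF uvE uvF; rewrite setUCr.
rewrite cardsX cardsT !card_prod !card_ord leq_mul // /expn /= ?muln1 ?mulnA //.
Qed.

Lemma num_components (P : graph_class) (Q : graph_class) n :
  invariant_class P -> invariant_class Q ->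
  (forall (V : finType) (E : {set {set V}}) (x : V), inside setT E -> P V setT E ->
    let A := [set w | connect (adj E) x w] in
    Q V A (restrict_edges A E) /\ P V (~: A) (restrict_edges (~: A) E)) ->
  n * num_class P [set: 'I_n] <=
    \sum_(m < n.+1) 'C(n, m) * m * num_class Q [set: 'I_m] * num_class P [set: 'I_(n - m)].
Proof.
move=> invP invQ split_comp; pose V := 'I_n.
pose X := [set t : {set V} * (V * ({set {set V}} * {set {set V}})) |
  [&& t.2.1 \in t.1, inside t.1 t.2.2.1 && Q V t.1 t.2.2.1 & inside (~: t.1) t.2.2.2 && P V (~: t.1) t.2.2.2]].
have cardX : #|X| = \sum_(m < n.+1) 'C(n, m) * m * num_class Q [set: 'I_m] * num_class P [set: 'I_(n - m)].
  rewrite -sum1_card (eq_bigl (fun t : {set V} * (V * ({set {set V}} * {set {set V}})) =>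
     xpredT t.1 && ((t.2.1 \in t.1) && ((inside t.1 t.2.2.1 && Q V t.1 t.2.2.1) && (inside (~: t.1) t.2.2.2 && P V (~: t.1) t.2.2.2))))); last first.
    by move=> t; rewrite inE.
  rewrite -(pair_big_dep xpredT
    (fun (A : {set V}) (t : V * ({set {set V}} * {set {set V}})) => (t.1 \in A) && ((inside A t.2.1 && Q V A t.2.1) && (inside (~: A) t.2.2 && P V (~: A) t.2.2))) (fun _ _ => 1)) /=.
  rewrite (partition_big (fun A : {set V} => inord #|A| : 'I_n.+1) xpredT) //=.
  apply: eq_bigr => m _.
  have cm (A : {set V}) : (inord #|A| == m) = (#|A| == m :> nat).
    rewrite -(inj_eq val_inj) /= inordK // ltnS.
    by apply: leq_trans (max_card _) _; rewrite card_ord.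
  under eq_bigl do rewrite cm.
  rewrite (eq_bigr (fun=> m * (num_class Q [set: 'I_m] * num_class P [set: 'I_(n - m)]))).
    rewrite sum_nat_cond_const -!mulnA; congr (_ * _).
    have := card_draws V m; rewrite card_ord => <-.
    by apply: eq_card => A; rewrite !inE.
  move=> A /eqP Am.
  have Cm : #|~: A| = n - m := card_setC_ord Am.
  rewrite -(num_class_card invQ Am) -(num_class_card invP Cm) -Am.
  rewrite -!cardsX -sum1_card; apply: eq_bigl => t; by rewrite !inE.
rewrite -cardX.
pose Y := setX [set: V] [set E : {set {set V}} | inside setT E && P V setT E].
have -> : n * num_class P [set: 'I_n] = #|Y| by rewrite cardsX cardsT card_ord.
pose comp (t : V * {set {set V}}) := [set w | connect (adj t.2) t.1 w].
pose code (t : V * {set {set V}}) :=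
  (comp t, (t.1, (restrict_edges (comp t) t.2, restrict_edges (~: comp t) t.2))).
have restrU (t : V * {set {set V}}) : inside setT t.2 ->
    t.2 = restrict_edges (comp t) t.2 :|: restrict_edges (~: comp t) t.2.
  move=> iE; apply/setP => e; rewrite !inE -andb_orr.
  case: (boolP (e \in t.2)) => //= eE; symmetry.
  have [x [y [xy _ _ exy]]] := insideP _ _ iE e eE.
  have axy : adj t.2 x y by rewrite /adj /= xy -exy.
  rewrite exy !subUset !sub1set !inE.
  have -> : connect (adj t.2) t.1 y = connect (adj t.2) t.1 x.
    apply/idP/idP => H; apply: connect_trans H (connect1 _) => //.
    by rewrite adj_sym.
  by case: (connect _ _ _).
rewrite -(card_in_imset (f := code)); last first.
  move=> [x E] [x' E'] /=; rewrite !inE /= => /andP[iE _] /andP[iE' _].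
  rewrite /code /= => -[_ -> E1 E2]; congr (_, _).
  apply: etrans (restrU (x', E) iE) _; rewrite /= E1 E2.
  exact: esym (restrU (x', E') iE').
apply: subset_leq_card; apply/subsetP => _ /imsetP[[x E] + ->].
rewrite !inE /= => /andP[iE PE].
have [QA PA] := split_comp V E x iE PE.
have iR (A : {set V}) : inside A (restrict_edges A E).
  apply/forall_inP => e; rewrite inE => /andP[eE ->].
  by have /andP[-> _] := forall_inP iE e eE.
by rewrite connect0 /comp /= !iR QA PA.
Qed.

End MergeCounting.

Section ClassCounting.
Import mathcomp.boot.fintype mathcomp.boot.finset.
Local Open Scope set_scope.
Local Open Scope nat_scope.
Variables (R : realType) (d D : nat).

Lemma rich_edge_swap (V : finType) (A : {set V}) (E F S S' : {set {set V}}) u v u' v' :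
  inside A E -> inside (~: A) F -> [set u; v] \in E -> [set u'; v'] \in F ->
  planar_class R d D A E -> planar_class R d D (~: A) F -> low_degree (~: A) F ->
  S \subset E :\ [set u; v] -> S' \subset F :\ [set u'; v'] -> #|S| + #|S'| = 2 ->
  connected_on A (E :\: S) -> connected_on (~: A) (F :\: ([set u'; v'] |: S')) ->
  rich_class R d D 2 [set: V] (edge_swap E F u v u' v').
Proof.
move=> iE iF uvE uvF /andP[dE /asboolP pE] /andP[dF /asboolP pF] lF SE SF SS cE cF.
have dA := disjointAC A; have dCA : [disjoint ~: A & A]%B by rewrite disjoint_sym.
have degA w : w \in A -> degree (edge_swap E F u v u' v') w = degree E w.
  exact: degree_edge_swap dA iE iF uvE uvF.
have degB w : w \in ~: A -> degree (edge_swap E F u v u' v') w = degree F w.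
  by rewrite edge_swap_sym; apply: degree_edge_swap dCA iF iE uvF uvE.
apply/and3P; split; first (apply/andP; split).
- apply/forall_inP => w _; case: (boolP (w \in A)) => wA.
    by rewrite degA // (forall_inP dE).
  by rewrite -in_setC in wA; rewrite degB // (forall_inP dF).
- by apply/asboolP; rewrite -(setUCr A); apply: edge_swap_planar.
- have [w wB lw] := exists_inP lF; apply/exists_inP; exists w => //.
  by rewrite degB.
apply/existsP; exists (S :|: S'); apply/and3P; split.
- apply/subsetP => e; rewrite !inE => /orP[/(subsetP SE)|/(subsetP SF)]; rewrite !inE => ->;
    by rewrite !orbT.
- rewrite cardsU (_ : S :&: S' = set0) ?cards0 ?subn0 ?SS //.
  apply/setP => e; rewrite !inE; apply/negP => /andP[/(subsetP SE) eE /(subsetP SF) eF].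
  move: eE eF; rewrite !inE => /andP[_ eE] /andP[_ eF].
  have [x [y [_ xA _ exy]]] := insideP _ _ iE e eE.
  have := inside_notin dA iF xA eF; by rewrite exy !inE eqxx.
rewrite -(setUCr A); apply: connected_edge_swap dA iE iF uvE uvF cE cF _ _ _ => //.
  by apply: subset_trans SE _; apply: subD1set.
by apply: subset_trans SF _; apply: subD1set.
Qed.

Lemma cards2D (T : finType) (S : {set T}) : #|S| = 2 ->
  exists x y, [/\ x != y, S = [set x; y] & S :\ x = [set y]].
Proof.
move=> /eqP/cards2P[x [y [xy ->]]]; exists x, y; split=> //.
apply/setP => z; rewrite !inE; case: (eqVneq z x) => //= ->.
by rewrite (negPf xy).
Qed.

Lemma num_rich_merge n m : m <= n ->
  'C(n, m) * num_class (rich_class R d D 2) [set: 'I_m] *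
    num_class (rich_class R d D 2) [set: 'I_(n - m)] <=
  n ^ 4 * num_class (rich_class R d D 2) [set: 'I_n].
Proof.
move=> mn; apply: num_merge mn _; try exact: rich_class_invariant.
move=> V A E F _ _ iE iF /and3P[pE lE rE] /and3P[pF lF rF].
split; first exact: removable_connected rE.
have [S /and3P[SE /eqP/cards2D[f1 [f2 [f12 Sf Sf1]]] cS]] := existsP rE.
have [S' /and3P[SF /eqP/cards2D[e1 [e2 [e12 Se Se1]]] cS']] := existsP rF.
have f1E : f1 \in E by apply: (subsetP SE); rewrite Sf !inE eqxx.
have f2E : f2 \in E by apply: (subsetP SE); rewrite Sf !inE eqxx orbT.
have e1F : e1 \in F by apply: (subsetP SF); rewrite Se !inE eqxx.
have e2F : e2 \in F by apply: (subsetP SF); rewrite Se !inE eqxx orbT.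
have [u [v [_ _ _ f1E']]] := insideP _ _ iE f1 f1E.
have [u' [v' [_ _ _ e1F']]] := insideP _ _ iF e1 e1F.
exists u, v, u', v'; rewrite -f1E' -e1F'; split=> //.
apply: (@rich_edge_swap V A E F [set f2] [set e2]); rewrite -?f1E' -?e1F' //.
- by rewrite sub1set !inE eq_sym f12.
- by rewrite sub1set !inE eq_sym e12.
- by rewrite !cards1.
- by apply: connected_on_subset cS; rewrite Sf; apply: setDS; apply: subsetUr.
- by rewrite -Se.
Qed.

Lemma num_connected_merge n m : 1 < m -> m <= n ->
  'C(n, m) * num_class (connected_class R d D) [set: 'I_m] *
    num_class (rich_class R d D 3) [set: 'I_(n - m)] <=
  n ^ 4 * num_class (rich_class R d D 2) [set: 'I_n].
Proof.
move=> m1 mn; apply: num_merge mn _.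
- exact: connected_class_invariant.
- exact: rich_class_invariant.
move=> V A E F Am _ iE iF /andP[pE cE] /and3P[pF lF rF].
split; first exact: cE.
have [S' /and3P[SF /eqP S3 cS']] := existsP rF.
have /set0Pn[e1 e1S] : S' != set0 by rewrite -card_gt0 S3.
have e1F : e1 \in F by apply: (subsetP SF).
have [u' [v' [_ _ _ e1F']]] := insideP _ _ iF e1 e1F.
have [u [v uvE]] : exists u v, [set u; v] \in E.
  have /card_gt1P[x [y [xA yA xy]]] : 1 < #|A| by rewrite Am.
  have := connected_onP _ _ cE x y xA yA; case/connectP => -[|z p] /=.
    by move=> _ yx; rewrite yx eqxx in xy.
  by case/andP => /andP[_ xz] _ _; exists x, z.
exists u, v, u', v'; rewrite -e1F'; split=> //.
apply: (@rich_edge_swap V A E F set0 (S' :\ e1)); rewrite -?e1F' //.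
- exact: sub0set.
- exact: setSD.
- by rewrite cards0; move: S3; rewrite (cardsD1 e1) e1S => -[].
- by rewrite setD0.
- by rewrite setD1K.
Qed.

Lemma num_planar_components n :
  n * num_class (planar_class R d D) [set: 'I_n] <=
    \sum_(m < n.+1) 'C(n, m) * m * num_class (connected_class R d D) [set: 'I_m] *
       num_class (planar_class R d D) [set: 'I_(n - m)].
Proof.
apply: num_components; [exact: planar_class_invariant|exact: connected_class_invariant|].
move=> V E x iE /andP[dE /asboolP pE] A.
have deg (B : {set V}) : (forall w z, w \in B -> adj E w z -> z \in B) ->
    degrees_in d D B (restrict_edges B E).
  move=> closed; apply/forall_inP => w wB.
  have -> : degree (restrict_edges B E) w = degree E w.
    apply: eq_card => e; rewrite !inE; case: (boolP (e \in E)) => //= eE.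
    case: (boolP (w \in e)) => we; rewrite ?andbF ?andbT //.
    have [a [b [ab _ _ eab]]] := insideP _ _ iE e eE.
    have adjab : adj E a b by rewrite /adj /= ab -eab.
    rewrite eab subUset !sub1set; move: we; rewrite eab !inE => /orP[] /eqP wE.
      by rewrite -wE wB (closed w b) // wE.
    by rewrite -wE wB (closed w a) // wE adj_sym.
  by apply: (forall_inP dE); rewrite inE.
have pl (B : {set V}) : `[< planar_on R B (restrict_edges B E) >].
  apply/asboolP; apply: planar_on_sub pE; first exact: subsetT.
  by apply/subsetP => e; rewrite inE => /andP[].
have closedA w z : w \in A -> adj E w z -> z \in A.
  by rewrite !inE => xw wz; apply: connect_trans xw (connect1 wz).
have closedC w z : w \in ~: A -> adj E w z -> z \in ~: A.
  rewrite !in_setC => wA wz; apply: contra wA => zA.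
  by apply: closedA zA _; rewrite adj_sym.
split; last by rewrite /planar_class deg ?pl.
apply/andP; split; first by rewrite /planar_class deg ?pl.
have reach w : connect (adj E) x w -> connect (adj (restrict_edges A E)) x w.
  have walk p y : y \in A -> path (adj E) y p ->
      connect (adj (restrict_edges A E)) y (last y p).
    elim: p y => [|z p IH] y yA //=; case/andP => yz pz.
    have zA := closedA _ _ yA yz; apply: connect_trans (IH z zA pz); apply: connect1.
    by case/andP: yz => yz yzE; rewrite /adj /= yz inE yzE subUset !sub1set yA zA.
  by case/connectP => p xp ->; apply: walk; rewrite // inE connect0.
apply/connected_onP => y z; rewrite !inE => /reach xy /reach xz.
by apply: connect_trans xz; rewrite connect_sym_adj.
Qed.

Lemma num_class_le (P Q : graph_class) (V : finType) (A : {set V}) :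
  (forall E, inside A E -> P V A E -> Q V A E) -> num_class P A <= num_class Q A.
Proof.
move=> PQ; apply: subset_leq_card; apply/subsetP => E.
by rewrite !inE => /andP[iE /(PQ _ iE) ->]; rewrite iE.
Qed.

Lemma num_planar_small : exists L, forall d D n,
  num_class (planar_class R d D) [set: 'I_n] <= n`! * L ^ n.
Proof.
have [L HL] := num_K5_free_small; exists L => d' D' n; apply: leq_trans (HL n).
apply: subset_leq_card; apply/subsetP => E; rewrite !inE => /andP[iE /andP[_ /asboolP pE]].
by rewrite iE (planar_on_K5_free iE pE).
Qed.

Lemma num_rich_connected V (A : {set V}) :
  num_class (rich_class R d D 2) A <= num_class (connected_class R d D) A.
Proof.
apply: num_class_le => E _ /and3P[pE _ rE].
by rewrite /connected_class pE (removable_connected rE).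
Qed.

Lemma num_connected_planar V (A : {set V}) :
  num_class (connected_class R d D) A <= num_class (planar_class R d D) A.
Proof. by apply: num_class_le => E _ /andP[]. Qed.

Lemma num_rich3_rich2 V (A : {set V}) :
  num_class (rich_class R d D 3) A <= num_class (rich_class R d D 2) A.
Proof.
apply: num_class_le => E _ /and3P[pE lE rE].
by apply/and3P; split=> //; apply: removableW.
Qed.

End ClassCounting.

Lemma num_rich_le (R : realType) (d D D' k : nat) (V : finType) (A : {set V}) :
  (D <= D')%N -> (num_class (rich_class R d D k) A <= num_class (rich_class R d D' k) A)%N.
Proof.
move=> DD; apply: num_class_le => E _ /and3P[/andP[dE pE] lE rE].
apply/and3P; split=> //; apply/andP; split=> //.
apply/forall_inP => w wA; have /andP[-> wD] := forall_inP dE w wA.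
exact: leq_trans DD.
Qed.

(** * Explicit straight-line graphs *)

Section StraightLine.
Variable R : realType.
Implicit Types (p q r s z : R * R) (t : R).

Definition cross (K : pzRingType) (p q r : K * K) : K :=
  (q.1 - p.1) * (r.2 - p.2) - (q.2 - p.2) * (r.1 - p.1).

Definition same_side (K : numDomainType) (p q r s : K * K) : bool :=
  0 < cross p q r * cross p q s.

Definition segment p q t : R * R := (p.1 + t * (q.1 - p.1), p.2 + t * (q.2 - p.2)).

Lemma segment0 p q : segment p q 0 = p.
Proof. by case: p => x y; rewrite /segment /= !mul0r !addr0. Qed.

Lemma segment1 p q : segment p q 1 = q.
Proof. by case: q => x y; rewrite /segment /= !mul1r !subrKC. Qed.

Lemma cross_segment p q r s t :
  cross p q (segment r s t) = cross p q r + t * (cross p q s - cross p q r).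
Proof. by rewrite /cross /segment /=; ring. Qed.

Lemma segment_curve p q : p <> q -> curve (segment p q) p q.
Proof.
case: p q => [p1 p2] [q1 q2] pq; split; rewrite ?segment0 ?segment1 //.
  have lin (a b : R) : continuous (fun t => a + t * b).
    move=> t; apply: cvgD; first exact: cvg_cst.
    by apply: cvgM; [exact: cvg_id|exact: cvg_cst].
  by move=> t; exact: (cvg_pair (lin _ _ t) (lin _ _ t)).
move=> s t _ _ [/addrI E1 /addrI E2]; have [q1p|q1p] := eqVneq q1 p1.
  have [q2p|q2p] := eqVneq q2 p2; first by case: pq; rewrite q1p q2p.
  by apply: (mulIf _ E2); rewrite subr_eq0.
by apply: (mulIf _ E1); rewrite subr_eq0.
Qed.

Lemma trace_segment_cross p q z : trace (segment p q) z -> cross p q z = 0.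
Proof. by move=> [t _ ->]; rewrite cross_segment /cross; ring. Qed.

Lemma same_side_disjoint p q r s z : same_side p q r s ->
  trace (segment p q) z -> trace (segment r s) z -> False.
Proof.
rewrite /same_side => H /trace_segment_cross z0 [t /andP[t0 t1] zE].
move: z0; rewrite zE cross_segment; move: (cross p q r) (cross p q s) H => a b ab E.
have [a0|a0|a0] := ltrgtP a 0.
- have b0 : b < 0 by rewrite nmulr_rgt0 in ab.
  have : (1 - t) * a + t * b = 0 by rewrite -E; ring.
  have h1 : (1 - t) * a <= 0 by rewrite mulr_ge0_le0 ?subr_ge0 // ltW.
  have h2 : t * b <= 0 by rewrite mulr_ge0_le0 // ltW.
  move=> h; have : (1 - t) * a = 0 by lra.
  have : t * b = 0 by lra.
  move=> /eqP; rewrite mulf_eq0 (lt_eqF b0) orbF => /eqP -> /eqP.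
  by rewrite subr0 mul1r (lt_eqF a0).
- have b0 : 0 < b by rewrite pmulr_rgt0 in ab.
  have : (1 - t) * a + t * b = 0 by rewrite -E; ring.
  have h1 : 0 <= (1 - t) * a by rewrite mulr_ge0 ?subr_ge0 // ltW.
  have h2 : 0 <= t * b by rewrite mulr_ge0 // ltW.
  move=> h; have : (1 - t) * a = 0 by lra.
  have : t * b = 0 by lra.
  move=> /eqP; rewrite mulf_eq0 (gt_eqF b0) orbF => /eqP -> /eqP.
  by rewrite subr0 mul1r (gt_eqF a0).
- by rewrite a0 mul0r ltxx in ab.
Qed.

Lemma segments_share_end p q r z : cross p q r != 0 ->
  trace (segment p q) z -> trace (segment p r) z -> z = p.
Proof.
move=> pqr tq [t t01 zE]; have := trace_segment_cross tq; rewrite zE cross_segment.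
have -> : cross p q p = 0 by rewrite /cross; ring.
rewrite add0r subr0 => /eqP; rewrite mulf_eq0 (negPf pqr) orbF => /eqP ->.
exact: segment0.
Qed.

Lemma trace_segmentC p q : trace (segment p q) = trace (segment q p).
Proof.
have sub a b : trace (segment a b) `<=` trace (segment b a).
  move=> z [t t01 ->]; exists (1 - t); first exact: unit_rev.
  by rewrite /segment; congr (_, _); ring.
by apply/seteqP; split; apply: sub.
Qed.

Lemma crossC (K : comPzRingType) (p q r : K * K) :
  cross q p r = - cross p q r /\ cross p r q = - cross p q r.
Proof. by rewrite /cross; split; ring. Qed.

Variable V : finType.

Lemma straight_line_drawing (pos : V -> R * R) (E : {set {set V}}) :
  inside [set: V]%SET E -> injective pos ->
  (forall i j k, i != j -> i != k -> j != k -> cross (pos i) (pos j) (pos k) != 0) ->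
  (forall i j k l, uniq [:: i; j; k; l] ->
     [set i; j]%SET \in E -> [set k; l]%SET \in E ->
     same_side (pos i) (pos j) (pos k) (pos l) ||
     same_side (pos k) (pos l) (pos i) (pos j)) ->
  planar_on R [set: V]%SET E.
Proof.
move=> iE inj_pos general side.
pose arc (e : {set V}) : R -> R * R :=
  if [pick p : V * V | e == [set p.1; p.2]%SET] is Some p
  then segment (pos p.1) (pos p.2) else fun=> (0, 0).
have arcE e : e \in E -> exists i j, [/\ i != j, e = [set i; j]%SET & arc e = segment (pos i) (pos j)].
  move=> eE; have [a [b [ab _ _ eab]]] := insideP _ _ iE e eE; rewrite /arc.
  case: pickP => [[i j] /eqP /= eij|/(_ (a, b))]; last by rewrite /= eab eqxx.
  exists i, j; split=> //; apply/eqP => ij; move: eij; rewrite eab ij finset.setUid => eij.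
  have : a \in [set j]%SET by rewrite -eij !inE eqxx.
  have : b \in [set j]%SET by rewrite -eij !inE eqxx orbT.
  by rewrite !inE => /eqP bj /eqP aj; rewrite aj bj eqxx in ab.
exists pos, arc; split.
- by move=> i j _ _; apply: inj_pos.
- move=> e /arcE[i [j [ij -> ->]]]; exists i, j; split=> //.
  by apply: segment_curve => /inj_pos ijE; rewrite ijE eqxx in ij.
- move=> e w /arcE[i [j [ij -> ->]]] _ /trace_segment_cross /eqP; rewrite !inE.
  apply: contraLR; rewrite negb_or => /andP[wi wj]; apply: general => //; by rewrite eq_sym.
- move=> e e' eE e'E ee' z.
  have [i [j [ij eij ->]]] := arcE e eE; have [k [l [kl ekl ->]]] := arcE e' e'E.
  have share a b c : a != b -> a != c -> [set a; b]%SET != [set a; c]%SET ->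
     trace (segment (pos a) (pos b)) z -> trace (segment (pos a) (pos c)) z -> z = pos a.
    move=> ab ac abac; apply: segments_share_end; apply: general => //.
    by apply: contraNneq abac => ->.
  have ji : j != i by rewrite eq_sym.
  have lk : l != k by rewrite eq_sym.
  have [ik|ik] := eqVneq i k.
    subst k => t1 t2; exists i; rewrite eij ekl !inE eqxx; split=> //.
    by apply: (share i j l); rewrite -?eij -?ekl.
  have [il|il] := eqVneq i l.
    subst l => t1 t2; exists i; rewrite eij ekl !inE eqxx orbT; split=> //.
    apply: (share i j k) => //; last by rewrite trace_segmentC.
    by rewrite [[set i; k]%SET]finset.setUC -eij -ekl.
  have [jk|jk] := eqVneq j k.
    subst k => t1 t2; exists j; rewrite eij ekl !inE eqxx orbT; split=> //.
    apply: (share j i l) => //; last by rewrite trace_segmentC.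
    by rewrite [[set j; i]%SET]finset.setUC -eij -ekl.
  have [jl|jl] := eqVneq j l.
    subst l => t1 t2; exists j; rewrite eij ekl !inE eqxx !orbT; split=> //.
    apply: (share j i k) => //; try by rewrite trace_segmentC.
    by rewrite [[set j; i]%SET]finset.setUC [[set j; k]%SET]finset.setUC -eij -ekl.
  have U : uniq [:: i; j; k; l] by rewrite /= !inE !negb_or ij ik il jk jl kl.
  rewrite eij in eE; rewrite ekl in e'E.
  by case/orP: (side _ _ _ _ U eE e'E) => S t1 t2; exfalso;
    [apply: same_side_disjoint S t1 t2|apply: same_side_disjoint S t2 t1].
Qed.

End StraightLine.

Section ExplicitGraphs.
Import mathcomp.boot.fintype mathcomp.boot.finset.
Local Open Scope set_scope.
Local Open Scope nat_scope.

Definition incident (v : nat) (p : nat * nat) : bool := (p.1 == v) || (p.2 == v).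

Definition seq_degree (es : seq (nat * nat)) (v : nat) : nat := count (incident v) es.

(* Certificate for a connected straight-line graph on [0, ..., n]: vertex [i]
   has coordinates [pts`_i], and every positive vertex keeps a smaller
   neighbour after the removal of the edges [rem]. *)
Definition straight_line_certificate (n d D : nat) (pts : seq (int * int))
    (es rem : seq (nat * nat)) : bool :=
  let P := nth (0%R, 0%R) pts in
  let vs := iota 0 n.+1 in
  [&& all (fun p => p.1 < p.2 <= n) es, uniq es, uniq rem && all (mem es) rem, (n < size pts) && uniq pts,
      all (fun i => d <= seq_degree es i <= D) vs,
      has (fun i => seq_degree es i <= 5) vs,
      all (fun i => (i == 0) || has (fun j => (j < i) && ((j, i) \in es) && ((j, i) \notin rem)) vs) vs,
      all (fun i => all (fun j => all (fun k => uniq [:: i; j; k] ==> (cross (P i) (P j) (P k) != 0%R)) vs) vs) vs &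
      all (fun p => all (fun q => uniq [:: p.1; p.2; q.1; q.2] ==>
         same_side (P p.1) (P p.2) (P q.1) (P q.2) || same_side (P q.1) (P q.2) (P p.1) (P p.2)) es) es].

Variable n : nat.
Implicit Types (es rem : seq (nat * nat)).

Definition edge_of (p : nat * nat) : {set 'I_n.+1} := [set inord p.1; inord p.2].

Definition edges_of es : {set {set 'I_n.+1}} := [set e | e \in [seq edge_of p | p <- es]].

Lemma mem_edge_of (v : 'I_n.+1) p : p.1 < p.2 <= n -> (v \in edge_of p) = incident v p.
Proof.
move=> /andP[p12 p2]; rewrite !inE /incident -!(inj_eq val_inj) /= !inordK ?ltnS //.
  by rewrite ![_ == nat_of_ord v]eq_sym.
exact: leq_trans (ltnW p12) p2.
Qed.

Lemma edge_of_inj p q : p.1 < p.2 <= n -> q.1 < q.2 <= n -> edge_of p = edge_of q -> p = q.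
Proof.
move=> pP qP E; have inc (v : 'I_n.+1) : incident v p = incident v q.
  by rewrite -!mem_edge_of // E.
case: p q pP qP inc {E} => [a b] [c e] /= /andP[ab bn] /andP[ce en] inc.
have val i : i <= n -> ((a == i) || (b == i)) = ((c == i) || (e == i)).
  by move=> ilt; have := inc (inord i); rewrite /incident /= inordK.
have an : a <= n by lia.
have cn : c <= n by lia.
have /orP Ha : (c == a) || (e == a) by rewrite -val // eqxx.
have /orP Hb : (c == b) || (e == b) by rewrite -val // eqxx orbT.
by case: Ha => /eqP Ha; case: Hb => /eqP Hb; subst; first [by [] | exfalso; lia].
Qed.

Lemma card_edges_of (p : pred {set 'I_n.+1}) es : all (fun p => p.1 < p.2 <= n) es ->
  uniq es -> #|[set e in edges_of es | p e]| = count (fun q => p (edge_of q)) es.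
Proof.
move=> /allP ltes ues.
have uE : uniq [seq edge_of q | q <- es].
  by rewrite map_inj_in_uniq // => a b aes bes; apply: edge_of_inj; apply: ltes.
have -> : [set e in edges_of es | p e] = [set e in [seq e <- [seq edge_of q | q <- es] | p e]].
  by apply/setP => e; rewrite !inE mem_filter andbC.
by rewrite cardsE (card_uniqP _) ?filter_uniq // size_filter count_map.
Qed.

Lemma certificate_rich (R : realType) d D d' D' pts es rem :
  d' <= d -> D <= D' -> straight_line_certificate n d D pts es rem ->
  inside [set: 'I_n.+1] (edges_of es) &&
  rich_class R d' D' (size rem) [set: 'I_n.+1] (edges_of es).
Proof.
move=> dd DD /and5P[/allP ltes ues /andP[urem /allP sub] /andP[npts upts]].
case/and5P => /allP deg /hasP[v0 v0n low] /allP conn /allP gen /allP side.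
have vsP (v : 'I_n.+1) : nat_of_ord v \in iota 0 n.+1 by rewrite mem_iota add0n ltn_ord.
have degE (v : 'I_n.+1) : degree (edges_of es) v = seq_degree es v.
  rewrite /degree (card_edges_of (fun e => v \in e)) //; last exact/allP.
  by apply: eq_in_count => q /ltes; apply: mem_edge_of.
have memE (v w : 'I_n.+1) : [set v; w] \in edges_of es ->
    ((nat_of_ord v, nat_of_ord w) \in es) || ((nat_of_ord w, nat_of_ord v) \in es).
  rewrite inE => /mapP[q qes E]; have /= qlt := ltes q qes.
  have iv : incident v q by rewrite -mem_edge_of // -E !inE eqxx.
  have iw : incident w q by rewrite -mem_edge_of // -E !inE eqxx orbT.
  have : inord q.1 \in [set v; w] by rewrite E !inE eqxx.
  have : inord q.2 \in [set v; w] by rewrite E !inE eqxx orbT.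
  have [q1n q2n] : q.1 < n.+1 /\ q.2 < n.+1.
    by have /andP[q12 q2n] := qlt; split=> //; apply: leq_trans q12 (leqW q2n).
  rewrite !inE -!(inj_eq val_inj) /= !inordK //.
  case: q qes qlt {E iv iw q1n q2n} => [a b] /= qes qlt /orP[] /eqP E2 /orP[] /eqP E1.
  - by move: qlt; rewrite E1 E2 ltnn.
  - by rewrite -E1 -E2 qes orbT.
  - by rewrite -E1 -E2 qes.
  - by move: qlt; rewrite E1 E2 ltnn.
have iE : inside setT (edges_of es).
  apply/insideP => e; rewrite inE => /mapP[q /ltes /= qlt ->].
  exists (inord q.1), (inord q.2); split; rewrite ?inE //.
  have /andP[q12 q2n] := qlt; rewrite -(inj_eq val_inj) /= !inordK ?ltn_eqF //.
  exact: leq_trans q12 (leqW q2n).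
rewrite iE andTb; apply/and3P; split; first (apply/andP; split).
- apply/forall_inP => v _; rewrite degE; have /andP[d1 d2] := deg _ (vsP v).
  by rewrite (leq_trans dd d1) (leq_trans d2 DD).
- pose pos (i : 'I_n.+1) : R * R := ((nth (0%R, 0%R) pts i).1%:~R, (nth (0%R, 0%R) pts i).2%:~R)%R.
  have crossE i j k : cross (pos i) (pos j) (pos k) =
      ((cross (nth (0%R, 0%R) pts i) (nth (0%R, 0%R) pts j) (nth (0%R, 0%R) pts k))%:~R)%R.
    by rewrite /cross /= !(rmorphB, rmorphM).
  have sideE i j k l : same_side (pos i) (pos j) (pos k) (pos l) =
     same_side (nth (0%R, 0%R) pts i) (nth (0%R, 0%R) pts j) (nth (0%R, 0%R) pts k) (nth (0%R, 0%R) pts l).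
    by rewrite /same_side !crossE -rmorphM ltr0z.
  apply/asboolP; apply: (@straight_line_drawing _ _ pos) => //.
  + have ptslt (i : 'I_n.+1) : i < size pts by apply: leq_trans (ltn_ord i) npts.
    move=> i j [/intr_inj E1 /intr_inj E2]; apply: val_inj; apply/eqP.
    rewrite -(nth_uniq (0%R, 0%R) (ptslt i) (ptslt j) upts).
    by move: E1 E2; case: (nth _ _ i) => ? ?; case: (nth _ _ j) => ? ? /= -> ->.
  + move=> i j k ij ik jk; rewrite crossE intr_eq0.
    have /allP/(_ _ (vsP j))/allP/(_ _ (vsP k))/implyP := gen _ (vsP i); apply.
    by rewrite /= !inE !negb_or !(inj_eq val_inj) ij ik jk.
  + move=> i j k l U ijE klE.
    have U' : uniq [:: nat_of_ord i; nat_of_ord j; nat_of_ord k; nat_of_ord l].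
      by rewrite -(map_inj_uniq val_inj) in U.
    pose G a b c e := same_side (nth (0%R, 0%R) pts a) (nth (0%R, 0%R) pts b)
      (nth (0%R, 0%R) pts c) (nth (0%R, 0%R) pts e).
    have sd a b c e : (a, b) \in es -> (c, e) \in es -> uniq [:: a; b; c; e] ->
        G a b c e || G c e a b.
      by move=> pes qes; have /allP/(_ _ qes)/implyP := side _ pes.
    have sw1 a b c e : G a b c e = G b a c e.
      by rewrite /G /same_side (crossC (nth _ _ a) _ (nth _ _ c)).1
        (crossC (nth _ _ a) _ (nth _ _ e)).1 mulrNN.
    have sw2 a b c e : G a b c e = G a b e c by rewrite /G /same_side mulrC.
    rewrite !sideE -/(G i j k l) -/(G k l i j); move: U'; rewrite /= !inE !negb_or => U'.
    case/orP: (memE _ _ ijE) => ije; case/orP: (memE _ _ klE) => kle.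
    * by apply: sd ije kle _; rewrite /= !inE !negb_or.
    * have := sd _ _ _ _ ije kle; rewrite (sw2 i j) (sw1 l k); apply.
      by clear -U'; rewrite /= !inE !negb_or; lia.
    * have := sd _ _ _ _ ije kle; rewrite (sw1 j i) (sw2 k l); apply.
      by clear -U'; rewrite /= !inE !negb_or; lia.
    * have := sd _ _ _ _ ije kle; rewrite (sw1 j i) (sw2 i j) (sw1 l k) (sw2 k l); apply.
      by clear -U'; rewrite /= !inE !negb_or; lia.
- apply/exists_inP; have v0lt : v0 < n.+1 by rewrite mem_iota in v0n.
  by exists (Ordinal v0lt); rewrite // degE.
apply/existsP; exists (edges_of rem); apply/and3P; split.
- apply/subsetP => e; rewrite !inE => /mapP[q /sub qes ->]; exact: map_f.
- have := @card_edges_of predT rem; rewrite count_predT => <- //.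
    by apply/eqP; apply: eq_card => e; rewrite [RHS]inE andbT.
  by apply/allP => q /sub /ltes.
have to0 (i : 'I_n.+1) : connect (adj (edges_of es :\: edges_of rem)) i ord0.
  case: i => i; elim/ltn_ind: i => i IH ilt.
  have := conn i; rewrite mem_iota add0n ilt => /(_ isT)/orP[/eqP i0|].
    by rewrite (_ : Ordinal ilt = ord0) ?connect0 //; apply: val_inj.
  case/hasP => j _ /andP[/andP[ji jies] jirem].
  have jlt : j < n.+1 := ltn_trans ji ilt.
  apply: connect_trans (connect1 _) (IH j ji jlt).
  have eji : [set Ordinal ilt; Ordinal jlt] = edge_of (j, i).
    rewrite setUC /edge_of /=; congr [set _; _]; apply: val_inj; by rewrite /= inordK.
  rewrite /adj /= -(inj_eq val_inj) /= gtn_eqF //= eji !inE (map_f edge_of jies) andbT.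
  apply/negP => /mapP[q qrem] /edge_of_inj E; move: jirem; rewrite E ?qrem //.
    by rewrite /= ji -ltnS.
  by apply: ltes; apply: sub.
apply/connected_onP => x y _ _; apply: connect_trans (to0 x) _.
by rewrite connect_sym_adj.
Qed.

End ExplicitGraphs.

Section BaseGraphs.
Local Open Scope nat_scope.

Definition int_points (s : seq (nat * nat)) : seq (int * int) :=
  [seq (Posz p.1, Posz p.2) | p <- s].

Lemma graph4_certificate : straight_line_certificate 3 2 3
  (int_points [:: (0, 0); (5, 0); (0, 5); (2, 2)])
  [:: (0, 1); (0, 2); (0, 3); (1, 2); (1, 3); (2, 3)]
  [:: (1, 2); (1, 3); (2, 3)].
Proof. by vm_compute. Qed.

Lemma graph5_certificate : straight_line_certificate 4 2 3
  (int_points [:: (0, 0); (5, 1); (0, 5); (1, 3); (1, 4)])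
  [:: (0, 1); (0, 2); (0, 3); (1, 2); (1, 3); (2, 4); (3, 4)]
  [:: (1, 2); (1, 3); (3, 4)].
Proof. by vm_compute. Qed.

Lemma graph8_certificate : straight_line_certificate 7 4 4
  (int_points [:: (0, 0); (0, 7); (1, 3); (7, 2); (3, 2); (1, 5); (2, 5);
    (2, 4)])
  [:: (0, 1); (0, 2); (0, 3); (0, 4); (1, 3); (1, 5); (1, 6); (2, 4); (2,
    5); (2, 7); (3, 4); (3, 6); (4, 7); (5, 6); (5, 7); (6, 7)]
  [:: (1, 3); (2, 4); (2, 5)].
Proof. by vm_compute. Qed.

Lemma graph9_certificate : straight_line_certificate 8 4 4
  (int_points [:: (0, 0); (9, 0); (3, 9); (3, 6); (4, 1); (6, 2); (4, 3);
    (5, 3); (5, 2)])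
  [:: (0, 1); (0, 2); (0, 3); (0, 4); (1, 2); (1, 4); (1, 5); (2, 3); (2,
    5); (3, 6); (3, 7); (4, 6); (4, 8); (5, 7); (5, 8); (6, 7); (6, 8); (7,
    8)]
  [:: (1, 2); (1, 4); (2, 3)].
Proof. by vm_compute. Qed.

Lemma graph14_certificate : straight_line_certificate 13 5 6
  (int_points [:: (8, 4); (8, 2); (6, 5); (4, 3); (13, 3); (9, 7); (20, 0);
    (0, 0); (5, 8); (4, 5); (9, 10); (5, 12); (3, 20); (3, 9)])
  [:: (0, 1); (0, 2); (0, 3); (0, 4); (0, 5); (1, 3); (1, 4); (1, 6); (1,
    7); (2, 3); (2, 5); (2, 8); (2, 9); (3, 7); (3, 9); (4, 5); (4, 6); (4,
    10); (5, 8); (5, 10); (5, 11); (6, 7); (6, 10); (6, 12); (7, 9); (7,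
    12); (7, 13); (8, 9); (8, 11); (8, 13); (9, 13); (10, 11); (10, 12);
    (11, 12); (11, 13); (12, 13)]
  [:: (1, 3); (1, 4); (2, 3)].
Proof. by vm_compute. Qed.

Lemma graph15_certificate : straight_line_certificate 14 5 6
  (int_points [:: (17, 10); (19, 7); (24, 5); (11, 12); (6, 24); (15, 9);
    (14, 8); (17, 6); (0, 0); (11, 4); (12, 9); (9, 8); (7, 10); (12, 7);
    (6, 6)])
  [:: (0, 1); (0, 2); (0, 3); (0, 4); (0, 5); (1, 2); (1, 5); (1, 6); (1,
    7); (2, 4); (2, 7); (2, 8); (2, 9); (3, 4); (3, 5); (3, 10); (3, 11);
    (3, 12); (4, 8); (4, 12); (5, 6); (5, 10); (6, 7); (6, 10); (6, 13); (7,
    9); (7, 13); (8, 9); (8, 12); (8, 14); (9, 13); (9, 14); (10, 11); (10,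
    13); (11, 12); (11, 13); (11, 14); (12, 14); (13, 14)]
  [:: (1, 2); (1, 5); (2, 4)].
Proof. by vm_compute. Qed.

End BaseGraphs.

Lemma num_rich_certificate (R : realType) n d D d' D' pts es rem :
  (d' <= d)%N -> (D <= D')%N -> straight_line_certificate n d D pts es rem ->
  size rem = 3%N -> (0 < num_class (rich_class R d' D' 3) [set: 'I_n.+1]%SET)%N.
Proof.
move=> dd DD cert rem3; apply/card_gt0P; exists (edges_of n es).
by rewrite inE -rem3 (certificate_rich R dd DD cert).
Qed.

Lemma base_graphs (R : realType) (d D : nat) : (d <= 5)%N -> (maxn d 3 <= D)%N ->
  (d, D) <> (3, 3)%N -> (d, D) <> (5, 5)%N ->
  exists2 p, (2 < p)%N & (0 < num_class (rich_class R d D 3) [set: 'I_p]%SET)%N /\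
    (0 < num_class (rich_class R d D 3) [set: 'I_p.+1]%SET)%N.
Proof.
move=> d5 dD n33 n55; have D3 : (3 <= D)%N by lia.
have [d2|d2] := leqP d 2.
  exists 4%N => //; split.
    exact: (num_rich_certificate R d2 D3 graph4_certificate erefl).
  exact: (num_rich_certificate R d2 D3 graph5_certificate erefl).
have [d4|d4] := leqP d 4.
  have D4 : (4 <= D)%N.
    by case: (ltngtP D 3) => [|//|E]; [lia|]; case: n33; congr (_, _); lia.
  exists 8%N => //; split.
    exact: (num_rich_certificate R d4 D4 graph8_certificate erefl).
  exact: (num_rich_certificate R d4 D4 graph9_certificate erefl).
have D6 : (6 <= D)%N.
  by case: (ltngtP D 5) => [|//|E]; [lia|]; case: n55; congr (_, _); lia.
exists 14%N => //; split.
  exact: (num_rich_certificate R d5 D6 graph14_certificate erefl).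
exact: (num_rich_certificate R d5 D6 graph15_certificate erefl).
Qed.

(** * Growth rates *)

Section GrowthRate.
Variable R : realType.

Lemma bernoulli (e : R) n : 0 <= e -> n%:R * e <= (1 + e) ^+ n.
Proof.
move=> e0; suff : 1 + n%:R * e <= (1 + e) ^+ n by apply: le_trans; rewrite lerDr.
elim: n => [|n IH]; first by rewrite mul0r addr0 expr0.
rewrite exprS; apply: le_trans (_ : (1 + e) * (1 + n%:R * e) <= _); last first.
  by rewrite ler_pM2l // ltr_pwDl.
rewrite -natr1 mulrDl mulrDl mul1r !mulrDr mulr1 mul1r.
rewrite -subr_ge0; set x := (X in 0 <= X); have -> : x = n%:R * (e * e) by rewrite /x; ring.
by rewrite mulr_ge0 // mulr_ge0.
Qed.

Lemma root_exists (y : R) m : (0 < m)%N -> 0 <= y -> exists2 t, 0 <= t & t ^+ m = y.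
Proof.
move=> m0 y0; exists (y `^ m%:R^-1); first exact: powR_ge0.
by rewrite -powR_mulrn ?powR_ge0 // -powRrM mulVf ?powRr1 // pnatr_eq0 -lt0n.
Qed.

Lemma poly_le_exp d (rho : R) : 1 < rho ->
  exists2 C, 0 < C & forall n, n%:R ^+ d <= C * rho ^+ n.
Proof.
move=> rho1; have [tau tau0 tauE] := root_exists (ltn0Sn d) (ltW (lt_trans ltr01 rho1)).
have tau1 : 1 < tau.
  rewrite ltNge; apply/negP => t1; have : tau ^+ d.+1 <= 1 by rewrite exprn_ile1.
  by rewrite tauE leNgt rho1.
pose e := tau - 1; have e0 : 0 < e by rewrite subr_gt0.
have C0 : 0 < (e ^+ d.+1)^-1 by rewrite invr_gt0 exprn_gt0.
exists (1 + (e ^+ d.+1)^-1) => [|[|n]]; first by rewrite addr_gt0.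
  rewrite expr0 mulr1; apply: (@le_trans _ _ 1); last by rewrite lerDl ltW.
  by rewrite expr0n; case: (d == _).
have H : (n.+1%:R * e) ^+ d.+1 <= rho ^+ n.+1.
  rewrite -tauE -exprM mulnC exprM lerXn2r ?nnegrE ?mulr_ge0 ?exprn_ge0 ?(ltW e0) //.
  by have := bernoulli n.+1 (ltW e0); rewrite [1 + e]addrC subrK.
apply: (@le_trans _ _ ((e ^+ d.+1)^-1 * rho ^+ n.+1)); last first.
  by rewrite ler_wpM2r ?lerDr // exprn_ge0 // ltW // (lt_trans ltr01).
rewrite mulrC ler_pdivlMr ?exprn_gt0 //; apply: le_trans H.
by rewrite exprMn ler_pM2r ?exprn_gt0 // [leRHS]exprS ler_peMl ?exprn_ge0 // ler1n.
Qed.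

Lemma poly_lt_exp d (rho K : R) : 1 < rho -> 0 < K ->
  \forall n \near \oo, n%:R ^+ d <= K * rho ^+ n.
Proof.
move=> rho1 K0; have [C C0 HC] := poly_le_exp d.+1 rho1.
near=> n; have n0 : (0 < n%:R :> R) by rewrite ltr0n; near: n; exact: nbhs_infty_gt.
rewrite -(ler_pM2l n0) -exprS; apply: le_trans (HC n) _.
rewrite mulrA ler_pM2r ?exprn_gt0 ?(lt_trans ltr01) //.
rewrite -ler_pdivrMr //; near: n; exact: nbhs_infty_ger.
Unshelve. all: by end_near.
Qed.

Lemma geometric_sum_le (r : R) n : 0 <= r -> r < 1 -> \sum_(m < n) r ^+ m <= (1 - r)^-1.
Proof.
move=> r0 r1; have r1' : 0 < 1 - r by rewrite subr_gt0.
rewrite -[leRHS]mul1r ler_pdivlMr // mulrC.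
have -> : (1 - r) * \sum_(m < n) r ^+ m = 1 - r ^+ n.
  by rewrite -[RHS]opprB subrX1 -mulNr opprB.
by rewrite gerBl exprn_ge0.
Qed.

Variables (u b a : nat -> nat -> R) (x : nat -> R) (N0 n0 : nat) (L C0 C1 : R).
Hypotheses (N0_gt0 : (0 < N0)%N) (L_ge0 : 0 <= L) (C0_ge0 : 0 <= C0) (C1_ge0 : 0 <= C1).
Hypothesis u_merge : forall N m k, (N0 <= N)%N -> (0 < m)%N -> (0 < k)%N ->
  u N m * u N k <= (m + k)%:R ^+ 4 * u N (m + k)%N.
Hypothesis u_ge0 : forall N n, 0 <= u N n.
Hypothesis u_le : forall N n, u N n <= L ^+ n.
Hypothesis u_gt0 : forall N n, (N0 <= N)%N -> (N0 <= n)%N -> 0 < u N n.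
Hypothesis b_ge0 : forall N n, 0 <= b N n.
Hypothesis b_le : forall N m, (N0 <= N)%N -> (1 < m)%N ->
  b N m <= C0 * (m + n0)%:R ^+ 4 * u N (m + n0)%N.
Hypothesis b1_le : forall N, b N 1%N <= C1.
Hypothesis a_ge0 : forall N n, 0 <= a N n.
Hypothesis a0_le : forall N, a N 0%N <= 1.
Hypothesis a_rec : forall N n, n%:R * a N n <= \sum_(m < n.+1) m%:R * b N m * a N (n - m)%N.
Hypothesis x_ge : forall N n, (N0 <= N)%N -> (N <= n)%N -> u N n <= x n.
Hypothesis x_le : forall n, (N0 <= n)%N -> x n <= a n n.

(* The factor [3 ^ 8 * m ^ 4] absorbs the loss in [u_merge] as long as the two
   parts have comparable sizes. *)
Let v N m : R := u N m / (3 ^+ 8 * m%:R ^+ 4).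

Let den_gt0 m : (0 < m)%N -> 0 < 3 ^+ 8 * m%:R ^+ 4 :> R.
Proof. by move=> m0; rewrite mulr_gt0 ?exprn_gt0 ?ltr0n. Qed.

Let v_ge0 N m : 0 <= v N m.
Proof. by rewrite divr_ge0 // mulr_ge0 ?exprn_ge0 ?ler0n. Qed.

Let v_merge N m k : (N0 <= N)%N -> (0 < m)%N -> (0 < k)%N -> (m <= 2 * k)%N -> (k <= 2 * m)%N ->
  v N m * v N k <= v N (m + k)%N.
Proof.
move=> N_ m0 k0 mk km; rewrite /v mulf_div.
have mk0 : (0 < m + k)%N by rewrite addn_gt0 m0.
rewrite (ler_pdivrMr _ _ (mulr_gt0 (den_gt0 m0) (den_gt0 k0))).
apply: le_trans (u_merge N_ m0 k0) _.
rewrite [leRHS]mulrAC -[leRHS]mulrA [leLHS]mulrC ler_wpM2l //.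
rewrite ler_pdivlMr ?den_gt0 //.
have m3 : (m + k)%:R <= 3 * m%:R :> R by rewrite -natrM ler_nat; lia.
have k3 : (m + k)%:R <= 3 * k%:R :> R by rewrite -natrM ler_nat; lia.
have X4 (p q : R) : 0 <= p -> p <= q -> p ^+ 4 <= q ^+ 4.
  by move=> p0 pq; apply: lerXn2r; rewrite ?nnegrE ?(le_trans p0).
have := ler_pM (exprn_ge0 4 (ler0n _ _)) (exprn_ge0 4 (ler0n _ _)) (X4 _ _ (ler0n _ _) m3) (X4 _ _ (ler0n _ _) k3).
rewrite !exprMn => H; set s := (m + k)%:R in H *.
have e8 : (3 : R) ^+ 8 = 3 ^+ 4 * 3 ^+ 4 by rewrite -exprD.
have : 0 <= (3 : R) ^+ 8 by rewrite exprn_ge0.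
move: H; rewrite e8; move: (s ^+ 4) (m%:R ^+ 4) (k%:R ^+ 4) (3 ^+ 4) => S M K T H T0.
have -> : S * (T * T * S) = (T * T) * (S * S) by ring.
have -> : T * T * M * (T * T * K) = (T * T) * (T * M * (T * K)) by ring.
exact: ler_wpM2l.
Qed.

Let v_pow N m q : (N0 <= N)%N -> (0 < m)%N -> (0 < q)%N -> v N m ^+ q <= v N (q * m)%N.
Proof.
move=> N_ m0; elim/ltn_ind: q => q IH q0.
have [q1|q1] := leqP q 1; first by case: q q0 q1 IH => [|[|q]] // *; rewrite expr1 mul1n.
pose k := (q %/ 2)%N; have [k0 kq kk] : [/\ (0 < k)%N, (k < q)%N & (k <= q - k <= 2 * k)%N].
  by rewrite /k; split; lia.
have qE : q = (k + (q - k))%N by lia.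
rewrite {1}qE exprD [in leRHS]qE mulnDl.
apply: le_trans (ler_pM _ _ (IH k kq k0) (IH (q - k)%N _ _)) (v_merge _ _ _ _ _);
  rewrite ?exprn_ge0 ?muln_gt0 ?m0 ?andbT //; nia.
Qed.

Let T : set R := [set t | 0 <= t /\ exists N m, [/\ (N0 <= N)%N, (0 < m)%N & t ^+ m <= v N m]].

Let v_le_u N m : (0 < m)%N -> v N m <= u N m.
Proof.
move=> m0; rewrite /v ler_pdivrMr ?den_gt0 // ler_peMr //.
by rewrite mulr_ege1 // exprn_ege1 // ler1n.
Qed.

Let T_sup : has_sup T.
Proof.
split.
  exists 0; split=> //; exists N0, N0; split=> //.
  by rewrite expr0n -[_ == _]negbK -lt0n N0_gt0 v_ge0.
exists L => t [t0 [N [m [N_ m0 tm]]]].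
have : t ^+ m <= L ^+ m by apply: le_trans tm (le_trans (v_le_u _ m0) (u_le _ _)).
by rewrite ler_pXn2r ?nnegrE.
Qed.

Let gamma := sup T.

Let gamma_gt0 : 0 < gamma.
Proof.
have v0 : 0 < v N0 N0 by rewrite divr_gt0 ?den_gt0 // u_gt0.
pose t := Num.min 1 (v N0 N0).
have t0 : 0 < t by rewrite lt_min ltr01.
apply: (lt_le_trans t0); apply: (sup_upper_bound T_sup).
split; first exact: ltW t0.
exists N0, N0; split=> //; apply: le_trans (_ : t <= _); last by rewrite ge_min lexx orbT.
have t1 : t <= 1 by rewrite ge_min lexx.
by rewrite -{2}[t]expr1 ler_wiXn2l ?(ltW t0).
Qed.

Let v_le_gamma N m : (N0 <= N)%N -> (0 < m)%N -> v N m <= gamma ^+ m.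
Proof.
move=> N_ m0; have [t t0 tE] := root_exists m0 (v_ge0 N m).
rewrite -tE; apply: lerXn2r; rewrite ?nnegrE ?(ltW gamma_gt0) //.
by apply: sup_upper_bound => //; split=> //; exists N, m; rewrite tE.
Qed.

Let x_lower t : 0 < t -> t < gamma -> \forall n \near \oo, t ^+ n <= x n.
Proof.
move=> t0 tg; have [s [s0 [N [m [N_ m0 sv]]]] ts] := sup_gt T_sup.1 tg.
have s_gt0 := lt_trans t0 ts.
have [k k0 Hk] : exists2 k, 0 < k & forall r, (N0 <= r < N0 + m)%N -> k * s ^+ r <= u N r.
  pose F (i : 'I_m) := u N (N0 + i)%N / s ^+ (N0 + i).
  exists (\big[Num.min/1]_i F i).
    elim/big_ind: _ => // [p q p0 q0|i _]; first by rewrite lt_min p0.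
    by rewrite divr_gt0 ?exprn_gt0 // u_gt0 // leq_addr.
  move=> r /andP[r0 rm]; have im : (r - N0 < m)%N by rewrite ltn_subLR.
  rewrite -ler_pdivlMr ?exprn_gt0 //.
  have : \big[Num.min/1]_i F i <= F (Ordinal im) by apply: bigmin_le_cond.
  by rewrite /F /= subnKC.
have rho1 : 1 < s / t by rewrite ltr_pdivlMr ?mul1r.
have e0 := poly_lt_exp 4 rho1 k0.
near=> n.
have nN : (N0 + m + N <= n)%N by near: n; exact: nbhs_infty_ge.
have en : n%:R ^+ 4 <= k * (s / t) ^+ n by near: n.
pose q := ((n - N0) %/ m)%N; pose r := (N0 + (n - N0) %% m)%N.
have nqr : n = (q * m + r)%N.
  rewrite /q /r addnCA -(divn_eq (n - N0) m) subnKC //.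
  by apply: leq_trans nN; rewrite -addnA leq_addr.
have rm : (N0 <= r < N0 + m)%N by rewrite leq_addr ltn_add2l ltn_pmod.
have q0 : (0 < q)%N.
  by rewrite divn_gt0 // leq_subRL; move: nN; clear; lia.
have qm0 : (0 < q * m)%N by rewrite muln_gt0 q0.
have r0 : (0 < r)%N by rewrite addn_gt0 N0_gt0.
have n_gt0 : (0 < n)%N by apply: leq_trans nN; rewrite addn_gt0 addn_gt0 N0_gt0.
have n0' : (0 : R) < n%:R ^+ 4 by rewrite exprn_gt0 // ltr0n.
apply: le_trans (x_ge N_ _); last by apply: leq_trans nN; rewrite leq_addl.
rewrite -(ler_pM2l n0'); have := u_merge N_ qm0 r0; rewrite -nqr; apply: le_trans.
have uq : s ^+ (q * m) <= u N (q * m)%N.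
  apply: le_trans (v_le_u _ qm0); apply: le_trans (v_pow N_ m0 q0).
  by rewrite mulnC exprM; apply: lerXn2r; rewrite ?nnegrE ?exprn_ge0.
apply: le_trans (_ : s ^+ (q * m) * (k * s ^+ r) <= _); last first.
  by apply: ler_pM; rewrite ?mulr_ge0 ?exprn_ge0 ?(ltW k0) // Hk.
rewrite mulrCA -exprD -nqr -ler_pdivlMr ?exprn_gt0 //.
by rewrite -mulrA -expr_div_n.
Unshelve. all: by end_near.
Qed.

Let mb_le s : gamma < s -> exists2 C, 0 <= C &
  forall N m, (N0 <= N)%N -> m%:R * b N m <= C * s ^+ m.
Proof.
move=> gs; have s0 := lt_trans gamma_gt0 gs.
have rho1 : 1 < s / gamma by rewrite ltr_pdivlMr ?mul1r.
have [C C_gt0 HC] := poly_le_exp 9 rho1.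
pose C2 := C0 * 3 ^+ 8 * C * s ^+ n0.
exists (C1 / s + C2) => [|N m N_].
  by rewrite addr_ge0 ?divr_ge0 ?mulr_ge0 ?exprn_ge0 // ltW.
have C20 : 0 <= C2 by rewrite !mulr_ge0 ?exprn_ge0 // ltW.
have C1s : 0 <= C1 / s by rewrite divr_ge0 // ltW.
case: m => [|[|m]].
- by rewrite mul0r mulr_ge0 ?addr_ge0 ?exprn_ge0 // ltW.
- rewrite mul1r expr1 mulrDl divfK ?gt_eqF //.
  by apply: le_trans (b1_le N) _; rewrite lerDl mulr_ge0 // ltW.
apply: (@le_trans _ _ (C2 * s ^+ m.+2)); last first.
  by rewrite ler_wpM2r ?lerDr // exprn_ge0 // ltW.
set k := m.+2; pose j := (k + n0)%N.
have j0 : (0 < j)%N by rewrite /j /k.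
have uj : u N j <= 3 ^+ 8 * j%:R ^+ 4 * gamma ^+ j.
  have := v_le_gamma N_ j0; by rewrite /v ler_pdivrMr ?den_gt0 // mulrC.
have kj : k%:R <= j%:R :> R by rewrite ler_nat leq_addr.
apply: le_trans (_ : j%:R * (C0 * j%:R ^+ 4 * (3 ^+ 8 * j%:R ^+ 4 * gamma ^+ j)) <= _).
  apply: ler_pM => //; apply: le_trans (b_le N_ _) _ => //.
  by apply: ler_wpM2l; rewrite ?mulr_ge0 ?exprn_ge0.
have -> : j%:R * (C0 * j%:R ^+ 4 * (3 ^+ 8 * j%:R ^+ 4 * gamma ^+ j)) =
   (C0 * 3 ^+ 8) * (j%:R ^+ 9 * gamma ^+ j) :> R.
  have -> : j%:R ^+ 9 = j%:R * j%:R ^+ 4 * j%:R ^+ 4 :> R by rewrite -exprS -exprD.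
  by move: (3 ^+ 8) (j%:R ^+ 4) (gamma ^+ j) => B G H; ring.
rewrite /C2 -[leRHS]mulrA -[leRHS]mulrA ler_wpM2l ?mulr_ge0 ?exprn_ge0 //.
rewrite -exprD addnC -/j; apply: le_trans (_ : C * (s / gamma) ^+ j * gamma ^+ j <= _).
  by rewrite ler_wpM2r // exprn_ge0 // ltW.
by rewrite -mulrA -exprMn divfK ?gt_eqF.
Qed.

Let a_upper t : gamma < t -> exists2 M, 0 < M &
  forall N n, (N0 <= N)%N -> a N n <= M * t ^+ n.
Proof.
move=> gt; have t0 := lt_trans gamma_gt0 gt.
pose s := (gamma + t) / 2; have [gs st] : gamma < s /\ s < t by rewrite /s; split; lra.
have s0 := lt_trans gamma_gt0 gs.
have [C C_ge0 HC] := mb_le gs.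
have st1 : s / t < 1 by rewrite ltr_pdivrMr ?mul1r.
pose S := C * (1 - s / t)^-1.
have S0 : 0 <= S by rewrite mulr_ge0 // invr_ge0 subr_ge0 ltW.
pose K := Num.max 1 S; have K1 : 1 <= K by rewrite le_max lexx.
pose n1 := (Num.truncn S).+1.
have Sn1 : S <= n1%:R by rewrite ltW // truncnS_gt.
exists (K ^+ n1) => [|N n N_]; first by rewrite exprn_gt0 // (lt_le_trans ltr01).
suff : a N n <= K ^+ minn n n1 * t ^+ n.
  move=> H; apply: le_trans H _; rewrite ler_wpM2r ?exprn_ge0 ?(ltW t0) //.
  by rewrite ler_weXn2l // geq_minr.
elim/ltn_ind: n => -[|n] IH; first by rewrite min0n !expr0 mulr1.
have nn : (0 : R) < n.+1%:R by rewrite ltr0n.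
rewrite -(ler_pM2l nn); apply: le_trans (a_rec N n.+1) _.
have K0 : 0 <= K by apply: le_trans K1.
set Z := K ^+ minn n n1 * t ^+ n.+1.
have Z0 : 0 <= Z by rewrite mulr_ge0 // exprn_ge0 // ltW.
apply: (@le_trans _ _ (\sum_(m < n.+2) C * (s / t) ^+ m * Z)).
  apply: ler_sum => m _; have [m0|m0] := posnP m.
    by rewrite m0 !mul0r expr0 mulr1 mulr_ge0.
  have mn : (m <= n.+1)%N by rewrite -ltnS.
  apply: le_trans (ler_pM _ _ (HC N m N_) (IH (n.+1 - m)%N _)) _; rewrite ?mulr_ge0 //.
    by rewrite ltn_subrL m0.
  have -> : C * (s / t) ^+ m * Z = C * s ^+ m * (K ^+ minn n n1 * t ^+ (n.+1 - m)).
    have tE : t ^+ n.+1 = t ^+ m * t ^+ (n.+1 - m) by rewrite -exprD subnKC.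
    rewrite /Z tE expr_div_n; have : t ^+ m != 0 by rewrite expf_neq0 // gt_eqF.
    by move: (t ^+ m) (s ^+ m) (t ^+ _) (K ^+ _) => p q r z p0; field.
  rewrite ler_wpM2l ?mulr_ge0 ?exprn_ge0 ?(ltW s0) //.
  have le_min : (minn (n.+1 - m) n1 <= minn n n1)%N.
    rewrite leq_min geq_minr andbT; apply: leq_trans (geq_minl _ _) _.
    by rewrite leq_subLR; exact: (leq_add m0 (leqnn n)).
  by rewrite ler_wpM2r ?exprn_ge0 ?(ltW t0) // ler_weXn2l.
rewrite -mulr_suml -mulr_sumr; apply: (@le_trans _ _ (S * Z)).
  by rewrite ler_wpM2r // ler_wpM2l // geometric_sum_le // divr_ge0 // ltW.
rewrite /Z !mulrA ler_wpM2r ?exprn_ge0 ?(ltW t0) //.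
have [nn1|nn1] := leqP n.+1 n1.
  rewrite (minn_idPl (ltnW nn1)) exprS mulrA ler_wpM2r ?exprn_ge0 //.
  apply: (@le_trans _ _ K); first by rewrite le_max lexx orbT.
  by rewrite ler_peMl // ler1n.
have -> : minn n n1 = n1 by apply/minn_idPr; rewrite -ltnS.
by rewrite ler_wpM2r ?exprn_ge0 // (le_trans Sn1) // ler_nat ltnW.
Qed.

Let x_upper t : gamma < t -> \forall n \near \oo, x n <= t ^+ n.
Proof.
move=> gt; pose s := (gamma + t) / 2; have [gs st] : gamma < s /\ s < t by rewrite /s; split; lra.
have s0 := lt_trans gamma_gt0 gs; have [M M0 HM] := a_upper gs.
have rho1 : 1 < t / s by rewrite ltr_pdivlMr ?mul1r.
have iM0 : 0 < M^-1 by rewrite invr_gt0.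
have e0 := poly_lt_exp 0 rho1 iM0.
near=> n.
have nN : (N0 <= n)%N by near: n; exact: nbhs_infty_ge.
have en : n%:R ^+ 0 <= M^-1 * (t / s) ^+ n by near: n.
apply: le_trans (x_le nN) _; apply: le_trans (HM n n nN) _.
by move: en; rewrite expr0 mulrC ler_pdivlMr // mul1r expr_div_n ler_pdivlMr ?exprn_gt0.
Unshelve. all: by end_near.
Qed.

Lemma growth_rate : exists g : R, 0 < g /\ (fun n => x n `^ n%:R^-1) @ \oo --> g.
Proof.
exists gamma; split=> //; apply/cvgrPdist_le => /= e e0.
pose t := Num.max (gamma / 2) (gamma - e); pose t' := gamma + e.
have t0 : 0 < t by rewrite lt_max divr_gt0.
have gt' : gamma < t' by rewrite ltrDl.
have tg : t < gamma.
  rewrite gt_max gtrBl e0 andbT ltr_pdivrMr // ltr_pMr //.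
  by rewrite ltr1n.
have H1 := x_lower t0 tg; have H2 := x_upper gt'.
near=> n.
have n_gt0 : (0 < n)%N by near: n; exact: nbhs_infty_gt.
have xl : t ^+ n <= x n by near: n.
have xu : x n <= t' ^+ n by near: n.
have n0' : 0 <= (n%:R : R)^-1 by rewrite invr_ge0.
have rt (y : R) : 0 <= y -> (y ^+ n) `^ n%:R^-1 = y.
  by move=> y0; rewrite -powR_mulrn // -powRrM divff ?powRr1 // pnatr_eq0 -lt0n.
have x0 : 0 <= x n by apply: le_trans xl; rewrite exprn_ge0 // ltW.
have lo : t <= x n `^ n%:R^-1.
  rewrite -[leLHS]rt ?(ltW t0) //; apply: ge0_ler_powR => //; rewrite nnegrE //.
  by rewrite exprn_ge0 // ltW.
have t'0 := lt_trans gamma_gt0 gt'.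
have hi : x n `^ n%:R^-1 <= t'.
  rewrite -[leRHS]rt ?(ltW t'0) //; apply: ge0_ler_powR => //; rewrite nnegrE //.
  by rewrite exprn_ge0 // ltW.
rewrite ler_distlC; move: lo hi; rewrite /t ge_max => /andP[_ lo] hi.
by rewrite lo hi.
Unshelve. all: by end_near.
Qed.

End GrowthRate.

Section DegreeBounds.
Import mathcomp.boot.fintype mathcomp.boot.finset.
Local Open Scope set_scope.
Local Open Scope nat_scope.
Variable V : finType.
Implicit Types (E : {set {set V}}).

Lemma min_degree_le E v : min_degree E <= degree E v.
Proof.
rewrite /min_degree; elim: (index_enum V) (mem_index_enum v) => // w s IH.
by rewrite big_cons inE geq_min => /orP[/eqP ->|/IH ->]; rewrite ?leqnn ?orbT.
Qed.

Lemma min_degree_ge E d : d <= #|V| -> (forall v, d <= degree E v) -> d <= min_degree E.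
Proof.
move=> dV dE; rewrite /min_degree; elim/big_ind: _ => // a b da db.
by rewrite leq_min da.
Qed.

Lemma max_degreeP E D : reflect (forall v, degree E v <= D) (max_degree E <= D).
Proof.
apply: (iffP (@bigop.bigmax_leqP _ xpredT D (degree E))) => H v; first exact: H.
by move=> _; exact: H.
Qed.

End DegreeBounds.

Section PlanarGraphs.
Variables (R : realType) (n d D : nat).

Lemma asbool_planar_on (E : {set {set 'I_n}}) :
  `[< planar R E >] = `[< planar_on R [set: 'I_n]%SET E >].
Proof.
by apply: asbool_equiv_eq; split; [exact: planar_planar_on|exact: planar_on_planar].
Qed.

Lemma card_planar_graphs_le :
  (#|planar_graphs R n d%:Z 5 0 D%:Z| <= num_class (planar_class R d D) [set: 'I_n]%SET)%N.
Proof.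
apply: fintype.subset_leq_card; apply/fintype.subsetP => E; rewrite !inE simple_inside.
rewrite asbool_planar_on !lez_nat leq0n /= => /and4P[-> pE /andP[dmin _] maxD].
rewrite /planar_class pE andbT; apply/forall_inP => w _.
by rewrite (leq_trans dmin (min_degree_le E w)); have /max_degreeP := maxD; apply.
Qed.

Lemma card_planar_graphs_ge k : (5 <= n)%N -> (d <= 5)%N ->
  (num_class (rich_class R d D k) [set: 'I_n]%SET <= #|planar_graphs R n d%:Z 5 0 D%:Z|)%N.
Proof.
move=> n5 d5; apply: fintype.subset_leq_card; apply/fintype.subsetP => E.
rewrite !inE simple_inside asbool_planar_on !lez_nat leq0n /=.
case/andP => -> /and3P[/andP[/forall_inP deg ->] /exists_inP[w _ lw] _] /=.
rewrite (leq_trans (min_degree_le E w) lw) andbT; apply/andP; split.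
  apply: min_degree_ge; first by rewrite card_ord (leq_trans d5).
  by move=> v; have /andP[] := deg v (finset.in_setT v).
by apply/max_degreeP => v; have /andP[] := deg v (finset.in_setT v).
Qed.
End PlanarGraphs.

Section Normalized.
Variable R : realType.

Definition per_fact (c n : nat) : R := c%:R / n`!%:R.

Lemma per_fact_ge0 c n : 0 <= per_fact c n.
Proof. by rewrite divr_ge0. Qed.

Lemma per_fact_le (c c' n : nat) : (c <= c')%N -> per_fact c n <= per_fact c' n.
Proof. by move=> cc; rewrite ler_wpM2r ?invr_ge0 // ler_nat. Qed.

Lemma per_factM c c' m n : (m <= n)%N ->
  per_fact c m * per_fact c' (n - m) = per_fact ('C(n, m) * c * c')%N n.
Proof.
move=> mn; rewrite /per_fact -(bin_fact mn) !natrM; field.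
by rewrite !pnatr_eq0 -!lt0n !fact_gt0 bin_gt0 mn.
Qed.

Lemma per_factMl k c n : per_fact (k * c)%N n = k%:R * per_fact c n.
Proof. by rewrite /per_fact natrM mulrA. Qed.
End Normalized.

Theorem theorem14p3 (R : realType) (d1 : nat) (D2 : nat -> int)
    (d1_le5 : (d1 <= 5)%N)
    (D2_mono : forall m n : nat, (m <= n)%N -> D2 m <= D2 n)
    (D2_large : \forall n \near \oo,
       Num.max d1%:Z 3 <= D2 n /\
       (d1%:Z, D2 n) \notin [:: (3, 3); (5, 5)]) :
  exists gamma : R, 0 < gamma /\
    (fun n : nat =>
       (#|planar_graphs R n d1%:Z 5 0 (D2 n)|%:R / (n`!)%:R) `^ (n%:R^-1))
      @ \oo --> gamma.
Proof.
have [N1 _ HN1] := D2_large; pose D n := `|D2 n|%N.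
have D2E n : (N1 <= n)%N -> D2 n = (D n)%:Z.
  move=> /HN1[+ _]; rewrite ge_max => /andP[_ n3].
  by rewrite /D gez0_abs // (le_trans _ n3).
have Dmono m n : (N1 <= m)%N -> (m <= n)%N -> (D m <= D n)%N.
  by move=> mN mn; have := D2_mono m n mn; rewrite !D2E // (leq_trans mN).
have [p p2 [hp hp1]] : exists2 p, (2 < p)%N &
    (0 < num_class (rich_class R d1 (D N1) 3) [set: 'I_p]%SET)%N /\
    (0 < num_class (rich_class R d1 (D N1) 3) [set: 'I_p.+1]%SET)%N.
  have [+ +] := HN1 N1 (leqnn _); rewrite (D2E N1) // => dD nD.
  apply: base_graphs => //.
  - by move: dD; rewrite ge_max geq_max !lez_nat.
  - by case=> E1 E2; move: nD; rewrite E1 E2 inE eqxx.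
  - by case=> E1 E2; move: nD; rewrite E1 E2 !inE eqxx orbT.
pose c N n := num_class (rich_class R d1 (D N) 2) [set: 'I_n]%SET.
pose b N n := num_class (connected_class R d1 (D N)) [set: 'I_n]%SET.
pose a N n := num_class (planar_class R d1 (D N)) [set: 'I_n]%SET.
have h_gt0 N q : (N1 <= N)%N ->
    (0 < num_class (rich_class R d1 (D N1) 3) [set: 'I_q]%SET)%N ->
    (0 < num_class (rich_class R d1 (D N) 3) [set: 'I_q]%SET)%N.
  by move=> N1N; move=> /leq_trans; apply; apply/num_rich_le/Dmono.
have cD N m k : (0 < m)%N -> (0 < k)%N -> (0 < c N m)%N -> (0 < c N k)%N -> (0 < c N (m + k))%N.
  move=> m0 k0 cm ck; have := num_rich_merge R d1 (D N) (leq_addr k m); rewrite addKn -!/(c _ _).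
  case: (posnP (c N (m + k)%N)) => // ->; rewrite muln0 leqn0 !muln_eq0.
  by rewrite !gtn_eqF // bin_gt0 leq_addr.
have cp N : (N1 <= N)%N -> (0 < c N p)%N /\ (0 < c N p.+1)%N.
  move=> N1N; split; apply: leq_trans (num_rich3_rich2 _ _ _ _); exact: h_gt0.
have c_gt0 N n : (N1 <= N)%N -> (p * p <= n)%N -> (0 < c N n)%N.
  move=> /cp[c0 c1] pn; have p0 : (0 < p)%N by lia.
  have mul q k : (0 < k)%N -> (0 < c N k)%N -> (0 < c N (q.+1 * k))%N.
    move=> k0 ck; elim: q => [|q IH]; first by rewrite mul1n.
    by rewrite mulSn cD // muln_gt0.
  pose q := (n %/ p)%N; pose r := (n %% p)%N.
  have rq : (r < q)%N by rewrite (leq_trans (ltn_pmod _ p0)) // leq_divRL.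
  have nE : n = ((q - r.+1).+1 * p + r * p.+1)%N.
    rewrite {1}(divn_eq n p) -/q -/r; have -> : ((q - r.+1).+1 = q - r)%N by lia.
    by rewrite mulnS addnA addnAC -mulnDl subnK // ltnW.
  rewrite nE; case: (posnP r) => [->|r0]; first by rewrite mul0n addn0 mul.
  rewrite cD ?muln_gt0 ?r0 ?mul //.
  by rewrite -(prednK r0) mul.
have [L HL] := num_planar_small R.
have abL N n : (c N n <= b N n <= a N n)%N /\ (a N n <= n`! * L ^ n)%N.
  by split; [rewrite num_rich_connected num_connected_planar|exact: HL].
have perL k n : (k <= n`! * L ^ n)%N -> per_fact R k n <= L%:R ^+ n.
  by move=> kn; rewrite /per_fact ler_pdivrMr ?ltr0n ?fact_gt0 // mulrC -natrX -natrM ler_nat.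
pose N0 := (N1 + p * p + 5)%N.
apply: (@growth_rate R (fun N n => per_fact R (c N n) n)
  (fun N n => per_fact R (b N n) n) (fun N n => per_fact R (a N n) n) _ N0 p L%:R p`!%:R L%:R) => //.
- by rewrite /N0 addnS.
- move=> N m k _ m0 k0.
  have -> : per_fact R (c N k) k = per_fact R (c N k) (m + k - m) by rewrite addKn.
  rewrite per_factM ?leq_addr // -natrX -per_factMl; apply: per_fact_le.
  by have := num_rich_merge R d1 (D N) (leq_addr k m); rewrite addKn.
- by move=> N n; exact: per_fact_ge0.
- by move=> N n; apply: perL; have [/andP[cb ba] /(leq_trans ba)/(leq_trans cb)] := abL N n.
- move=> N n NN nn; rewrite /per_fact divr_gt0 ?ltr0n ?fact_gt0 // c_gt0 //.
    by apply: leq_trans NN; rewrite /N0 -addnA leq_addr.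
  by apply: leq_trans nn; rewrite /N0 addnAC leq_addl.
- by move=> N n; exact: per_fact_ge0.
- move=> N m NN m1; have N1N : (N1 <= N)%N by apply: leq_trans NN; rewrite /N0 -addnA leq_addr.
  have := num_connected_merge R d1 (D N) m1 (leq_addr p m).
  rewrite addKn -/(b _ _) -/(c _ _) => H.
  have {}H : ('C(m + p, m) * b N m * 1 <= (m + p) ^ 4 * c N (m + p))%N.
    by apply: leq_trans H; rewrite leq_mul2l h_gt0 ?orbT.
  rewrite -mulrA mulrC -ler_pdivrMr ?ltr0n ?fact_gt0 //.
  have -> : per_fact R (b N m) m / p`!%:R = per_fact R (b N m) m * per_fact R 1 (m + p - m).
    by rewrite addKn /per_fact mul1r.
  rewrite per_factM ?leq_addr // -natrX -per_factMl; exact: per_fact_le.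
- by move=> N; rewrite -[leRHS]expr1; apply: perL; have [/andP[_ ba] /(leq_trans ba)] := abL N 1%N.
- by move=> N n; exact: per_fact_ge0.
- by move=> N; rewrite -[leRHS](expr0 L%:R); apply: perL; have [_] := abL N 0%N.
- move=> N n; rewrite -per_factMl; apply: le_trans (per_fact_le R n (num_planar_components R d1 (D N) n)) _.
  rewrite /per_fact natr_sum mulr_suml; apply: ler_sum => m _.
  have mn : (m <= n)%N by rewrite -ltnS.
  rewrite -mulrA (per_factM R _ _ mn) -per_factMl /per_fact.
  have -> : ('C(n, m) * m * b N m * a N (n - m) =
      m * ('C(n, m) * b N m * a N (n - m)))%N.
    by rewrite [('C(n, m) * m)%N]mulnC -!mulnA.
  exact: lexx.
- move=> N n NN Nn; have N1N : (N1 <= N)%N by apply: leq_trans NN; rewrite /N0 -addnA leq_addr.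
  rewrite D2E ?(leq_trans N1N) //; apply: per_fact_le.
  apply: leq_trans (card_planar_graphs_ge R _ 2 _ d1_le5); first by apply/num_rich_le/Dmono.
  by apply: leq_trans Nn; apply: leq_trans NN; rewrite leq_addl.
- move=> n nN; rewrite D2E; last by apply: leq_trans nN; rewrite /N0 -addnA leq_addr.
  exact/per_fact_le/card_planar_graphs_le.
Qed.
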